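(* Let $\Omega$ be a bounded strictly pseudoconvex domain in $\mathbb{C}^n$ with $C^{\infty}$ boundary $\partial\Omega$. For any positive integer $q$ there exist a plurisubharmonic defining function $\rho_q \in C^{\infty}(\overline{\Omega})$ for $\Omega$ and a constant $C$ such that $$\det H(\rho_q)(z) \le C\,\mathrm{dist}(z, \partial\Omega)^q \quad \text{for all } z \in \Omega.$$
   Context: For a real-valued $C^2$ function $u$, $H(u)(z) = \left[\frac{\partial^2 u}{\partial z_i \partial \overline{z}_j}(z)\right]_{1 \le i,j \le n}$ denotes its complex Hessian matrix. $\mathrm{dist}(z,\partial\Omega)$ is the Euclidean distance from $z$ to $\partial\Omega$. A defining function for $\Omega$ in $C^\infty(\overline{\Omega})$ is a real-valued function $\rho \in C^\infty(\overline{\Omega})$ with $\rho < 0$ in $\Omega$, $\rho = 0$ on $\partial\Omega$, and $\nabla\rho \ne 0$ on $\partial\Omega$. The constant $C$ does not depend on $z$. *)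

(* Defs.v *)
From HB Require Import structures.
From mathcomp Require Import all_boot all_order all_algebra.
From mathcomp Require Import complex.
From mathcomp Require Import all_classical all_reals all_analysis.

Set Implicit Arguments.
Unset Strict Implicit.
Unset Printing Implicit Defensive.

Import Order.TTheory GRing.Theory Num.Theory.
Import numFieldNormedType.Exports.

Local Open Scope classical_set_scope.
Local Open Scope ring_scope.
Local Open Scope complex_scope.

(* The space C^n is carried by 'rV[R]_(n + n), as a real normed space: the
   point z has complex coordinates z_j = x_j + i y_j, where x_j is the entry
   lshift n j of z and y_j its entry rshift n j. *)
Definition of_complex_row (R : realType) (n : nat) (w : 'rV[R[i]]_n) :
    'rV[R]_(n + n) :=
  row_mx (map_mx (@complex.Re R) w) (map_mx (@complex.Im R) w).

Section RealCalculus.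
Variables (R : realType) (m : nat).
Implicit Types (f : 'rV[R]_m -> R) (U A : set 'rV[R]_m) (z : 'rV[R]_m).

Definition partial (k : 'I_m) f z : R := 'D_(delta_mx 0 k) f z.

Definition iter_partial (s : seq 'I_m) f : 'rV[R]_m -> R :=
  foldr partial f s.

(* This is C^oo regularity only when U is open. *)
Definition smooth_on U f : Prop :=
  forall (s : seq 'I_m) z, U z ->
    {for z, continuous (iter_partial s f)} /\
    forall k, derivable (iter_partial s f) z (delta_mx 0 k).

(* f (more precisely its restriction to the closure of A) is in
   C^oo(closure A). *)
Definition smooth_up_to_boundary A f : Prop :=
  exists U, [/\ open U, closure A `<=` U & smooth_on U f].

Definition grad f z : 'rV[R]_m := \row_k partial k f z.

Definition boundary A : set 'rV[R]_m := closure A `\` interior A.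

(* The library norm of 'rV[R]_m is the sup norm. *)
Definition enorm z : R := Num.sqrt (\sum_(k < m) z 0 k ^+ 2).

Definition euclidean_dist z A : R := inf [set enorm (z - w) | w in A].

Definition is_domain A : Prop := [/\ open A, connected A & A !=set0].

Definition local_defining_function A (U : set 'rV[R]_m) f : Prop :=
  [/\ open U, smooth_on U f, A `&` U = [set z | U z /\ f z < 0] &
      forall z, U z -> grad f z != 0].

Definition smooth_boundary A : Prop :=
  forall p, boundary A p ->
    exists U f, U p /\ local_defining_function A U f.

Definition smooth_defining_function A f : Prop :=
  [/\ smooth_up_to_boundary A f,
      forall z, A z -> f z < 0,
      forall z, boundary A z -> f z = 0 &
      forall z, boundary A z -> grad f z != 0].

Definition upper_semicontinuous_on A f : Prop :=
  forall z, A z -> forall c : R, f z < c -> \forall w \near z, f w < c.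

End RealCalculus.

Section ComplexCalculus.
Variables (R : realType) (n : nat).
Implicit Types (u : 'rV[R]_(n + n) -> R) (g : 'rV[R]_(n + n) -> R[i]).
Implicit Types (z a p : 'rV[R]_(n + n)) (Omega : set 'rV[R]_(n + n)).

Definition cpartial (k : 'I_(n + n)) g z : R[i] :=
  partial k (fun w => complex.Re (g w)) z +i*
  partial k (fun w => complex.Im (g w)) z.

(* Wirtinger derivatives d/dz_j and d/d(conj z_j). *)
Definition dz (j : 'I_n) g z : R[i] :=
  2^-1 * (cpartial (lshift n j) g z - 'i%C * cpartial (rshift n j) g z).

Definition dzbar (j : 'I_n) g z : R[i] :=
  2^-1 * (cpartial (lshift n j) g z + 'i%C * cpartial (rshift n j) g z).

Definition complex_hessian u z : 'M[R[i]]_n :=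
  \matrix_(i, j) dz i (dzbar j (fun w => (u w)%:C)) z.

Definition levi_form u z (w : 'rV[R[i]]_n) : R[i] :=
  \sum_(i < n) \sum_(j < n) complex_hessian u z i j * w 0 i * (w 0 j)^*%C.

Definition complex_tangent u p (w : 'rV[R[i]]_n) : Prop :=
  \sum_(j < n) dz j (fun z => (u z)%:C) p * w 0 j = 0.

(* In R[i], 0 < c means that c is real and positive. *)
Definition strictly_pseudoconvex Omega : Prop :=
  forall p, boundary Omega p ->
    exists U r, [/\ U p, local_defining_function Omega U r &
      forall w, w != 0 -> complex_tangent r p w -> 0 < levi_form r p w].

(* Upper semicontinuity and the sub-mean value inequality over every closed
   complex disc contained in Omega. *)
Definition plurisubharmonic_on Omega u : Prop :=
  upper_semicontinuous_on Omega u /\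
  forall a (w : 'rV[R[i]]_n),
    (forall c : R[i], `|c| <= 1 -> Omega (a + of_complex_row (c *: w))) ->
    ((u a)%:E <= ((2 * pi)^-1)%:E *
      \int[@lebesgue_measure R]_(t in `[0%R, (2 * pi)%R])
        (u (a + of_complex_row ((cos t +i* sin t) *: w)))%:E)%E.

End ComplexCalculus.

(* Main.v *)
Require Import Defs.
From HB Require Import structures.
From mathcomp Require Import all_boot all_order all_algebra.
From mathcomp Require Import complex ring lra.
From mathcomp Require finmap.
From mathcomp Require Import all_classical all_reals all_analysis.
Set Implicit Arguments.
Unset Strict Implicit.
Unset Printing Implicit Defensive.
Import Order.TTheory GRing.Theory Num.Theory.
Import numFieldNormedType.Exports.
Local Open Scope classical_set_scope.
Local Open Scope ring_scope.
Local Open Scope complex_scope.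

(** The defining function is built in the way of Fefferman, as an approximate
    solution of the homogeneous Monge-Ampere equation near the boundary.

    Local strictly pseudoconvex defining functions, cut off by squares of bump
    functions, are summed to a function [rho] that is smooth on the whole space,
    negative on the domain and strictly pseudoconvex along the boundary
    ([global_defining_function]).  A sum works because at a boundary point the
    gradients of the summands are nonnegative multiples of one vector, so that the
    tangential Levi forms add up.

    Adding [a rho^(k+2)] to a function of the form [rho + g rho^2] changes its
    complex Hessian, modulo [rho^(k+1)], by the multiple
    [(k+2)(k+1) a rho^k] of the rank one matrix [d rho (d rho)*].  The determinant is
    affine along a rank one direction, with a slope that is positive at the
    boundary by strict pseudoconvexity.  Hence the coefficient of [rho^k] in the
    determinant can be prescribed through [a], for k = 0, 1, 2 and so on
    ([monge_ampere_step]), and there is a smooth [g] such that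
    [F = rho + g rho^2] satisfies [det H(F) = (- rho)^q + O(rho^(q+1))]
    ([monge_ampere_approx]).  The congruences modulo powers of [rho] carry smooth
    quotients, so that no function has to be divided by [rho].

    The choice of the sign of the leading term makes [F] plurisubharmonic near the
    boundary.  There [H(F)] is positive definite up to a rank one term, so at most
    one of its eigenvalues is nonpositive, and this one is nonnegative as soon as
    the determinant is ([herm_form_ge0], [levi_quad_ge0]).  Thus inside a collar of
    the boundary [F] has a semipositive Levi form and a determinant of at most
    [2 (- rho)^q] ([collar_solution]).

    The function is extended to the domain ([collar_extension]) and composed with
    a convex function that is constant on the values taken outside the collar and
    is a translation near 0 ([convex_cutoff]).  The result is a global defining
    function with semipositive Levi form.  The submean inequality over circles
    follows by differentiating the circle mean in the radius
    ([circle_mean_ge], [plurisubharmonic_of_levi]).  Since [rho] is Lipschitz and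
    vanishes on the boundary, [- rho] is at most a multiple of the distance
    ([vanishing_le_dist]), which gives the bound near the boundary; elsewhere the
    determinant is bounded and the distance is bounded below. *)

(** * Calculus of smooth functions *)

(** Smoothness in one variable, given by the sequence of all derivatives: this
    form makes a function and its derivative smooth at the same time. *)
Definition smooth1 (R : realType) (h : R -> R) : Prop :=
  exists H : nat -> R -> R,
    H 0%N = h /\ forall k (x : R), is_derive x 1 (H k) (H k.+1 x).

Lemma is_derive_line (R : realType) (V : normedModType R) (f : V -> R) (z v : V)
    (l : R) :
  is_derive (0 : R) 1 (fun t : R => f (t *: v + z)) l <-> is_derive z v f l.
Proof.
have E : 'D_v f z = 'D_1 (fun t : R => f (t *: v + z)) 0.
  rewrite /derive; set g1 := fun h => h^-1 *: _; set g2 := fun h => h^-1 *: _.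
  suff -> : g1 = g2 by [].
  by apply/funext => h; rewrite /g1 /g2 /= addr0 scale0r add0r [_%:A]mulr1.
split=> -[d <-].
  by split; [exact/(derivable1P _ _ _).2 | rewrite E].
by split; [exact/(derivable1P _ _ _).1 | rewrite E].
Qed.

Section SmoothExpr.
Variables (R : realType) (m : nat).
Implicit Types (f g : 'rV[R]_m -> R) (U : set 'rV[R]_m) (z v : 'rV[R]_m).

(** The smallest class that contains the smooth functions and is closed under the
    usual operations.  It is stable under partial derivatives, which yields the
    smoothness of its members without Leibniz or Faa di Bruno formulas for
    iterated derivatives. *)
Inductive smooth_expr U : ('rV[R]_m -> R) -> Prop :=
| se_smooth f : smooth_on U f -> smooth_expr U f
| se_cst c : smooth_expr U (fun=> c)
| se_coord k : smooth_expr U (fun z => z 0 k)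
| se_add f g : smooth_expr U f -> smooth_expr U g ->
    smooth_expr U (fun z => f z + g z)
| se_mul f g : smooth_expr U f -> smooth_expr U g ->
    smooth_expr U (fun z => f z * g z)
| se_inv f : (forall z, U z -> f z != 0) -> smooth_expr U f ->
    smooth_expr U (fun z => (f z)^-1)
| se_comp h f : smooth1 h -> smooth_expr U f ->
    smooth_expr U (fun z => h (f z))
| se_eq f g : smooth_expr U f -> {in U, f =1 g} -> smooth_expr U g.

Lemma partial_derive f z k (l : R) :
  is_derive z (delta_mx 0 k) f l -> partial k f z = l.
Proof. by move=> h; rewrite /partial; apply: derive_val. Qed.

Lemma is_derive_comp1 (h : R -> R) f z v (l l' : R) :
  is_derive (f z) 1 h l -> is_derive z v f l' ->
  is_derive z v (fun z => h (f z)) (l * l').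
Proof.
move=> hl /is_derive_line fl; apply/is_derive_line.
have E : f (0 *: v + z) = f z by rewrite scale0r add0r.
rewrite -E in hl.
have := is_derive1_comp hl fl.
by rewrite mulrC.
Qed.

Lemma is_derive_coord z v (k : 'I_m) : is_derive z v (fun z => z 0 k) (v 0 k).
Proof.
apply/is_derive_line.
have -> : (fun t : R => (t *: v + z) 0 k) =
   (fun t => (v 0 k) *: t) + cst (z 0 k).
  by apply/funext => t; rewrite !mxE !fctE mulrC.
by apply: is_derive_eq; rewrite addr0 scaler1.
Qed.

Lemma smooth_expr_step U f : open U -> smooth_expr U f ->
  (forall z, U z -> {for z, continuous f} /\
     forall k, derivable f z (delta_mx 0 k)) /\
  forall k, smooth_expr U (partial k f).
Proof.
move=> oU; elim=> {f} [f sf|c|k|f g sf [cf pf] sg [cg pg]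
  |f g sf [cf pf] sg [cg pg]|f nf sf [cf pf]|h f [H [<- dH]] sf [cf pf]
  |f g sf [cf pf] fg].
- split=> [z Uz|k]; first exact: (sf [::] z Uz).
  apply: se_smooth => s z Uz; have := sf (rcons s k) z Uz.
  by rewrite /iter_partial foldr_rcons.
- split=> [z Uz|k]; first by split; [exact: cst_continuous|move=> k; exact: derivable_cst].
  by apply: se_eq (se_cst _ 0) _ => z _; apply/esym/partial_derive.
- split=> [z Uz|l].
    split; first exact: coord_continuous.
    by move=> l; have [] := is_derive_coord z (delta_mx 0 l) k.
  apply: se_eq (se_cst _ ((delta_mx 0 l : 'rV[R]_m) 0 k)) _ => z _.
  by apply/esym/partial_derive/is_derive_coord.
- split=> [z Uz|k].
    split; first by apply: continuousD; [case: (cf z Uz)|case: (cg z Uz)].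
    by move=> k; apply: derivableD; [case: (cf z Uz)|case: (cg z Uz)].
  apply: se_eq (se_add (pf k) (pg k)) _ => z /set_mem Uz.
  by apply/esym; rewrite /partial deriveD//; [case: (cf z Uz)|case: (cg z Uz)].
- split=> [z Uz|k].
    split; first by apply: continuousM; [case: (cf z Uz)|case: (cg z Uz)].
    by move=> k; apply: derivableM; [case: (cf z Uz)|case: (cg z Uz)].
  apply: se_eq (se_add (se_mul sf (pg k)) (se_mul sg (pf k))) _ => z /set_mem Uz.
  by apply/esym; rewrite /partial deriveM//; [case: (cf z Uz)|case: (cg z Uz)].
- split=> [z Uz|k].
    split; first by apply: continuousV; [exact: nf|case: (cf z Uz)].
    by move=> k; apply: derivableV; [exact: nf|case: (cf z Uz)].
  have nf2 z : U z -> f z * f z != 0 by move=> Uz; rewrite mulf_neq0 ?nf.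
  apply: se_eq (se_mul (se_cst _ (-1))
     (se_mul (se_inv nf2 (se_mul sf sf)) (pf k))) _ => z /set_mem Uz.
  apply/esym; rewrite /partial deriveV ?nf//; last by case: (cf z Uz).
  by rewrite -[LHS]/(_ * _) expr2 mulN1r mulNr.
- have dc z k : U z -> is_derive z (delta_mx 0 k) (fun z => H 0%N (f z))
      (H 1%N (f z) * partial k f z).
    by move=> Uz; apply: is_derive_comp1 => //; apply/derivableP; case: (cf z Uz).
  split=> [z Uz|k].
    split; last by move=> k; have [] := dc z k Uz.
    apply: continuous_comp; first by case: (cf z Uz).
    by apply/differentiable_continuous/derivable1_diffP; case: (dH 0%N (f z)).
  have s1 : smooth1 (H 1%N) by exists (fun k => H k.+1).
  apply: se_eq (se_mul (se_comp s1 sf) (pf k)) _ => z /set_mem Uz.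
  by apply/esym/partial_derive/dc.
- have nfg z : U z -> {near z, f =1 g}.
    by move=> Uz; near=> w; apply: fg; apply/mem_set; near: w; exact: open_nbhs_nbhs.
  split=> [z Uz|k].
    split; last by move=> k; apply: near_eq_derivable (nfg z Uz) _; case: (cf z Uz).
    have cfz : f @ z --> f z by case: (cf z Uz).
    suff : g @ z --> g z by [].
    rewrite -(fg z) ?inE//; apply: cvg_trans cfz.
    exact: (near_eq_cvg (nfg z Uz)).
  apply: se_eq (pf k) _ => z /set_mem Uz.
  by rewrite /partial; apply: near_eq_derive; exact: nfg.
Unshelve. all: by end_near. Qed.

Lemma smooth_expr_smooth U f : open U -> smooth_expr U f -> smooth_on U f.
Proof.
move=> oU sf s z Uz.
suff sfs : smooth_expr U (iter_partial s f) by exact: (smooth_expr_step oU sfs).1.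
elim: s => //= k s ih; exact: (smooth_expr_step oU ih).2.
Qed.

End SmoothExpr.

Section Smooth.
Variables (R : realType) (m : nat).
Implicit Types (f g : 'rV[R]_m -> R) (z v w : 'rV[R]_m).

Definition smooth f : Prop := smooth_on setT f.

Lemma smooth_of_expr f : smooth_expr setT f -> smooth f.
Proof. by apply: smooth_expr_smooth; exact: openT. Qed.

Lemma smooth_cst (c : R) : smooth (fun=> c).
Proof. by apply: smooth_of_expr; exact: se_cst. Qed.

Lemma smooth_coord k : smooth (fun z => z 0 k).
Proof. by apply: smooth_of_expr; exact: se_coord. Qed.

Lemma smoothD f g : smooth f -> smooth g -> smooth (fun z => f z + g z).
Proof. by move=> sf sg; exact: smooth_of_expr (se_add (se_smooth sf) (se_smooth sg)). Qed.

Lemma smoothM f g : smooth f -> smooth g -> smooth (fun z => f z * g z).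
Proof. by move=> sf sg; exact: smooth_of_expr (se_mul (se_smooth sf) (se_smooth sg)). Qed.

Lemma smoothN f : smooth f -> smooth (fun z => - f z).
Proof.
move=> sf; have := smoothM (smooth_cst (-1)) sf.
by under eq_fun do rewrite mulN1r.
Qed.

Lemma smoothB f g : smooth f -> smooth g -> smooth (fun z => f z - g z).
Proof. by move=> sf sg; exact: smoothD sf (smoothN sg). Qed.

Lemma smoothX f n : smooth f -> smooth (fun z => f z ^+ n).
Proof.
move=> sf; elim: n => [|n ih]; first exact: smooth_cst.
by under eq_fun do rewrite exprS; exact: smoothM.
Qed.

Lemma smoothV f : (forall z, f z != 0) -> smooth f -> smooth (fun z => (f z)^-1).
Proof. by move=> nf sf; apply: smooth_of_expr; apply: se_inv => //; exact: se_smooth. Qed.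

Lemma smooth_comp h f : smooth1 h -> smooth f -> smooth (fun z => h (f z)).
Proof. by move=> sh sf; apply: smooth_of_expr; apply: se_comp => //; exact: se_smooth. Qed.

Lemma smooth_sum I (r : seq I) (P : pred I) (F : I -> 'rV[R]_m -> R) :
  (forall i, smooth (F i)) -> smooth (fun z => \sum_(i <- r | P i) F i z).
Proof.
move=> sF; elim: r => [|i r ih].
  by under eq_fun do rewrite big_nil; exact: smooth_cst.
under eq_fun do rewrite big_cons.
by case: (P i); [exact: smoothD (sF i) ih|exact: ih].
Qed.

Lemma smooth_prod I (r : seq I) (P : pred I) (F : I -> 'rV[R]_m -> R) :
  (forall i, smooth (F i)) -> smooth (fun z => \prod_(i <- r | P i) F i z).
Proof.
move=> sF; elim: r => [|i r ih].
  by under eq_fun do rewrite big_nil; exact: smooth_cst.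
under eq_fun do rewrite big_cons.
by case: (P i); [exact: smoothM (sF i) ih|exact: ih].
Qed.

Lemma smooth_partial k f : smooth f -> smooth (partial k f).
Proof.
move=> sf s z _; have := sf (rcons s k) z I.
by rewrite /iter_partial foldr_rcons.
Qed.

Lemma near_eq_partial f g k z : (\forall w \near z, f w = g w) ->
  partial k f z = partial k g z.
Proof. exact: near_eq_derive. Qed.

Lemma smooth_continuous f : smooth f -> continuous f.
Proof. by move=> sf z; have [] := sf [::] z I. Qed.

Lemma smooth_derive_partial f z k : smooth f ->
  is_derive z (delta_mx 0 k) f (partial k f z).
Proof. by move=> sf; apply/derivableP; have [_] := sf [::] z I; exact. Qed.

Lemma is_derive_line_at f v (a : 'rV[R]_m -> R) z (t : R) :
  (forall z, is_derive z v f (a z)) ->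
  is_derive t 1 (fun t : R => f (t *: v + z)) (a (t *: v + z)).
Proof.
move=> fa; apply/is_derive_line.
have /is_derive_line := fa (t *: v + z).
by congr is_derive; apply/funext => s; rewrite [s *: 1]mulr1 scalerDl addrA.
Qed.

Lemma is_derive_scale_dir f v z (c l : R) :
  is_derive z v f l -> is_derive z (c *: v) f (c * l).
Proof.
move=> /is_derive_line fl; apply/is_derive_line.
have -> : (fun t : R => f (t *: (c *: v) + z)) =
  (fun t : R => f (t *: v + z)) \o (fun t => c *: t).
  by apply/funext => t /=; rewrite scalerA mulrC.
rewrite mulrC; apply: is_derive1_comp; first by rewrite scaler0.
by apply: is_derive_eq; rewrite [c *: 1]mulr1.
Qed.

Lemma continuous_two_dir f v w z (e : R) : 0 < e -> {for z, continuous f} ->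
  exists2 h, 0 < h & forall c d, `|c| <= h -> `|d| <= h ->
    `|f z - f (c *: v + d *: w + z)| < e.
Proof.
move=> e0 /cvgrPdist_lt /(_ e e0) /nbhs_ballP[r /= r0 rf].
pose K := `|v| + `|w| + 1.
have K0 : 0 < K by rewrite ltr_wpDl// addr_ge0.
exists (r / K / 2); first by rewrite !divr_gt0.
move=> c d ch dh; apply: rf; rewrite -ball_normE /= opprD addrC subrK normrN.
apply: le_lt_trans (ler_normD _ _) _; rewrite !normrZ.
have : `|c| * `|v| + `|d| * `|w| <= r / K / 2 * K.
  have q0 : 0 < r / K / 2 by rewrite !divr_gt0.
  have A := ler_wpM2r (normr_ge0 v) ch; have B := ler_wpM2r (normr_ge0 w) dh.
  move: (r / K / 2) q0 A B => q q0 A B; rewrite /K !mulrDr mulr1; lra.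
move/le_lt_trans; apply.
by rewrite mulrAC divfK ?gt_eqF// ltr_pdivrMr// mulr_natr mulr2n ltrDl.
Qed.

(** Additivity of directional derivatives in the direction.  The increment along
    [v + w] is an increment along [v] followed by one along [w] from a moved base
    point; the mean value theorem and the continuity of the derivative along [w]
    absorb the move. *)
Lemma is_derive_add_dir f v w (a b : 'rV[R]_m -> R) :
  (forall z, is_derive z v f (a z)) -> (forall z, is_derive z w f (b z)) ->
  continuous b -> forall z, is_derive z (v + w) f (a z + b z).
Proof.
move=> fa fb cb z.
suff cv : h^-1 *: (f (h *: (v + w) + z) - f z) @[h --> (0:R)^'] --> a z + b z.
  by split; [apply/cvg_ex; exists (a z + b z) | exact: cvg_lim].
have -> : (fun h : R => h^-1 *: (f (h *: (v + w) + z) - f z)) =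
   (fun h : R => h^-1 *: (f (h *: v + z) - f z) +
      h^-1 *: (f (h *: w + (h *: v + z)) - f (h *: v + z))).
  apply/funext => h; rewrite -scalerDr; congr (_ *: _).
  have -> : h *: (v + w) + z = h *: w + (h *: v + z).
    by rewrite scalerDr addrA [h *: w + _]addrC.
  ring.
apply: cvgD; first by have [/cvgP d <-] := fa z; exact: d.
apply/cvgrPdist_lt => e e0.
have [h h0 hP] := continuous_two_dir v w e0 (cb z).
near=> t.
have th : `|t| <= h by near: t; apply: dnbhs0_le.
have t0 : t != 0 by near: t; exact: nbhs_dnbhs_neq.
pose F (s : R) := f ((s * t) *: w + (t *: v + z)).
have dF (s : R) : is_derive s 1 F (b ((s * t) *: w + (t *: v + z)) * t).
  have -> : F = (fun s : R => f (s *: w + (t *: v + z))) \o (fun s => t *: s).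
    by apply/funext => u; rewrite /F /= mulrC.
  apply: is_derive1_comp; last by apply: is_derive_eq; rewrite [t *: 1]mulr1.
  by rewrite mulrC; exact: is_derive_line_at.
have cF : {within `[0, 1], continuous F}.
  by apply: derivable_within_continuous => s _; case: (dF s).
have [c c01 Fc] := MVT ltr01 (fun s _ => dF s) cF.
have -> : f (t *: w + (t *: v + z)) - f (t *: v + z) = F 1 - F 0.
  by rewrite /F mul1r mul0r scale0r add0r.
rewrite Fc subr0 mulr1 -[_ *: _]/(_ * _) mulrC mulfK// addrA.
rewrite [_ + t *: v]addrC; apply: hP => //.
rewrite normrM -[leRHS]mul1r ler_pM//.
by move: c01; rewrite in_itv/= => /andP[c0 c1]; rewrite ger0_norm ltW.
Unshelve. all: by end_near. Qed.

Lemma smooth_is_derive f z v : smooth f ->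
  is_derive z v f (\sum_k v 0 k * partial k f z).
Proof.
move=> sf.
have main (s : seq 'I_m) z' : is_derive z' (\sum_(k <- s) v 0 k *: delta_mx 0 k) f
    (\sum_(k <- s) v 0 k * partial k f z').
  elim: s z' => [|k s ih] z'; first by rewrite !big_nil; exact: is_derive0.
  rewrite !big_cons.
  apply: (is_derive_add_dir (a := fun z => v 0 k * partial k f z)
     (b := fun z => \sum_(k <- s) v 0 k * partial k f z)) => //.
  - by move=> y; apply: is_derive_scale_dir; exact: smooth_derive_partial.
  - apply: smooth_continuous; apply: smooth_sum => l.
    by apply: smoothM; [exact: smooth_cst|exact: smooth_partial].
have -> : v = \sum_k v 0 k *: delta_mx 0 k.
  by rewrite {1}(row_sum_delta v).
have -> : \sum_k (\sum_k v 0 k *: delta_mx 0 k : 'rV[R]_m) 0 k * partial k f z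
  = \sum_k v 0 k * partial k f z by rewrite -row_sum_delta.
exact: main.
Qed.

(** The mean value theorem, used once in each direction. *)
Lemma second_difference f k l z (h : R) : smooth f -> 0 < h ->
  exists c d, [/\ `|c| <= h, `|d| <= h &
   f (h *: delta_mx 0 k + (h *: delta_mx 0 l + z)) - f (h *: delta_mx 0 k + z)
   - (f (h *: delta_mx 0 l + z) - f z) =
   h ^+ 2 * partial l (partial k f) (c *: delta_mx 0 k + d *: delta_mx 0 l + z)].
Proof.
move=> sf h0.
set dk := delta_mx 0 k; set dl := delta_mx 0 l.
have D g u y (s : R) : smooth g -> is_derive s 1 (fun s : R => g (s *: delta_mx 0 u + y))
   (partial u g (s *: delta_mx 0 u + y)).
  by move=> sg; apply: is_derive_line_at => x; exact: smooth_derive_partial.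
pose F := (fun s : R => f (s *: dk + (h *: dl + z))) - (fun s => f (s *: dk + z)).
have dF (s : R) : is_derive s 1 F (partial k f (s *: dk + (h *: dl + z)) -
    partial k f (s *: dk + z)).
  by apply: is_deriveB; exact: D.
have cF : {within `[0, h], continuous F}.
  by apply: derivable_within_continuous => s _; case: (dF s).
have [c ch Fc] := MVT h0 (fun s _ => dF s) cF.
pose G := (fun s : R => partial k f (s *: dl + (c *: dk + z))).
have dG (s : R) : is_derive s 1 G (partial l (partial k f) (s *: dl + (c *: dk + z))).
  by apply: D; exact: smooth_partial.
have cG : {within `[0, h], continuous G}.
  by apply: derivable_within_continuous => s _; case: (dG s).
have [d dh Gd] := MVT h0 (fun s _ => dG s) cG.
exists c, d; split.
- by move: ch; rewrite in_itv/= => /andP[c0 c1]; rewrite ger0_norm ltW.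
- by move: dh; rewrite in_itv/= => /andP[c0 c1]; rewrite ger0_norm ltW.
have -> : f (h *: dk + (h *: dl + z)) - f (h *: dk + z) -
  (f (h *: dl + z) - f z) = F h - F 0.
  by rewrite /F !fctE !scale0r !add0r.
rewrite Fc subr0 (_ : _ - _ = G h - G 0); last first.
  by rewrite /G scale0r add0r addrCA.
rewrite Gd subr0 -mulrA -expr2 mulrC; congr (_ * partial _ _ _).
by rewrite addrA [d *: _ + _]addrC.
Qed.

(** The second difference over a small square is symmetric in the two
    directions, so that mixed derivatives in both orders agree at points that
    tend to [z]. *)
Lemma partialC f k l z : smooth f -> partial k (partial l f) z = partial l (partial k f) z.
Proof.
move=> sf; apply/eqP; rewrite -subr_eq0 -normr_le0; apply/ler_addgt0Pr => e e0.
have e2 : 0 < e / 2 by rewrite divr_gt0.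
have ckl : {for z, continuous (partial k (partial l f))}.
  by apply: smooth_continuous; do 2 apply: smooth_partial.
have clk : {for z, continuous (partial l (partial k f))}.
  by apply: smooth_continuous; do 2 apply: smooth_partial.
have [h1 h10 hP1] := continuous_two_dir (delta_mx 0 l) (delta_mx 0 k) e2 ckl.
have [h2 h20 hP2] := continuous_two_dir (delta_mx 0 k) (delta_mx 0 l) e2 clk.
pose h := Num.min h1 h2.
have h0 : 0 < h by rewrite lt_min h10.
have [c1 [d1 [c1h d1h E1]]] := second_difference l k z sf h0.
have [c2 [d2 [c2h d2h E2]]] := second_difference k l z sf h0.
have hh1 : h <= h1 by rewrite ge_min lexx.
have hh2 : h <= h2 by rewrite ge_min lexx orbT.
have {}hP1 := hP1 _ _ (le_trans c1h hh1) (le_trans d1h hh1).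
have {}hP2 := hP2 _ _ (le_trans c2h hh2) (le_trans d2h hh2).
have E : partial k (partial l f) (c1 *: delta_mx 0 l + d1 *: delta_mx 0 k + z) =
  partial l (partial k f) (c2 *: delta_mx 0 k + d2 *: delta_mx 0 l + z).
  apply: (mulfI (lt0r_neq0 (exprn_gt0 2 h0))).
  refine (etrans (esym E1) (etrans _ E2)); rewrite addrCA.
  set x1 := f _; set x2 := f _; set x3 := f _; set x4 := f _.
  by move: x1 x2 x3 x4 => x1 x2 x3 x4; ring.
rewrite E in hP1; rewrite add0r.
move: hP1 hP2; set a := partial k _ z; set b := partial l _ z; set x := partial l _ _.
clearbody a b x; move=> A B; have -> : a - b = (a - x) - (b - x) by ring.
apply: le_trans (ler_normB _ _) _; apply/ltW; rewrite [e]splitr; exact: ltrD.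
Qed.

End Smooth.

(** * Smooth cutoff functions *)

Section Cutoff1.
Variable R : realType.
Implicit Types (a b t x y : R) (p : {poly R}).

(** The polynomial factor makes the class of these functions closed under
    derivation. *)
Definition flat_exp p x : R := if 0 < x then p.[x^-1] * expR (- x^-1) else 0.

Lemma exprn_le_expR n y : 0 <= y -> y ^+ n <= n`!%:R * expR y.
Proof.
move=> y0; case: n => [|n]; first by rewrite expr0 fact0 mul1r -expR0 ler_expR.
have k0 : 0 < (n.+1)`!%:R :> R by rewrite ltr0n fact_gt0.
rewrite mulrC -ler_pdivrMr//; apply: le_trans (expR_ge1Dxn n y0).
by rewrite lerDr.
Qed.

Lemma horner_le_expR p : exists C, forall y, 0 <= y -> `|p.[y]| <= C * expR y.
Proof.
exists (\sum_(i < size p) `|p`_i| * i`!%:R) => y y0.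
rewrite horner_coef mulr_suml; apply: le_trans (ler_norm_sum _ _ _) _.
apply: ler_sum => i _; rewrite normrM -mulrA ler_wpM2l//.
by rewrite ger0_norm ?exprn_ge0//; exact: exprn_le_expR.
Qed.

Lemma is_derive_horner p x : is_derive x 1 (horner p) p^`().[x].
Proof.
split; first exact: derivable_horner.
by rewrite -derive1E derivE.
Qed.

(** Away from 0 this is the chain rule; at 0 the difference quotient tends to 0
    because the exponential beats every polynomial in [1/x]. *)
Lemma is_derive_flat_exp p x :
  is_derive x 1 (flat_exp p) (flat_exp ('X^2 * (p - p^`())) x).
Proof.
have [x0|x0|->] := ltgtP x 0.
- have E : \forall y \near x, cst 0 y = flat_exp p y.
    near=> y; rewrite /flat_exp ltNge ltW//=.
    by near: y; exact: lt_nbhsl.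
  apply: near_eq_is_derive E _.
  by rewrite /flat_exp ltNge ltW//=; exact: is_derive_cst.
- have E : \forall y \near x, p.[y^-1] * expR (- y^-1) = flat_exp p y.
    near=> y; rewrite /flat_exp ifT//.
    by near: y; exact: lt_nbhsr.
  apply: near_eq_is_derive E _.
  rewrite /flat_exp x0.
  have xn0 : x != 0 by rewrite gt_eqF.
  have dv : is_derive x 1 (fun y : R => y^-1) (- x ^- 2).
    split; first by apply: derivableV.
    by rewrite deriveV// derive_id [LHS]mulr1.
  have d1 : is_derive x 1 (fun y : R => p.[y^-1]) (p^`().[x^-1] * - x ^- 2).
    exact: (is_derive1_comp (is_derive_horner p x^-1) dv).
  have d2 : is_derive x 1 (fun y : R => expR (- y^-1)) (expR (- x^-1) * x ^- 2).
    have dv' : is_derive x 1 (fun y : R => - y^-1) (x ^- 2).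
      by rewrite -[x ^- 2]opprK; exact: is_deriveN.
    have de : is_derive (- x^-1) 1 (@expR R) (expR (- x^-1)) by exact: is_derive_expR.
    have := @is_derive1_comp R (@expR R) (fun y : R => - y^-1) x _ _ de dv'.
    exact.
  apply: is_derive_eq (is_deriveM d1 d2) _.
  rewrite -![_ *: _]/(_ * _) !hornerE /= exprVn; ring.
- have [C hC] := horner_le_expR ('X^2 * p).
  have C0 : 0 <= C by have := hC 0 (lexx 0); rewrite expR0 mulr1; exact: le_trans.
  rewrite {2}/flat_exp ltxx.
  suff cv : h^-1 *: (flat_exp p (h *: 1 + 0) - flat_exp p 0) @[h --> (0:R)^'] --> (0 : R).
    by split; [apply/cvg_ex; exists 0 | exact: cvg_lim].
  apply/cvgrPdist_le => e e0; near=> h.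
  rewrite addr0 [h *: 1]mulr1 {2}/flat_exp ltxx subr0 sub0r normrN -[_ *: _]/(_ * _).
  rewrite /flat_exp; case: ifPn => [h0|_]; last by rewrite mulr0 normr0 ltW.
  have hi : 0 <= h^-1 by rewrite invr_ge0 ltW.
  have := hC _ hi; rewrite hornerM hornerXn normrM ger0_norm ?exprn_ge0// => H.
  rewrite !normrM [`|expR _|]ger0_norm ?expR_ge0// [`|h^-1|]ger0_norm//.
  rewrite mulrA expRN ler_pdivrMr ?expR_gt0//.
  have -> : h^-1 * `|p.[h^-1]| = h * (h^-1 ^+ 2 * `|p.[h^-1]|).
    by rewrite expr2; field; rewrite gt_eqF.
  apply: le_trans (ler_wpM2l (ltW h0) H) _; rewrite mulrA ler_wpM2r ?expR_ge0//.
  have : `|h| <= e / (C + 1).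
    by near: h; apply: dnbhs0_le; rewrite divr_gt0// ltr_wpDl.
  rewrite gtr0_norm// ler_pdivlMr ?ltr_wpDl// mulrDr mulr1 => hh.
  by apply: le_trans hh; rewrite lerDl ltW.
Unshelve. all: by end_near. Qed.

Lemma smooth1_flat_exp p : smooth1 (flat_exp p).
Proof.
exists (fun k => flat_exp (iter k (fun p => 'X^2 * (p - p^`())) p)); split => // k x.
exact: is_derive_flat_exp.
Qed.

(** Transfers the closure properties of smooth functions on row vectors to
    functions of one variable. *)
Lemma smooth1_line (f : 'rV[R]_1 -> R) : smooth f ->
  smooth1 (fun t => f (t *: delta_mx 0 0)).
Proof.
move=> sf.
exists (fun k t => iter k (partial 0) f (t *: delta_mx 0 0)); split=> // k x.
have := @is_derive_line_at R 1 (iter k (partial 0) f) (delta_mx 0 0)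
   (iter k.+1 (partial 0) f) 0 x.
rewrite addr0; under eq_fun do rewrite addr0; apply => z.
have sk : smooth (iter k (partial 0) f) by elim: k => [//|k ih]; exact: smooth_partial.
exact: (smooth_derive_partial z 0 sk).
Qed.

Definition step a b t : R :=
  flat_exp 1 (t - a) / (flat_exp 1 (t - a) + flat_exp 1 (b - t)).

Lemma flat_exp_ge0 x : 0 <= flat_exp 1 x.
Proof. by rewrite /flat_exp; case: ifP => // _; rewrite hornerE ?mul1r expR_ge0. Qed.

Lemma flat_exp_gt0 x : 0 < x -> 0 < flat_exp 1 x.
Proof. by rewrite /flat_exp => ->; rewrite hornerE ?mul1r expR_gt0. Qed.

Lemma flat_exp_eq0 p x : x <= 0 -> flat_exp p x = 0.
Proof. by rewrite /flat_exp ltNge => ->. Qed.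

Lemma flat_exp_le x y : x <= y -> flat_exp 1 x <= flat_exp 1 y.
Proof.
move=> xy; have [x0|x0] := leP x 0; first by rewrite flat_exp_eq0// flat_exp_ge0.
rewrite /flat_exp x0 (lt_le_trans x0 xy) !hornerE ?mul1r ler_expR lerN2.
by rewrite lef_pV2// posrE// (lt_le_trans x0 xy).
Qed.

Lemma step_den_gt0 a b t : a < b -> 0 < flat_exp 1 (t - a) + flat_exp 1 (b - t).
Proof.
move=> ab; have [ta|ta] := leP t a.
  by rewrite ltr_wpDl ?flat_exp_ge0// flat_exp_gt0// subr_gt0 (le_lt_trans ta).
by rewrite ltr_wpDr ?flat_exp_ge0// flat_exp_gt0// subr_gt0.
Qed.

Lemma step_ge0 a b t : a < b -> 0 <= step a b t.
Proof. by move=> ab; rewrite divr_ge0 ?flat_exp_ge0// ltW// step_den_gt0. Qed.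

Lemma step_le1 a b t : a < b -> step a b t <= 1.
Proof.
by move=> ab; rewrite ler_pdivrMr ?step_den_gt0// mul1r lerDl flat_exp_ge0.
Qed.

Lemma step0 a b t : t <= a -> step a b t = 0.
Proof. by move=> ta; rewrite /step flat_exp_eq0 ?subr_le0// mul0r. Qed.

Lemma step1 a b t : a < b -> b <= t -> step a b t = 1.
Proof.
move=> ab bt; rewrite /step [flat_exp 1 (b - t)]flat_exp_eq0 ?subr_le0// addr0.
by rewrite divff// gt_eqF// flat_exp_gt0// subr_gt0 (lt_le_trans ab).
Qed.

Lemma step_le a b s t : a < b -> s <= t -> step a b s <= step a b t.
Proof.
move=> ab st; rewrite /step ler_pdivrMr ?step_den_gt0// mulrAC.
rewrite ler_pdivlMr ?step_den_gt0// !mulrDr [X in _ <= X]addrC.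
rewrite [X in X <= _]addrC lerD//; last by rewrite mulrC.
by rewrite ler_pM ?flat_exp_ge0// flat_exp_le// lerB.
Qed.

Lemma smooth1_step a b : a < b -> smooth1 (step a b).
Proof.
move=> ab; suff : smooth (fun z : 'rV[R]_1 => step a b (z 0 0)).
  move/smooth1_line; congr smooth1; apply/funext => t.
  by rewrite !mxE eqxx mulr1.
have sA : smooth (fun z : 'rV[R]_1 => flat_exp 1 (z 0 0 - a)).
  apply: smooth_comp; first exact: smooth1_flat_exp.
  by apply: smoothB; [exact: smooth_coord|exact: smooth_cst].
have sB : smooth (fun z : 'rV[R]_1 => flat_exp 1 (b - z 0 0)).
  apply: smooth_comp; first exact: smooth1_flat_exp.
  by apply: smoothB; [exact: smooth_cst|exact: smooth_coord].
have D0 (z : 'rV[R]_1) : flat_exp 1 (z 0 0 - a) + flat_exp 1 (b - z 0 0) != 0.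
  by rewrite gt_eqF// step_den_gt0.
exact: (smoothM sA (smoothV D0 (smoothD sA sB))).
Qed.

Lemma smooth1_continuous (h : R -> R) : smooth1 h -> continuous h.
Proof.
move=> [H [<- dH]] x; apply/differentiable_continuous/derivable1_diffP.
by case: (dH 0%N x).
Qed.

(** The fundamental theorem of calculus on bounded intervals; the vanishing on the
    left makes the base point [a - 1] work for the whole line. *)
Lemma continuous_primitive (f : R -> R) a : continuous f ->
  (forall t, t <= a -> f t = 0) -> exists F : R -> R, forall t, is_derive t 1 F (f t).
Proof.
move=> cf f0.
pose F x := (\int[@lebesgue_measure R]_(t in [set` `[a - 1, x]]) (f t))%R.
exists F => t.
have [ta|lat] := ltP t a.
  have E : \forall y \near t, cst 0 y = F y.
    near=> y; rewrite /F /Rintegral integral0_eq// => x.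
    rewrite /= in_itv/= => /andP[_ xy]; rewrite f0//.
    apply: le_trans xy _; apply: ltW.
    by near: y; exact: lt_nbhsl.
  by apply: near_eq_is_derive E _; rewrite f0 ?ltW//; exact: is_derive_cst.
have t1 : t < t + 1 by rewrite ltrDl.
have a1 : a - 1 < t by rewrite (lt_le_trans _ lat)// ltrBlDr ltrDl.
have fi : (@lebesgue_measure R).-integrable `[a - 1, t + 1] (EFin \o f).
  apply: continuous_compact_integrable; first exact: segment_compact.
  exact: continuous_subspaceT.
have [dF FE] := continuous_FTC1_closed t1 fi a1 (cf t).
apply: DeriveDef; first exact: dF.
rewrite -derive1E; exact: FE.
Unshelve. all: by end_near. Qed.

(** The primitive of a smooth step.  Composition with this convex nondecreasing
    function preserves plurisubharmonicity, turns a function into a constant where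
    it is less than [a], and changes it by a constant where it is greater than
    [b]. *)
Lemma convex_cutoff a b : a < b -> b < 0 -> exists H : nat -> R -> R,
  [/\ forall k (x : R), is_derive x 1 (H k) (H k.+1 x),
      H 0%N 0 = 0, forall t, t < 0 -> H 0%N t < 0,
      forall t, (0 <= H 1%N t) && (0 <= H 2%N t) &
      forall t, (t < a -> H 1%N t = 0 /\ H 2%N t = 0) /\
        (b < t -> H 1%N t = 1 /\ H 2%N t = 0)].
Proof.
move=> ab b0; have ss := smooth1_step ab.
have [F dF] := continuous_primitive (smooth1_continuous ss) (@step0 a b).
have [S [S0 dS]] := ss.
pose H k := if k is k'.+1 then S k' else F - cst (F 0).
have dH k (x : R) : is_derive x 1 (H k) (H k.+1 x).
  case: k => [|k] /=; last exact: dS.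
  rewrite S0 -[step a b x]subr0; apply: is_deriveB.
have mv s t : s < t -> exists2 c, s < c < t & H 0%N t - H 0%N s = step a b c * (t - s).
  move=> st; have c : {within `[s, t], continuous (H 0%N)}.
    by apply: derivable_within_continuous => y _; case: (dH 0%N y).
  have [c' scc E] := MVT st (fun y _ => dH 0%N y) c.
  by exists c'; [move: scc; rewrite in_itv | rewrite E /= S0].
have H0 : H 0%N 0 = 0 by rewrite /= !fctE subrr.
have near0 (c t : R) : (\forall y \near t, cst c y = H 1%N y) -> H 2%N t = 0.
  move=> E; have [_ <-] := dH 1%N t.
  by rewrite -(near_eq_derive (1 : R) E) derive_cst.
have Hlt t : b <= t -> t < 0 -> H 0%N t < 0.
  move=> bt t0; have [c /andP[tc c0]] := mv _ _ t0.
  rewrite H0 sub0r step1// ?mul1r ?sub0r; last exact: le_trans (ltW tc).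
  by move=> /oppr_inj ->.
exists H; split=> //.
- move=> t t0; have [bt|tb] := leP b t; first exact: Hlt.
  have [c _ E] := mv _ _ tb; apply: le_lt_trans (Hlt b (lexx b) b0).
  by rewrite -subr_ge0 E mulr_ge0 ?step_ge0// subr_ge0 ltW.
- move=> t; apply/andP; split; first by rewrite /= S0 step_ge0.
  have [d <-] := dH 1%N t; apply: limr_ge; first exact: d.
  near=> h; rewrite /= S0 -[_ *: _]/(_ * _) [h *: 1]mulr1.
  have [h0|h0] := leP 0 h.
    by rewrite mulr_ge0 ?invr_ge0// subr_ge0 step_le// lerDr.
  by rewrite mulr_le0 ?invr_le0 ?(ltW h0)// subr_le0 step_le// gerDr ltW.
- move=> t; split=> ta; split.
  + by rewrite /= S0 step0// ltW.
  + apply: (near0 0); near=> y; rewrite /= S0 step0// ltW//.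
    by near: y; exact: lt_nbhsl.
  + by rewrite /= S0 step1// ltW.
  + apply: (near0 1); near=> y; rewrite /= S0 step1// ltW//.
    by near: y; exact: lt_nbhsr.
Unshelve. all: by end_near. Qed.

End Cutoff1.

Section Bump.
Variables (R : realType) (m : nat).
Implicit Types (p z : 'rV[R]_m) (U : set 'rV[R]_m).

Lemma nbhs_box p (P : set 'rV[R]_m) : nbhs p P ->
  exists2 e : R, 0 < e & forall z, (forall k, `|z 0 k - p 0 k| < e) -> P z.
Proof.
move=> /nbhs_ballP[e /= e0 eP]; exists e => // z zP; apply: eP; split=> // i j.
by rewrite -ball_normE /= (ord1 i) distrC.
Qed.

(** A product over the coordinates of smooth steps on both sides of [p]. *)
Lemma smooth_bump U p : open U -> U p -> exists chi : 'rV[R]_m -> R,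
  [/\ smooth chi, forall z, 0 <= chi z, \forall z \near p, chi z = 1 &
      forall z, ~ U z -> \forall w \near z, chi w = 0].
Proof.
move=> oU Up; have [e e0 eU] := nbhs_box (open_nbhs_nbhs (conj oU Up)).
pose tau (t : R) := step (- (e / 2)) (- (e / 4)) t.
have ab : - (e / 2) < - (e / 4) by lra.
exists (fun z => \prod_k (tau (z 0 k - p 0 k) * tau (p 0 k - z 0 k))); split.
- apply: smooth_prod => k; apply: smoothM; apply: smooth_comp;
    try exact: smooth1_step; apply: smoothB; by [exact: smooth_coord|exact: smooth_cst].
- by move=> z; apply: prodr_ge0 => k _; rewrite mulr_ge0 ?step_ge0.
- have e4 : 0 < e / 4 by lra.
  near=> z; have [_ bz] : ball p (e / 4) z by near: z; exact: nbhsx_ballx.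
  apply: big1 => k _; have := bz 0 k; rewrite -ball_normE /=.
  rewrite ltr_norml => /andP[h1 h2]; rewrite /tau !step1// ?mulr1//; lra.
- move=> z Uz.
  have [k hk] : exists k, e <= `|z 0 k - p 0 k|.
    apply: contrapT => /forallNP H; apply: Uz; apply: eU => k.
    by rewrite ltNge; apply/negP/H.
  have e2 : 0 < e / 2 by lra.
  near=> w; have [_ bw] : ball z (e / 2) w by near: w; exact: nbhsx_ballx.
  rewrite (bigD1 k)//=; have := bw 0 k; rewrite -ball_normE /=.
  rewrite ltr_norml => /andP[h1 h2].
  rewrite (_ : tau _ * tau _ = 0) ?mul0r//.
  move: hk; rewrite lter_normr => /orP[h|h].
    by rewrite [X in _ * X]/tau step0 ?mulr0//; lra.
  by rewrite [X in X * _]/tau step0 ?mul0r//; lra.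
Unshelve. all: by end_near. Qed.

End Bump.

(** * Complex Hessians *)

(* Unification must not unfold partial derivatives into limits of difference
   quotients. *)
Opaque partial.

Section PartialRules.
Variables (R : realType) (m : nat).
Implicit Types (f g : 'rV[R]_m -> R) (z : 'rV[R]_m) (k l : 'I_m).

Lemma partialD f g k z : smooth f -> smooth g ->
  partial k (fun z => f z + g z) z = partial k f z + partial k g z.
Proof.
move=> sf sg; apply: partial_derive.
exact: (is_deriveD (smooth_derive_partial z k sf) (smooth_derive_partial z k sg)).
Qed.

Lemma partialM f g k z : smooth f -> smooth g ->
  partial k (fun z => f z * g z) z = f z * partial k g z + g z * partial k f z.
Proof.
move=> sf sg; apply: partial_derive.
exact: (is_deriveM (smooth_derive_partial z k sf) (smooth_derive_partial z k sg)).
Qed.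

Lemma partial_cst (c : R) k z : partial k (fun=> c) z = 0.
Proof. by apply: partial_derive; exact: is_derive_cst. Qed.

Lemma partialZ c f k z : smooth f ->
  partial k (fun z => c * f z) z = c * partial k f z.
Proof.
move=> sf; refine (etrans (partialM k z (smooth_cst c) sf) _).
by rewrite (partial_cst c k z) mulr0 addr0.
Qed.

Lemma partial_comp (h : R -> R) (h' : R) f k z : smooth f ->
  is_derive (f z) 1 h h' -> partial k (fun z => h (f z)) z = h' * partial k f z.
Proof.
move=> sf dh; apply: partial_derive.
exact: (is_derive_comp1 dh (smooth_derive_partial z k sf)).
Qed.

Lemma partialX f n k z : smooth f ->
  partial k (fun z => f z ^+ n) z = n%:R * f z ^+ n.-1 * partial k f z.
Proof.
move=> sf; apply: (partial_comp (h := fun x => x ^+ n)) => //.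
apply: DeriveDef; first exact: exprn_derivable.
by rewrite exp_derive -[RHS]mulr1.
Qed.

(** Equality near a point propagates to the partial derivatives near it. *)
Lemma near_eq_partial2 f g k l z : (\forall w \near z, f w = g w) ->
  partial k (partial l f) z = partial k (partial l g) z.
Proof.
move=> fg; apply: near_eq_partial.
have : \forall w \near z, \forall w' \near w, f w' = g w' by exact: near_join.
by apply: filterS => w; exact: near_eq_partial.
Qed.

Definition hess f z k l : R := partial k (partial l f) z.

Lemma smooth_hess f k l : smooth f -> smooth (fun z => hess f z k l).
Proof. by move=> sf; do 2 apply: smooth_partial. Qed.

Lemma hessC f z k l : smooth f -> hess f z k l = hess f z l k.
Proof. exact: partialC. Qed.

Lemma hessD f g z k l : smooth f -> smooth g ->
  hess (fun z => f z + g z) z k l = hess f z k l + hess g z k l.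
Proof.
move=> sf sg; rewrite /hess.
have -> : partial l (fun z => f z + g z) = fun w => partial l f w + partial l g w.
  by apply/funext => w; exact: partialD.
exact: partialD (smooth_partial l sf) (smooth_partial l sg).
Qed.

Lemma hessM f g z k l : smooth f -> smooth g ->
  hess (fun z => f z * g z) z k l =
  f z * hess g z k l + partial k f z * partial l g z +
  partial k g z * partial l f z + g z * hess f z k l.
Proof.
move=> sf sg; rewrite /hess.
have -> : partial l (fun z => f z * g z) =
    fun w => f w * partial l g w + g w * partial l f w.
  by apply/funext => w; exact: partialM.
have sf' := smooth_partial l sf; have sg' := smooth_partial l sg.
refine (etrans (partialD k z (smoothM sf sg') (smoothM sg sf')) _).
refine (etrans (congr2 +%R (partialM k z sf sg') (partialM k z sg sf')) _).
set a1 := partial k (partial l g) z; set a2 := partial k (partial l f) z.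
set b1 := partial k f z; set b2 := partial l f z.
set c1 := partial k g z; set c2 := partial l g z.
clearbody a1 a2 b1 b2 c1 c2; ring.
Qed.

Lemma hess_comp (H : nat -> R -> R) f z k l :
  (forall (j : nat) (x : R), is_derive x 1 (H j) (H j.+1 x)) -> smooth f ->
  hess (fun z => H 0%N (f z)) z k l =
  H 2%N (f z) * (partial k f z * partial l f z) + H 1%N (f z) * hess f z k l.
Proof.
move=> dH sf; rewrite /hess.
have -> : partial l (fun z => H 0%N (f z)) = fun w => H 1%N (f w) * partial l f w.
  by apply/funext => w; exact: (partial_comp l sf (dH 0%N (f w))).
have sH : smooth (fun z => H 1%N (f z)).
  by apply: smooth_comp => //; exists (fun j => H j.+1).
rewrite (partialM _ _ sH (smooth_partial l sf)).
rewrite (partial_comp _ sf (dH 1%N (f z))); ring.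
Qed.

Lemma partial_perturb f a r n k z : smooth f -> smooth a -> smooth r ->
  partial k (fun z => f z + a z * r z ^+ n.+2) z =
  partial k f z + r z ^+ n.+1 * (n.+2%:R * a z * partial k r z + r z * partial k a z).
Proof.
move=> sf sa sr; have srn := smoothX n.+2 sr.
rewrite (partialD _ _ sf (smoothM sa srn)) (partialM _ _ sa srn).
rewrite (partialX _ _ _ sr) /= !exprS; ring.
Qed.

(** Up to one more power of [r], the change is a rank one matrix: the second
    derivative of [r^(n+2)] contains [r^n] only in the term with two gradients. *)
Lemma hess_perturb f a r n z k l : smooth f -> smooth a -> smooth r ->
  hess (fun z => f z + a z * r z ^+ n.+2) z k l =
  hess f z k l + (n.+2 * n.+1)%:R * a z * r z ^+ n * (partial k r z * partial l r z) +
  r z ^+ n.+1 * (n.+2%:R * (a z * hess r z k l + partial k a z * partial l r z +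
     partial k r z * partial l a z) + r z * hess a z k l).
Proof.
move=> sf sa sr; rewrite /hess.
have -> : partial l (fun z => f z + a z * r z ^+ n.+2) = fun w => partial l f w +
    r w ^+ n.+1 * (n.+2%:R * a w * partial l r w + r w * partial l a w).
  by apply/funext => w; exact: partial_perturb.
have sf' := smooth_partial l sf; have sa' := smooth_partial l sa.
have sr' := smooth_partial l sr; have srn := smoothX n.+1 sr.
have c2 : smooth (fun _ : 'rV[R]_m => n.+2%:R) by exact: smooth_cst.
have s1 : smooth (fun z => n.+2%:R * a z) by exact: smoothM.
have s2 : smooth (fun z => n.+2%:R * a z * partial l r z) by exact: smoothM.
have s3 : smooth (fun z => r z * partial l a z) by exact: smoothM.
rewrite (partialD _ _ sf' (smoothM srn (smoothD s2 s3))).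
rewrite (partialM _ _ srn (smoothD s2 s3)) (partialD _ _ s2 s3).
rewrite (partialM _ _ s1 sr') (partialM _ _ sr sa') (partialM _ _ c2 sa).
rewrite (partialX _ _ _ sr).
rewrite (partial_cst n.+2%:R k z).
rewrite [(n.+2 * n.+1)%:R]natrM.
rewrite [r z ^+ n.+1]exprS.
rewrite succnK.
set p1 := partial k (partial l f) z; set p2 := partial k (partial l a) z.
set p3 := partial k (partial l r) z.
set q1 := partial k r z; set q2 := partial l r z; set q3 := partial k a z; set q4 := partial l a z.
clearbody p1 p2 p3 q1 q2 q3 q4.
ring.
Qed.

End PartialRules.

Section Wirtinger.
Variables (R : realType) (n : nat).
Local Notation C := R[i].
Implicit Types (S T : 'I_(n + n) -> 'I_(n + n) -> R) (a : 'I_(n + n) -> R).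
Implicit Types (u : 'rV[R]_(n + n) -> R) (z W : 'rV[R]_(n + n)) (w : 'rV[C]_n).

Local Notation x_ := (@lshift n n).
Local Notation y_ := (@rshift n n).

(** The complex Hessian in terms of the real Hessian [S], with the order of
    derivation kept; it is real linear in [S]. *)
Definition wirt_hess S : 'M[C]_n :=
  \matrix_(i, j) ((4^-1 * (S (x_ i) (x_ j) + S (y_ i) (y_ j))) +i*
    (4^-1 * (S (x_ i) (y_ j) - S (y_ i) (x_ j)))).

Definition wirt_grad a : 'cV[C]_n := \col_i ((2^-1 * a (x_ i)) +i* - (2^-1 * a (y_ i))).

Lemma halfC : (2^-1 : C) = (2^-1 : R)%:C.
Proof. by rewrite fmorphV rmorph_nat. Qed.

Lemma complex_hessianE u z : smooth u -> complex_hessian u z = wirt_hess (hess u z).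
Proof.
move=> su; apply/matrixP => i j; rewrite !mxE /dz.
have E : dzbar j (fun p => (u p)%:C) =
   fun p => (2^-1 * partial (x_ j) u p) +i* (2^-1 * partial (y_ j) u p).
  apply/funext => p; rewrite /dzbar /cpartial /= !(partial_cst 0) halfC.
  by simpc; congr (_ +i* _); ring.
have sx := smooth_partial (x_ j) su; have sy := smooth_partial (y_ j) su.
rewrite E /cpartial /= (partialZ 2^-1 (x_ i) z sx) (partialZ 2^-1 (x_ i) z sy).
rewrite (partialZ 2^-1 (y_ i) z sx) (partialZ 2^-1 (y_ i) z sy).
rewrite /hess; set s1 := partial (x_ i) (partial (x_ j) u) z.
set s2 := partial (x_ i) (partial (y_ j) u) z.
set s3 := partial (y_ i) (partial (x_ j) u) z.
set s4 := partial (y_ i) (partial (y_ j) u) z.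
clearbody s1 s2 s3 s4.
rewrite halfC.
simpc.
by congr (_ +i* _); field.
Qed.

Lemma dzE u z j : dz j (fun p => (u p)%:C) z = wirt_grad (fun k => partial k u z) j 0.
Proof.
rewrite !mxE /dz /cpartial /= !(partial_cst 0) halfC; simpc; congr (_ +i* _); ring.
Qed.

Lemma wirt_hessD S T : wirt_hess (fun k l => S k l + T k l) = wirt_hess S + wirt_hess T.
Proof. by apply/matrixP => i j; rewrite !mxE; simpc; congr (_ +i* _); ring. Qed.

Lemma wirt_hessZ c S : wirt_hess (fun k l => c * S k l) = c%:C *: wirt_hess S.
Proof. by apply/matrixP => i j; rewrite !mxE; simpc; congr (_ +i* _); ring. Qed.

Lemma wirt_hess_rank1 a :
  wirt_hess (fun k l => a k * a l) = wirt_grad a *m (map_mx (@conjc R) (wirt_grad a))^T.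
Proof.
apply/matrixP => i j; rewrite !mxE big_ord1 !mxE; simpc.
by congr (_ +i* _); field.
Qed.

Definition lin a W : R := \sum_k a k * W 0 k.

Definition quad S W : R := \sum_k \sum_l S k l * (W 0 k * W 0 l).

Definition mul_i W : 'rV[R]_(n + n) := row_mx (- rsubmx W) (lsubmx W).

(** Four times the Levi form in the direction [W], computed from the real Hessian. *)
Definition levi_quad S W : R := quad S W + quad S (mul_i W).

Lemma Re_sum I (r : seq I) (P : pred I) (F : I -> C) :
  complex.Re (\sum_(i <- r | P i) F i) = \sum_(i <- r | P i) complex.Re (F i).
Proof. by apply: (big_morph (@complex.Re R)) => // -[a b] [c d]. Qed.

Lemma Im_sum I (r : seq I) (P : pred I) (F : I -> C) :
  complex.Im (\sum_(i <- r | P i) F i) = \sum_(i <- r | P i) complex.Im (F i).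
Proof. by apply: (big_morph (@complex.Im R)) => // -[a b] [c d]. Qed.

Lemma quad_row_mx S (p q : 'rV[R]_n) : quad S (row_mx p q) = \sum_i \sum_j
  (S (x_ i) (x_ j) * (p 0 i * p 0 j) + S (x_ i) (y_ j) * (p 0 i * q 0 j) +
   (S (y_ i) (x_ j) * (q 0 i * p 0 j) + S (y_ i) (y_ j) * (q 0 i * q 0 j))).
Proof.
rewrite /quad big_split_ord /= -big_split; apply: eq_bigr => i _ /=.
rewrite !big_split_ord /= -!big_split; apply: eq_bigr => j _ /=.
by rewrite !(row_mxEl, row_mxEr).
Qed.

Lemma mul_i_row_mx (p q : 'rV[R]_n) : mul_i (row_mx p q) = row_mx (- q) p.
Proof. by rewrite /mul_i row_mxKl row_mxKr. Qed.

(** With [w = p + iq] the vector [iw] has the real coordinates [(- q, p)], and the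
    terms that mix [p] and [q] combine to those of the Hermitian form. *)
Lemma Re_wirt_hess S w :
  complex.Re (\sum_i \sum_j wirt_hess S i j * w 0 i * (w 0 j)^*%C) =
  4^-1 * levi_quad S (of_complex_row w).
Proof.
rewrite /levi_quad /of_complex_row mul_i_row_mx !quad_row_mx -big_split mulr_sumr.
rewrite Re_sum; apply: eq_bigr => i _; rewrite Re_sum -big_split mulr_sumr.
apply: eq_bigr => j _; rewrite !mxE.
case: (w 0 i) (w 0 j) => [a b] [c d] /=; ring.
Qed.

Lemma wirt_grad_dot a w : \sum_j wirt_grad a j 0 * w 0 j =
  (2^-1 * lin a (of_complex_row w)) +i* (- (2^-1 * lin a (mul_i (of_complex_row w)))).
Proof.
apply/eqP; rewrite eq_complex Re_sum Im_sum /=.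
rewrite /lin /of_complex_row mul_i_row_mx !big_split_ord /= -!big_split !mulr_sumr -sumrN.
apply/andP; split; apply/eqP; apply: eq_bigr => i _; rewrite !(row_mxEl, row_mxEr) !mxE.
  by case: (w 0 i) => [a' b'] /=; ring.
by case: (w 0 i) => [a' b'] /=; ring.
Qed.

Lemma quadD S T W : quad (fun k l => S k l + T k l) W = quad S W + quad T W.
Proof.
rewrite /quad -big_split; apply: eq_bigr => k _; rewrite -big_split.
by apply: eq_bigr => l _; rewrite mulrDl.
Qed.

Lemma quadZ c S W : quad (fun k l => c * S k l) W = c * quad S W.
Proof.
rewrite /quad mulr_sumr; apply: eq_bigr => k _; rewrite mulr_sumr.
by apply: eq_bigr => l _; rewrite -mulrA.
Qed.

Lemma quad_rank1 a b W : quad (fun k l => a k * b l) W = lin a W * lin b W.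
Proof.
rewrite /quad /lin mulr_suml; apply: eq_bigr => k _; rewrite mulr_sumr.
by apply: eq_bigr => l _; ring.
Qed.

Lemma levi_quadD S T W :
  levi_quad (fun k l => S k l + T k l) W = levi_quad S W + levi_quad T W.
Proof. by rewrite /levi_quad !quadD addrACA. Qed.

Lemma levi_quadZ c S W : levi_quad (fun k l => c * S k l) W = c * levi_quad S W.
Proof. by rewrite /levi_quad !quadZ mulrDr. Qed.

Lemma levi_quad_rank1 a b W : levi_quad (fun k l => a k * b l) W =
  lin a W * lin b W + lin a (mul_i W) * lin b (mul_i W).
Proof. by rewrite /levi_quad !quad_rank1. Qed.

Lemma levi_quad_ext S T W : (forall k l, S k l = T k l) -> levi_quad S W = levi_quad T W.
Proof. by move=> ST; congr levi_quad; apply/funext => k; apply/funext. Qed.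

End Wirtinger.

(** * Positive Hermitian matrices *)

Section MatrixLemmas.
Variable K : comNzRingType.

Lemma det_add_rank1_block n (A : 'M[K]_n) (u : 'cV_n) (v : 'rV_n) :
  \det (A + u *m v) = \det (block_mx (1%:M : 'M[K]_1) v (- u) A).
Proof.
have -> : block_mx (1%:M : 'M[K]_1) v (- u) A =
   block_mx 1%:M 0 (- u) 1%:M *m block_mx 1%:M v 0 (A + u *m v).
  rewrite mulmx_block !mul1mx !mul0mx !addr0 mulmx1 mulNmx.
  by rewrite addrCA addNr addr0.
by rewrite det_mulmx det_lblock det_ublock !det1 !mul1r.
Qed.

(** Bordering the matrix moves the rank one term into a single row, in which the
    determinant is linear. *)
Lemma det_add_rank1 n (A : 'M[K]_n) (u : 'cV_n) (v : 'rV_n) (t : K) :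
  \det (A + t *: (u *m v)) = \det A + t * (\det (A + u *m v) - \det A).
Proof.
have E (s : K) : \det (A + s *: (u *m v)) = \det (block_mx (1%:M : 'M[K]_1) (s *: v) (- u) A).
  by rewrite -det_add_rank1_block scalemxAr.
rewrite E.
rewrite (@determinant_multilinear _ _ _ (block_mx (1%:M : 'M[K]_1) (0 *: v) (- u) A)
  (block_mx (1%:M : 'M[K]_1) (1 *: v) (- u) A) (lshift n 0) (1 - t) t).
- by rewrite -!E scale0r scale1r addr0; ring.
- rewrite /block_mx !rowKu !row_row_mx !scale_row_mx add_row_mx.
  by rewrite -!scalerDl subrK scale1r scale0r scale1r !row_id scaler0 add0r.
- rewrite /block_mx !row'Ku; apply: (congr1 (fun X : 'M[K]_(0, _) => col_mx X _)).
  by apply/matrixP => -[].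
- rewrite /block_mx !row'Ku; apply: (congr1 (fun X : 'M[K]_(0, _) => col_mx X _)).
  by apply/matrixP => -[].
Qed.

Lemma det_1_rank1 n (u : 'cV[K]_n) (v : 'rV_n) :
  \det (1%:M + u *m v) = 1 + (v *m u) 0 0.
Proof.
rewrite det_add_rank1_block.
have -> : block_mx (1%:M : 'M[K]_1) v (- u) 1%:M =
   block_mx (1%:M + v *m u) v 0 1%:M *m block_mx 1%:M 0 (- u) 1%:M.
  rewrite mulmx_block !mulmx1 !mulmx0 !mul1mx !add0r mulmxN addrK.
  by rewrite ?addr0 ?add0r.
rewrite det_mulmx det_lblock det_ublock !det1 !mulr1 det_mx11 !mxE eqxx //.
Qed.

End MatrixLemmas.

Section Positive.
Variable C : numClosedFieldType.
Local Open Scope sesquilinear_scope.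

Definition herm_form n (A : 'M[C]_n) (w : 'rV_n) : C := (w *m A *m w ^t* ) 0 0.

Definition posdef n (A : 'M[C]_n) : Prop := forall w, w != 0 -> 0 < herm_form A w.

Lemma trmxC_mul m n p (A : 'M[C]_(m, n)) (B : 'M[C]_(n, p)) :
  (A *m B) ^t* = B ^t* *m A ^t*.
Proof. by rewrite trmx_mul map_mxM. Qed.

Lemma trmxCD m n (A B : 'M[C]_(m, n)) : (A + B) ^t* = A ^t* + B ^t*.
Proof. by apply/matrixP => i j; rewrite !mxE rmorphD. Qed.

Lemma trmxCZ m n (a : C) (A : 'M[C]_(m, n)) : (a *: A) ^t* = a^* *: A ^t*.
Proof. by apply/matrixP => i j; rewrite !mxE rmorphM. Qed.

Lemma herm_det_real n (A : 'M[C]_n) : A ^t* = A -> \det A \is Num.real.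
Proof.
move=> hA; apply/CrealP; rewrite -[in RHS]hA.
by rewrite det_map_mx det_tr.
Qed.

(** By the spectral theorem: the eigenvalues are values of the form at
    eigenvectors. *)
Lemma posdef_det_gt0 n (A : 'M[C]_n) : A ^t* = A -> posdef A -> 0 < \det A.
Proof.
move=> hA pA.
have Ah : A \is hermsymmx.
  by apply/is_hermitianmxP; rewrite expr0 scale1r.
have /hermitian_normalmx /orthomx_spectralP AE := Ah.
set P := spectralmx A in AE; set D := spectral_diag A in AE.
have Pu : P \in unitmx by exact: spectral_unit.
have PV : invmx P = P ^t* by rewrite invmx_unitary// spectral_unitarymx.
rewrite AE !det_mulmx mulrAC -det_mulmx mulVmx// det1 mul1r det_diag.
apply: prodr_gt0 => i _.
have wn0 : row i P != 0.
  apply/eqP => w0; have : row i (P *m invmx P) = 0 by rewrite row_mul w0 mul0mx.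
  rewrite mulmxV// => /rowP/(_ i); rewrite !mxE eqxx => /eqP.
  by rewrite oner_eq0.
have := pA _ wn0; rewrite /herm_form AE.
have -> : row i P *m (invmx P *m diag_mx D *m P) *m (row i P) ^t* =
    row i (P *m invmx P) *m diag_mx D *m (row i (P *m invmx P)) ^t*.
  rewrite PV !row_mul trmxC_mul trmxCK !mulmxA.
  by [].
rewrite mulmxV// row1 -rowE trmx_delta map_delta_mx -colE !mxE eqxx.
by rewrite mulr1n.
Qed.

Lemma posdef_unit n (A : 'M[C]_n) : A ^t* = A -> posdef A -> A \in unitmx.
Proof. by move=> hA pA; rewrite unitmxE unitfE gt_eqF// posdef_det_gt0. Qed.

Lemma invmx_herm n (A : 'M[C]_n) : A ^t* = A -> (invmx A) ^t* = invmx A.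
Proof. by move=> hA; rewrite trmx_inv map_invmx hA. Qed.

Lemma det_add_hrank1 n (A : 'M[C]_n) (v : 'cV[C]_n) (k : C) : A \in unitmx ->
  \det (A + k *: (v *m v ^t* )) = \det A * (1 + k * (v ^t* *m invmx A *m v) 0 0).
Proof.
move=> uA.
have -> : A + k *: (v *m v ^t* ) = A *m (1%:M + invmx A *m v *m (k *: v ^t* )).
  by rewrite mulmxDr mulmx1 !mulmxA mulmxV// mul1mx scalemxAr.
by rewrite det_mulmx det_1_rank1 -scalemxAl mxE mulmxA.
Qed.

Lemma herm_form_inv n (A : 'M[C]_n) (v : 'cV[C]_n) : A ^t* = A -> posdef A ->
  herm_form A (v ^t* *m invmx A) = (v ^t* *m invmx A *m v) 0 0.
Proof.
move=> hA pA; rewrite /herm_form trmxC_mul trmxCK (invmx_herm hA).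
by rewrite mulmxKV ?mulmxA//; exact: (posdef_unit hA pA).
Qed.

Lemma posdef_inv_gt0 n (A : 'M[C]_n) (v : 'cV[C]_n) : A ^t* = A -> posdef A ->
  v != 0 -> 0 < (v ^t* *m invmx A *m v) 0 0.
Proof.
move=> hA pA v0; rewrite -(herm_form_inv v hA pA); apply: (pA).
apply: contraNneq v0 => r0.
have : v ^t* *m invmx A *m A = 0 by rewrite r0 mul0mx.
rewrite mulmxKV; last exact: (posdef_unit hA pA).
by move=> v0; rewrite -[v]trmxCK v0 trmx0 map_mx0.
Qed.

Definition det_slope n (A : 'M[C]_n) (v : 'cV[C]_n) : C :=
  \det (A + v *m v ^t* ) - \det A.

Lemma det_slope_add n (A : 'M[C]_n) (v : 'cV[C]_n) (k : C) :
  det_slope (A + k *: (v *m v ^t* )) v = det_slope A v.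
Proof.
rewrite /det_slope -addrA -[X in _ + (_ + X)]scale1r -scalerDl !det_add_rank1.
ring.
Qed.

(** The slope is the same at every point of the line [A + k v v*], hence may be
    computed at the positive definite matrix [B] of that line, where it is
    [det B * (v* B^-1 v)]. *)
Lemma det_slope_gt0 n (A : 'M[C]_n) (v : 'cV[C]_n) (k : C) :
  A ^t* = A -> k \is Num.real -> posdef (A + k *: (v *m v ^t* )) -> v != 0 ->
  0 < det_slope A v.
Proof.
move=> hA kr pA v0; rewrite -(det_slope_add A v k).
set B := A + _ in pA *; have hB : B ^t* = B.
  by rewrite /B trmxCD hA trmxCZ trmxC_mul trmxCK (CrealP kr).
have uB := posdef_unit hB pA.
rewrite /det_slope -[X in B + X]scale1r det_add_hrank1// mulrDr mulr1 addrC addKr mul1r.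
by rewrite mulr_gt0//; [exact: (posdef_det_gt0 hB pA)|exact: (posdef_inv_gt0 hB pA v0)].
Qed.

(** A Hermitian matrix which becomes positive definite after adding a rank one
    term has at most one nonpositive eigenvalue, and the sign of its
    determinant decides about that one.  With [r] the covector [v* B^-1], which
    spans the [B]-orthogonal complement of the kernel of [v], the form splits
    into its restriction to the kernel of [v] and to the line through [r]. *)
Lemma herm_form_ge0 n (A : 'M[C]_n) (v : 'cV[C]_n) (k : C) (w : 'rV[C]_n) :
  A ^t* = A -> k \is Num.real -> posdef (A + k *: (v *m v ^t* )) ->
  0 <= \det A -> 0 <= herm_form A w.
Proof.
move=> hA kr pA dA.
set B := A + _ in pA *; have hB : B ^t* = B.
  by rewrite /B trmxCD hA trmxCZ trmxC_mul trmxCK (CrealP kr).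
have uB := posdef_unit hB pA.
have AE : A = B + (- k) *: (v *m v ^t* ) by rewrite /B scaleNr addrK.
clearbody B.
have fB0 y : 0 <= herm_form B y.
  have [->|y0] := eqVneq y 0; first by rewrite /herm_form !mul0mx mxE.
  by rewrite ltW// pA.
have [v0|v0] := eqVneq v 0.
  by rewrite AE v0 mul0mx scaler0 addr0 fB0.
set r := v ^t* *m invmx B.
set c := (v ^t* *m invmx B *m v) 0 0.
have c0 : 0 < c by exact: (posdef_inv_gt0 hB pA v0).
have kc : 0 <= 1 - k * c.
  move: dA; rewrite AE det_add_hrank1// pmulr_rge0; last exact: (posdef_det_gt0 hB pA).
  by rewrite mulNr.
have rB : r *m B = v ^t* by rewrite /r mulmxKV.
have Br : B *m r ^t* = v by rewrite -[LHS]trmxCK trmxC_mul trmxCK hB rB trmxCK.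
pose t := (w *m v) 0 0 / c.
pose y := w - t *: r.
have yv : y *m v = 0.
  have c0' : c != 0 by rewrite gt_eqF.
  rewrite mulmxBl -scalemxAl [w *m v]mx11_scalar [r *m v]mx11_scalar -/c.
  by rewrite scale_scalar_mx divfK// subrr.
have wE : w = t *: r + y by rewrite /y addrC subrK.
clearbody y; clearbody t.
have cross : y *m B *m r ^t* = 0 by rewrite -mulmxA Br.
have cross' : r *m B *m y ^t* = 0 by rewrite rB -trmxC_mul yv trmx0 map_mx0.
have cE : (r *m B *m r ^t* ) 0 0 = c by rewrite -mulmxA Br.
have wB : herm_form B w = t * t^* * c + herm_form B y.
  have -> : herm_form B w = ((t *: r + y) *m B *m (t^* *: r ^t* + y ^t* )) 0 0.
    by rewrite /herm_form wE trmxCD trmxCZ.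
  rewrite /herm_form.
  rewrite mulmxDl mulmxDl !mulmxDr -!scalemxAl -!scalemxAr cross cross'.
  by rewrite !scaler0 addr0 add0r scalerA mxE mxE cE.
have wA : herm_form A w = herm_form B w - k * (t * t^* * c ^+ 2).
  have wv : w *m v = (t * c)%:M by rewrite wE mulmxDl yv addr0 -scalemxAl
     [r *m v]mx11_scalar -/c scale_scalar_mx.
  have vw : v ^t* *m w ^t* = ((t * c)^*)%:M by rewrite -trmxC_mul wv tr_scalar_mx map_scalar_mx.
  have -> : herm_form A w = herm_form B w - k * (w *m v *m (v ^t* *m w ^t* )) 0 0.
    rewrite {1}/herm_form {1}AE mulmxDr mulmxDl -scalemxAr -scalemxAl [LHS]mxE.
    by rewrite [X in _ + X = _]mxE mulNr !mulmxA.
  rewrite wv vw -scalar_mxM mxE eqxx mulr1n rmorphM /= (CrealP (gtr0_real c0)).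
  ring.
rewrite wA wB.
have -> : t * t^* * c + herm_form B y - k * (t * t^* * c ^+ 2) =
   t * t^* * c * (1 - k * c) + herm_form B y by ring.
by rewrite addr_ge0// mulr_ge0// mulr_ge0 ?mul_conjC_ge0// ltW.
Qed.

End Positive.

(** * Approximate solutions of the homogeneous Monge-Ampere equation *)

Section Congruence.
Variables (R : realType) (m : nat).
Local Notation C := R[i].
Local Notation V := 'rV[R]_m.
Implicit Types (g h : V -> C) (f : V -> R) (z : V).

Definition csmooth g : Prop :=
  smooth (fun z => complex.Re (g z)) /\ smooth (fun z => complex.Im (g z)).

Lemma csmooth_real f : smooth f -> csmooth (fun z => (f z)%:C).
Proof. by move=> sf; split=> //=; exact: smooth_cst. Qed.

Lemma csmooth_cst (c : C) : csmooth (fun=> c).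
Proof. by split; exact: smooth_cst. Qed.

Lemma csmoothD g h : csmooth g -> csmooth h -> csmooth (fun z => g z + h z).
Proof.
move=> [g1 g2] [h1 h2]; split.
  have := smoothD g1 h1; congr smooth; apply/funext => z.
  by case: (g z) (h z) => [? ?] [? ?].
have := smoothD g2 h2; congr smooth; apply/funext => z.
by case: (g z) (h z) => [? ?] [? ?].
Qed.

Lemma csmoothM g h : csmooth g -> csmooth h -> csmooth (fun z => g z * h z).
Proof.
move=> [g1 g2] [h1 h2]; split.
  have := smoothB (smoothM g1 h1) (smoothM g2 h2); congr smooth; apply/funext => z.
  by case: (g z) (h z) => [? ?] [? ?].
have := smoothD (smoothM g1 h2) (smoothM g2 h1); congr smooth; apply/funext => z.
by case: (g z) (h z) => [? ?] [? ?].
Qed.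

Lemma csmooth_sum I (r : seq I) (P : pred I) (F : I -> V -> C) :
  (forall i, csmooth (F i)) -> csmooth (fun z => \sum_(i <- r | P i) F i z).
Proof.
move=> sF; elim: r => [|i r ih].
  by under eq_fun do rewrite big_nil; exact: csmooth_cst.
under eq_fun do rewrite big_cons.
by case: (P i); [exact: csmoothD (sF i) ih|exact: ih].
Qed.

Lemma csmooth_prod I (r : seq I) (P : pred I) (F : I -> V -> C) :
  (forall i, csmooth (F i)) -> csmooth (fun z => \prod_(i <- r | P i) F i z).
Proof.
move=> sF; elim: r => [|i r ih].
  by under eq_fun do rewrite big_nil; exact: csmooth_cst.
under eq_fun do rewrite big_cons.
by case: (P i); [exact: csmoothM (sF i) ih|exact: ih].
Qed.

Lemma csmooth_det n (A : V -> 'M[C]_n) : (forall i j, csmooth (fun z => A z i j)) ->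
  csmooth (fun z => \det (A z)).
Proof.
move=> sA; apply: csmooth_sum => s; apply: csmoothM; first exact: csmooth_cst.
by apply: csmooth_prod => i; exact: sA.
Qed.

(** Congruence modulo a power of a smooth function, with smooth quotient.
    Tracking the quotients replaces division of functions that vanish on the
    zero set of [r]. *)
Definition cong_mod (r : V -> R) k g h : Prop :=
  exists2 q, csmooth q & forall z, g z = h z + (r z ^+ k)%:C * q z.

Variables (r : V -> R) (k : nat).

Lemma cong_mod_refl g : cong_mod r k g g.
Proof. by exists (fun=> 0) => [|z]; [exact: csmooth_cst|rewrite mulr0 addr0]. Qed.

Lemma cong_modD g1 h1 g2 h2 : cong_mod r k g1 h1 -> cong_mod r k g2 h2 ->
  cong_mod r k (fun z => g1 z + g2 z) (fun z => h1 z + h2 z).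
Proof.
move=> [q1 s1 E1] [q2 s2 E2]; exists (fun z => q1 z + q2 z) => [|z].
  exact: csmoothD.
rewrite E1 E2; ring.
Qed.

Lemma cong_modM g1 h1 g2 h2 : csmooth h1 -> csmooth g2 ->
  cong_mod r k g1 h1 -> cong_mod r k g2 h2 ->
  cong_mod r k (fun z => g1 z * g2 z) (fun z => h1 z * h2 z).
Proof.
move=> sh sg [q1 s1 E1] [q2 s2 E2]; exists (fun z => q1 z * g2 z + h1 z * q2 z) => [|z].
  by apply: csmoothD; exact: csmoothM.
rewrite E1 {1}E2 [in RHS]E2; ring.
Qed.

Lemma cong_mod_prod I (s : seq I) (F G : I -> V -> C) :
  (forall i, csmooth (F i)) -> (forall i, csmooth (G i)) ->
  (forall i, cong_mod r k (F i) (G i)) ->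
  cong_mod r k (fun z => \prod_(i <- s) F i z) (fun z => \prod_(i <- s) G i z).
Proof.
move=> sF sG FG; elim: s => [|i s ih].
  under [X in cong_mod _ _ X _]eq_fun do rewrite big_nil.
  under [X in cong_mod _ _ _ X]eq_fun do rewrite big_nil.
  exact: cong_mod_refl.
under [X in cong_mod _ _ X _]eq_fun do rewrite big_cons.
under [X in cong_mod _ _ _ X]eq_fun do rewrite big_cons.
by apply: cong_modM => //; exact: csmooth_prod.
Qed.

Lemma cong_mod_det n (A B : V -> 'M[C]_n) :
  (forall i j, csmooth (fun z => A z i j)) -> (forall i j, csmooth (fun z => B z i j)) ->
  (forall i j, cong_mod r k (fun z => A z i j) (fun z => B z i j)) ->
  cong_mod r k (fun z => \det (A z)) (fun z => \det (B z)).
Proof.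
move=> sA sB AB; rewrite /determinant.
elim: (index_enum _) => [|s S ih].
  under [X in cong_mod _ _ X _]eq_fun do rewrite big_nil.
  under [X in cong_mod _ _ _ X]eq_fun do rewrite big_nil.
  exact: cong_mod_refl.
under [X in cong_mod _ _ X _]eq_fun do rewrite big_cons.
under [X in cong_mod _ _ _ X]eq_fun do rewrite big_cons.
apply: cong_modD ih; apply: cong_modM; first exact: csmooth_cst.
- by apply: csmooth_prod => i; exact: sA.
- exact: cong_mod_refl.
by apply: cong_mod_prod => i; [exact: sA|exact: sB|exact: AB].
Qed.

End Congruence.

Section MongeAmpere.
Variables (R : realType) (n : nat).
Local Notation C := R[i].
Local Notation V := 'rV[R]_(n + n).
Implicit Types (f g r u : V -> R) (z : V).
Local Open Scope sesquilinear_scope.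

Definition levi_mx u z : 'M[C]_n := wirt_hess (hess u z).
Definition dz_vec u z : 'cV[C]_n := wirt_grad (fun k => partial k u z).

Lemma wirt_hess_herm (S : 'I_(n + n) -> 'I_(n + n) -> R) :
  (forall k l, S k l = S l k) -> (wirt_hess S) ^t* = wirt_hess S.
Proof.
move=> SC; apply/matrixP => i j; rewrite !mxE; apply/eqP; rewrite eq_complex /=.
by rewrite [S (lshift n j) _]SC [S (rshift n j) _]SC [S (lshift n j) _]SC
   [S (rshift n j) _]SC -mulrN opprB !eqxx.
Qed.

Lemma csmooth_addZ (A B : V -> 'M[C]_n) (e : V -> R) i j :
  csmooth (fun z => A z i j) -> csmooth (fun z => B z i j) -> smooth e ->
  csmooth (fun z => (A z + (e z)%:C *: B z) i j).
Proof.
move=> sA sB se; have := csmoothD sA (csmoothM (csmooth_real se) sB).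
by congr csmooth; apply/funext => z; rewrite !mxE.
Qed.

Lemma levi_mx_herm u z : smooth u -> (levi_mx u z) ^t* = levi_mx u z.
Proof. by move=> su; apply: wirt_hess_herm => k l; exact: hessC. Qed.

Lemma det_levi_mx_real u z : smooth u -> \det (levi_mx u z) = (complex.Re (\det (levi_mx u z)))%:C.
Proof. by move=> su; rewrite RRe_real//; exact: herm_det_real (levi_mx_herm z su). Qed.

Lemma csmooth_wirt_hess (S : V -> 'I_(n + n) -> 'I_(n + n) -> R) i j :
  (forall k l, smooth (fun z => S z k l)) -> csmooth (fun z => wirt_hess (S z) i j).
Proof.
move=> sS; split; (under eq_fun do rewrite mxE) => /=.
  by apply: smoothM; [exact: smooth_cst|exact: smoothD].
by apply: smoothM; [exact: smooth_cst|exact: smoothB].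
Qed.

Lemma csmooth_levi_mx u i j : smooth u -> csmooth (fun z => levi_mx u z i j).
Proof. by move=> su; apply: csmooth_wirt_hess => k l; exact: smooth_hess. Qed.

Lemma dz_vec_rank1 u z : dz_vec u z *m (dz_vec u z) ^t* =
  wirt_hess (fun k l => partial k u z * partial l u z).
Proof. by rewrite wirt_hess_rank1 map_trmx. Qed.

Lemma csmooth_dz_vec_rank1 u i j : smooth u ->
  csmooth (fun z => (dz_vec u z *m (dz_vec u z) ^t* ) i j).
Proof.
move=> su; have := @csmooth_wirt_hess (fun z k l => partial k u z * partial l u z) i j.
under eq_fun do rewrite -dz_vec_rank1; apply => k l.
by apply: smoothM; exact: smooth_partial.
Qed.

(** The term of order [k] in [r] is of rank one, and its coefficient is free. *)
Lemma levi_mx_perturb f a r k : smooth f -> smooth a -> smooth r ->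
  exists M : V -> 'M[C]_n, (forall i j, csmooth (fun z => M z i j)) /\
  forall z, levi_mx (fun z => f z + a z * r z ^+ k.+2) z =
    levi_mx f z + ((k.+2 * k.+1)%:R * a z * r z ^+ k)%:C *: (dz_vec r z *m (dz_vec r z) ^t* )
    + (r z ^+ k.+1)%:C *: M z.
Proof.
move=> sf sa sr.
pose T z p l := k.+2%:R * (a z * hess r z p l + partial p a z * partial l r z +
     partial p r z * partial l a z) + r z * hess a z p l.
exists (fun z => wirt_hess (T z)); split=> [i j|z].
  apply: csmooth_wirt_hess => p l.
  have rl := smooth_partial l sr; have rp := smooth_partial p sr.
  have al := smooth_partial l sa; have ap := smooth_partial p sa.
  exact: smoothD (smoothM (smooth_cst k.+2%:R) (smoothD (smoothD
    (smoothM sa (smooth_hess p l sr)) (smoothM ap rl)) (smoothM rp al)))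
    (smoothM sr (smooth_hess p l sa)).
rewrite dz_vec_rank1 -!wirt_hessZ -!wirt_hessD.
by congr wirt_hess; apply/funext => p; apply/funext => l; rewrite hess_perturb.
Qed.

(** The derivative of the determinant of the complex Hessian in the direction of
    the squared gradient.  On a level set it is, up to a factor, the determinant
    of the Levi form on the complex tangent space. *)
Definition slope u z : C := det_slope (levi_mx u z) (dz_vec u z).

Lemma slope_diff (d s d' s' w x y : C) (v : R) :
  d + 1%:C * s = d' + (v + 1)%:C * s' + w * y ->
  d + 0%:C * s = d' + (v + 0)%:C * s' + w * x -> s = s' + w * (y - x).
Proof.
move=> e1 e0; have -> : s = (d + 1%:C * s) - (d + 0%:C * s) by rewrite !rmorphE /=; ring.
by rewrite e1 e0 !(rmorphD (real_complex R)) !rmorphE /=; ring.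
Qed.

Lemma step_algebra (d s : C) (x y w f t e : R) (p q : C) :
  s * e%:C = 1 -> w = x * y ->
  d = (x * f)%:C + ((t - f) * e * x)%:C * (s + (y ^+ 1)%:C * p) + w%:C * q ->
  complex.Re d = x * t + w * complex.Re (((t - f) * e)%:C * p + q).
Proof.
move=> se -> ->.
have -> : (x * f)%:C + ((t - f) * e * x)%:C * (s + (y ^+ 1)%:C * p) + (x * y)%:C * q =
   (x * f)%:C + ((t - f) * x)%:C * (s * e%:C) +
   (x * y)%:C * (((t - f) * e)%:C * p + q).
  by rewrite expr1 !(rmorphM (real_complex R)) /=; ring.
rewrite se mulr1; case: (_ * p + q) => a b /=; ring.
Qed.

(** One correction step: where [b] inverts the slope, adding a multiple of
    [r^(k+2)] changes the coefficient of [r^k] in the determinant at will. *)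
Lemma monge_ampere_step r g f t b k (W : set V) :
  smooth r -> smooth g -> smooth f -> smooth t -> smooth b ->
  (forall z, W z -> slope r z * (b z)%:C = 1) ->
  (forall z, W z -> \det (levi_mx (fun z => r z + g z * r z ^+ 2) z) = (r z ^+ k * f z)%:C) ->
  exists g' f', [/\ smooth g', smooth f' &
    forall z, W z -> \det (levi_mx (fun z => r z + g' z * r z ^+ 2) z) =
      (r z ^+ k * t z + r z ^+ k.+1 * f' z)%:C].
Proof.
move=> sr sg sf st sb bW detF.
pose F z := r z + g z * r z ^+ 2.
have sF : smooth F := smoothD sr (smoothM sg (smoothX 2 sr)).
pose N : R := (k.+2 * k.+1)%:R.
have N0 : N != 0 by rewrite pnatr_eq0.
pose a z := N^-1 * ((t z - f z) * b z).
have sa : smooth a := smoothM (smooth_cst N^-1) (smoothM (smoothB st sf) sb).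
pose D z := dz_vec r z *m (dz_vec r z) ^t*.
have sD i j : csmooth (fun z => D z i j) by exact: csmooth_dz_vec_rank1.
have [M [sM ME]] := levi_mx_perturb k sF sa sr.
have [L [sL LE]] := levi_mx_perturb 0 sr sg sr.
pose F' z := F z + a z * r z ^+ k.+2.
have sF' : smooth F' := smoothD sF (smoothM sa (smoothX k.+2 sr)).
have sHF i j : csmooth (fun z => levi_mx F z i j) by exact: csmooth_levi_mx.
have sHr i j : csmooth (fun z => levi_mx r z i j) by exact: csmooth_levi_mx.
have [q1 sq1 E1] : cong_mod r k.+1 (fun z => \det (levi_mx F' z))
    (fun z => \det (levi_mx F z + (N * a z * r z ^+ k)%:C *: D z)).
  have sB i j : csmooth (fun z => (levi_mx F z + (N * a z * r z ^+ k)%:C *: D z) i j).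
    exact: csmooth_addZ (sHF i j) (sD i j)
      (smoothM (smoothM (smooth_cst N) sa) (smoothX k sr)).
  apply: cong_mod_det => [i j|//|i j]; first exact: csmooth_levi_mx.
  by exists (fun z => M z i j) => // z; rewrite ME mxE [X in _ + X]mxE.
have [q2 sq2 E2] : cong_mod r 1 (fun z => det_slope (levi_mx F z) (dz_vec r z)) (slope r).
  (* The slope is the difference of two values of the determinant, for e = 1 and
     e = 0; the Hessians of F and r differ by a rank one term modulo r, which
     does not change the slope. *)
  have main (e : R) : cong_mod r 1 (fun z => \det (levi_mx F z + e%:C *: D z))
      (fun z => \det (levi_mx r z + (2 * g z + e)%:C *: D z)).
    apply: cong_mod_det => i j.
    - exact: csmooth_addZ (sHF i j) (sD i j) (smooth_cst e).
    - exact: csmooth_addZ (sHr i j) (sD i j)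
        (smoothD (smoothM (smooth_cst 2) sg) (smooth_cst e)).
    - exists (fun z => L z i j) => // z.
      rewrite -/F /F LE !expr0 mulr1 !mxE -!/(D _) expr1.
      rewrite [((2 * g z + e)%:C)]rmorphD /=.
      have -> : ((2 * 1)%N%:R * g z : R) = 2 * g z by [].
      set x := levi_mx r z i j; set y := D z i j; set w := L z i j; ring.
  have m1 := main 1; have m0 := main 0.
  have [p1 sp1 e1] := m1; have [p0 sp0 e0] := m0.
  exists (fun z => p1 z - p0 z) => [|z].
    have := csmoothD sp1 (csmoothM (csmooth_cst _ (-1)) sp0).
    by congr csmooth; apply/funext => z; rewrite mulN1r.
  have dr (e : R) : \det (levi_mx r z + e%:C *: D z) = \det (levi_mx r z) + e%:C * slope r z.
    exact: det_add_rank1.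
  have dF (e : R) : \det (levi_mx F z + e%:C *: D z) =
      \det (levi_mx F z) + e%:C * det_slope (levi_mx F z) (dz_vec r z).
    exact: det_add_rank1.
  have {}e1 := etrans (esym (dF 1)) (etrans (e1 z) (congr1 (+%R^~ _) (dr _))).
  have {}e0 := etrans (esym (dF 0)) (etrans (e0 z) (congr1 (+%R^~ _) (dr _))).
  exact: slope_diff e1 e0.
pose c z := (t z - f z) * b z.
have sc : smooth c := smoothM (smoothB st sf) sb.
exists (fun z => g z + a z * r z ^+ k), (fun z => complex.Re ((c z)%:C * q2 z + q1 z)).
have FE : (fun z => r z + (g z + a z * r z ^+ k) * r z ^+ 2) = F'.
  by apply/funext => z; rewrite /F' /F !exprS; ring.
split=> [||z Wz].
- exact: smoothD sg (smoothM sa (smoothX k sr)).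
- have [] // : csmooth (fun z => (c z)%:C * q2 z + q1 z).
  exact: csmoothD (csmoothM (csmooth_real sc) sq2) sq1.
rewrite FE det_levi_mx_real//; congr (_%:C).
have Nac : N * a z = c z by rewrite /a mulrA mulfV// mul1r.
have dk : \det (levi_mx F z + (N * a z * r z ^+ k)%:C *: D z) =
    \det (levi_mx F z) + (c z * r z ^+ k)%:C * det_slope (levi_mx F z) (dz_vec r z).
  by rewrite -Nac; exact: det_add_rank1.
have e3 := etrans (E1 z) (congr1 (+%R^~ _)
  (etrans dk (congr2 (fun x y => x + _ * y) (detF z Wz) (E2 z)))).
exact: step_algebra (bW z Wz) (exprSr (r z) k) e3.
Qed.

(** The correction step, with target 0, raises the order of vanishing of the
    determinant on the zero set of [r] from 0 to [q]; a last step with the target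
    [(-1)^q] fixes the leading term, which makes the determinant nonnegative on the
    side where [r] is negative. *)
Lemma monge_ampere_approx r b (W : set V) q : smooth r -> smooth b ->
  (forall z, W z -> slope r z * (b z)%:C = 1) ->
  exists g f, [/\ smooth g, smooth f & forall z, W z ->
    \det (levi_mx (fun z => r z + g z * r z ^+ 2) z) = ((- r z) ^+ q + r z ^+ q.+1 * f z)%:C].
Proof.
move=> sr sb bW.
have [g [f [sg sf gf]]] : exists g f, [/\ smooth g, smooth f & forall z, W z ->
    \det (levi_mx (fun z => r z + g z * r z ^+ 2) z) = (r z ^+ q * f z)%:C].
  elim: q => [|k [g [f [sg sf gf]]]].
    exists (fun=> 0), (fun z => complex.Re (\det (levi_mx r z))); split.
    - exact: smooth_cst.
    - have [] // : csmooth (fun z => \det (levi_mx r z)).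
      by apply: csmooth_det => i j; exact: csmooth_levi_mx.
    - move=> z _; have -> : (fun z => r z + 0 * r z ^+ 2) = r.
        by apply/funext => w; rewrite mul0r addr0.
      by rewrite mul1r; exact: det_levi_mx_real.
  have [g' [f' [sg' sf' E]]] := monge_ampere_step sr sg sf (smooth_cst 0) sb bW gf.
  by exists g', f'; split=> // z /E ->; rewrite mulr0 add0r.
have [g' [f' [sg' sf' E]]] := monge_ampere_step sr sg sf (smooth_cst ((-1) ^+ q)) sb bW gf.
by exists g', f'; split=> // z /E ->; rewrite mulrC -exprMn mulN1r.
Qed.

End MongeAmpere.

(** * Plurisubharmonicity from the sign of the Levi form *)

Section Differential.
Variables (R : realType) (m : nat).
Implicit Types (f : 'rV[R]_m -> R) (z v w : 'rV[R]_m).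

Definition dirD v f z : R := \sum_k v 0 k * partial k f z.

Lemma smooth_dirD v f : smooth f -> smooth (dirD v f).
Proof.
move=> sf; apply: (@smooth_sum R m _ _ _ (fun k z => v 0 k * partial k f z)) => k.
exact: smoothM (smooth_cst (v 0 k)) (smooth_partial k sf).
Qed.

Lemma is_derive_dirD f z v (t : R) : smooth f ->
  is_derive t 1 (fun t : R => f (t *: v + z)) (dirD v f (t *: v + z)).
Proof. by move=> sf; apply: is_derive_line_at => y; exact: smooth_is_derive. Qed.

Lemma dirD_mean f z v : smooth f ->
  exists2 c : R, 0 < c < 1 & f (v + z) - f z = dirD v f (c *: v + z).
Proof.
move=> sf; pose F (t : R) := f (t *: v + z).
have dF (t : R) : is_derive t 1 F (dirD v f (t *: v + z)) by exact: is_derive_dirD.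
have cF : {within `[0, 1], continuous F}.
  by apply: derivable_within_continuous => s _; case: (dF s).
have [c c01 Fc] := MVT ltr01 (fun s _ => dF s) cF.
exists c; first by move: c01; rewrite in_itv.
by move: Fc; rewrite /F scale1r scale0r add0r subr0 mulr1.
Qed.

Lemma dirD_linear f z : linear (fun v => dirD v f z).
Proof.
move=> a v w; rewrite -[RHS]/(a * dirD v f z + dirD w f z) /dirD mulr_sumr -big_split.
by apply: eq_bigr => k _; rewrite !mxE mulrDl mulrA.
Qed.

Lemma row_coord_le v k : `|v 0 k| <= `|v|.
Proof. by rewrite [leRHS]mx_normrE; apply: (le_bigmax _ (fun ij => `|v ij.1 ij.2|) (0, k)). Qed.

(** Continuous partial derivatives give a total differential, by the mean value
    theorem along segments. *)
Lemma smooth_differential f z : smooth f ->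
  differentiable f z /\ 'd f z = (fun v => dirD v f z) :> ('rV[R]_m -> R).
Proof.
move=> sf.
pose glM := GRing.isLinear.Build _ _ _ _ _ (dirD_linear f z).
pose L : {linear 'rV[R]_m -> R} := HB.pack (fun v => dirD v f z) glM.
have cL : continuous L.
  apply: (smooth_continuous (f := fun v => dirD v f z)).
  apply: (@smooth_sum R m _ _ _ (fun k v => v 0 k * partial k f z)) => k.
  exact: smoothM (smooth_coord k) (smooth_cst (partial k f z)).
have oL : f \o shift z = cst (f z) + (L : 'rV[R]_m -> R) +o_ (0 : 'rV[R]_m) id.
  apply/eqaddoP => _/posnumP[e].
  have e0 : 0 < e%:num / (m%:R + 1) by rewrite divr_gt0// ltr_wpDl.
  have kP k : \forall w \near z, `|partial k f z - partial k f w| < e%:num / (m%:R + 1).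
    have /cvgrPdist_lt := @smooth_continuous R m _ (smooth_partial k sf) z.
    exact.
  have /nbhs_ballP[d /= d0 dP] := @filter_forall _ _ _ _ (nbhs_filter z) kP.
  near=> h.
  have hd : `|h| < d.
    by near: h; apply/nbhs_ballP; exists d => //= h; rewrite -ball_normE /= sub0r normrN.
  have -> : (f \o shift z - (cst (f z) + L)) h = f (h + z) - f z - dirD h f z.
    by rewrite !fctE /= opprD addrA.
  have [c /andP[c0 c1] ->] := dirD_mean z h sf.
  rewrite /dirD -sumrB; apply: le_trans (ler_norm_sum _ _ _) _.
  have -> : e%:num * `|id h| = e%:num * `|h| by [].
  apply: (@le_trans _ _ (\sum_(k < m) `|h| * (e%:num / (m%:R + 1)))).
    apply: ler_sum => k _; rewrite -mulrBr normrM ler_pM// ?row_coord_le//.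
    rewrite distrC ltW//; apply: dP; rewrite -ball_normE /= opprD addrC subrK normrN.
    rewrite normrZ ger0_norm ?ltW//; apply: le_lt_trans hd.
    by rewrite -[leRHS]mul1r ler_wpM2r// ltW.
  rewrite sumr_const card_ord -[_ *+ m]mulr_natl.
  rewrite [leLHS](_ : _ = e%:num * `|h| * (m%:R / (m%:R + 1))); last by ring.
  by rewrite ler_piMr ?mulr_ge0// ler_pdivrMr ?ltr_wpDl// mul1r lerDl.
have dE := diff_unique cL oL.
by split; [apply/diff_locallyP; rewrite dE; split|rewrite dE].
Unshelve. all: by end_near. Qed.

Lemma is_derive_scale (x : R -> R) (x' : R) v (t : R) : is_derive t 1 x x' ->
  is_derive t 1 (fun t => x t *: v) (x' *: v).
Proof.
move=> dx; have dxd : differentiable x t by apply/derivable1_diffP; case: dx.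
apply: DeriveDef; first exact/diff_derivable/differentiableZl.
rewrite deriveE; last exact: differentiableZl.
by rewrite (diffZl v dxd) -deriveE//; case: dx => [_ ->].
Qed.

Lemma smooth_is_derive_curve f (x y : R -> R) (x' y' : R) (v w z : 'rV[R]_m) (t : R) :
  smooth f -> is_derive t 1 x x' -> is_derive t 1 y y' ->
  let p := x t *: v + (y t *: w + z) in
  is_derive t 1 (fun t => f (x t *: v + (y t *: w + z)))
    (x' * dirD v f p + y' * dirD w f p).
Proof.
move=> sf dx dy p.
pose g := (fun t => x t *: v) + ((fun t => y t *: w) + cst z).
have gE s : g s = x s *: v + (y s *: w + z) by [].
have [dxd dyd] : differentiable x t /\ differentiable y t.
  by split; apply/derivable1_diffP; [case: dx|case: dy].
have dxv : differentiable (fun t => x t *: v) t by exact: differentiableZl.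
have dyw : differentiable (fun t => y t *: w) t by exact: differentiableZl.
have dwz := differentiableD dyw (differentiable_cst z t).
have dg : differentiable g t := differentiableD dxv dwz.
have [df dfE] := smooth_differential (g t) sf.
have dfg : differentiable (f \o g) t := differentiable_comp dg df.
have [_ dgE] := is_deriveD (is_derive_scale v dx)
  (is_deriveD (is_derive_scale w dy) (is_derive_cst z t (1 : R))).
rewrite addr0 (deriveE (1 : R) dg) in dgE.
suff : is_derive t 1 (f \o g) (x' * dirD v f p + y' * dirD w f p) by [].
apply: DeriveDef; first exact/derivable1_diffP.
rewrite (deriveE (1 : R) dfg) (diff_comp dg df) /= dfE dgE.
have := dirD_linear f (g t) x' v (y' *: w) => ->.
have := dirD_linear f (g t) y' w 0; rewrite addr0 => ->.
by rewrite {3}/dirD big1 ?addr0// => k _; rewrite mxE mul0r.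
Qed.

End Differential.

Section CircleMean.
Variable R : realType.
Local Notation mu := (@lebesgue_measure R).
Implicit Types (K F : R -> R).

Definition cint K : R := (\int[mu]_(t in `[0, (2 * pi)]) K t)%R.

Lemma twopi_gt0 : 0 < 2 * pi :> R.
Proof. by rewrite mulr_gt0// pi_gt0. Qed.

Lemma cint_integrable K : continuous K -> mu.-integrable `[0, 2 * pi] (EFin \o K).
Proof.
move=> cK; apply: continuous_compact_integrable; first exact: segment_compact.
exact: continuous_subspaceT.
Qed.

Lemma cintD K F : continuous K -> continuous F ->
  cint (fun t => K t + F t) = cint K + cint F.
Proof. by move=> cK cF; rewrite /cint RintegralD//; exact: cint_integrable. Qed.

Lemma cintZ (c : R) K : continuous K -> cint (fun t => c * K t) = c * cint K.
Proof. by move=> cK; rewrite /cint RintegralZl//; exact: cint_integrable. Qed.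

Lemma cint_ge0 K : (forall t, 0 <= K t) -> 0 <= cint K.
Proof. by move=> K0; apply: Rintegral_ge0. Qed.

Lemma cint_cst (c : R) : cint (fun=> c) = c * (2 * pi).
Proof.
rewrite /cint Rintegral_cst//= lebesgue_measure_itv/= lte_fin twopi_gt0.
by rewrite sube0.
Qed.

Lemma cint_EFin K : continuous K ->
  (\int[mu]_(t in `[0%R, (2 * pi)%R]) (K t)%:E = (cint K)%:E)%E.
Proof.
move=> cK; rewrite /cint /Rintegral fineK//.
exact: integrable_fin_num (cint_integrable cK).
Qed.

Lemma is_derive_continuous K F : (forall t : R, is_derive t 1 K (F t)) -> continuous K.
Proof.
by move=> dK t; apply/differentiable_continuous/derivable1_diffP; case: (dK t).
Qed.

Lemma cint_derive K F : (forall t : R, is_derive t 1 F (K t)) -> continuous K ->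
  cint K = F (2 * pi) - F 0.
Proof.
move=> dF cK; have cF := is_derive_continuous dF.
apply: EFin_inj; rewrite -cint_EFin// (@continuous_FTC2 _ _ F)//.
- exact: twopi_gt0.
- exact: continuous_subspaceT.
- split; first by move=> x _; case: (dF x).
    exact/cvg_at_right_filter/cF.
  exact/cvg_at_left_filter/cF.
- by move=> x _; rewrite derive1E; case: (dF x).
Qed.

Lemma continuous_slice (K : R -> R -> R) (s : R) :
  continuous (fun p : R * R => K p.1 p.2) -> continuous (K s).
Proof.
move=> cK t; apply: (@continuous_comp _ _ _ (fun t => (s, t)) (fun p : R * R => K p.1 p.2)).
  have cs : (fun=> s) x @[x --> t] --> s by exact: cvg_cst.
  exact: (cvg_pair cs cvg_id).
exact: cK.
Qed.

(** Differentiation under the integral; the domination is the maximum of the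
    derivative over a compact rectangle. *)
Lemma is_derive_cint (K K' : R -> R -> R) :
  (forall r t : R, is_derive r 1 (K ^~ t) (K' r t)) ->
  continuous (fun p : R * R => K p.1 p.2) ->
  continuous (fun p : R * R => K' p.1 p.2) ->
  forall r : R, is_derive r 1 (fun r => cint (K r)) (cint (K' r)).
Proof.
move=> dK cK cK' r.
have cKr (s : R) : continuous (K s).
  exact: continuous_slice.
pose A : set (R * R) := `[r - 1, r + 1] `*` `[0, 2 * pi].
have cA : compact A by apply: compact_setX; exact: segment_compact.
have A0 : A !=set0.
  exists (r, 0); split; rewrite /= in_itv/=; first by rewrite gerBl lerDl ler01.
  by rewrite lexx ltW// twopi_gt0.
have [p _ pmax] := compact_EVT_max A0 cA (continuous_subspaceT
  (fun p => continuous_comp (cK' p) (@norm_continuous _ _ _))).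
pose B := `|K' p.1 p.2|.
have d1 s t : partial1of2 K s t = K' s t.
  by rewrite /partial1of2 derive1E; case: (dK s t).
have Ir : `]r - 1, r + 1[%classic r by rewrite /= in_itv/= gtrBl ltr01 ltrDl ltr01.
have mI : measurable (`[0, 2 * pi]%classic : set (measurableTypeR R)) by [].
have intK s : `]r - 1, r + 1[%classic s -> mu.-integrable `[0, 2 * pi] (EFin \o K s).
  by move=> _; exact: cint_integrable.
have dK' s t : `]r - 1, r + 1[%classic s -> (`[0, 2 * pi]%classic : set R) t -> derivable (K ^~ t) s 1.
  by move=> _ _; case: (dK s t).
have intB : mu.-integrable `[0, 2 * pi] (EFin \o (cst B)).
  by apply: cint_integrable; exact: cst_continuous.
have ubB s t : `]r - 1, r + 1[%classic s -> (`[0, 2 * pi]%classic : set R) t ->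
    `|partial1of2 K s t| <= cst B t.
  move=> sI tI; rewrite d1; apply: (pmax (s, t)); rewrite inE; split => //=.
  exact: subset_itv_oo_cc.
have E : partial1of2 K r = K' r by apply/funext => t; exact: d1.
have B0 (y : R) : 0 <= cst B y by exact: normr_ge0.
have D := derivable_under_integral mI Ir intK dK' B0 intB ubB.
have D' := differentiation_under_integral mI Ir intK dK' B0 intB ubB.
apply: DeriveDef; first exact: D.
by rewrite -derive1E; refine (etrans D' _); rewrite /cint -E.
Qed.

End CircleMean.

Section SubMean.
Variables (R : realType) (m : nat).
Variables (v w a : 'rV[R]_m).
Implicit Types (f g : 'rV[R]_m -> R).

Let pt (r t : R) := (r * cos t) *: v + ((r * sin t) *: w + a).

Lemma circle_continuous : continuous (fun p : R * R => pt p.1 p.2).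
Proof.
move=> p.
have c1 : (fun p : R * R => p.1) x @[x --> p] --> p.1 by exact: cvg_fst.
have c2 : (fun p : R * R => p.2) x @[x --> p] --> p.2 by exact: cvg_snd.
have cc : cos x.2 @[x --> p] --> cos p.2.
  by apply: cvg_comp c2 _; exact: continuous_cos.
have cs : sin x.2 @[x --> p] --> sin p.2.
  by apply: cvg_comp c2 _; exact: continuous_sin.
apply: cvgD; first by apply: cvgZr_tmp; exact: cvgM.
by apply: cvgD; [apply: cvgZr_tmp; exact: cvgM|exact: cvg_cst].
Qed.

Lemma circle_term_continuous (al : R -> R) g : continuous al -> smooth g ->
  continuous (fun p : R * R => al p.2 * g (pt p.1 p.2)).
Proof.
move=> cal sg p; apply: cvgM.
  by apply: (@cvg_comp _ _ _ snd al); [exact: cvg_snd|exact: cal].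
apply: (@cvg_comp _ _ _ (fun p : R * R => pt p.1 p.2) g); first exact: circle_continuous.
exact: smooth_continuous.
Qed.

Lemma circle_radial_derive g (r t : R) : smooth g ->
  is_derive r 1 (fun r => g (pt r t))
    (cos t * dirD v g (pt r t) + sin t * dirD w g (pt r t)).
Proof.
move=> sg; apply: (smooth_is_derive_curve (x := fun r => r * cos t)
  (y := fun r => r * sin t)) => //.
  have := is_deriveZ (cos t) (is_derive_id r (1 : R)).
  rewrite [_ *: 1]mulr1; congr is_derive; apply/funext => s.
  exact: mulrC.
have := is_deriveZ (sin t) (is_derive_id r (1 : R)).
rewrite [_ *: 1]mulr1; congr is_derive; apply/funext => s.
exact: mulrC.
Qed.

Lemma circle_angular_derive g (r t : R) : smooth g ->
  is_derive t 1 (fun t => g (pt r t))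
    (- (r * sin t) * dirD v g (pt r t) + (r * cos t) * dirD w g (pt r t)).
Proof.
move=> sg; apply: (smooth_is_derive_curve (x := fun t => r * cos t)
  (y := fun t => r * sin t)) => //.
  by have := is_deriveZ r (is_derive_cos t); rewrite -[r *: _]/(_ * _) mulrN.
Qed.

(** The circle mean of a function with nonnegative Laplacian increases with the
    radius: with M(r) the integral over the circle of radius r,
    r (r M'(r))' is r^2 times the integral of the Laplacian, because the angular
    second derivative has integral zero over a full turn. *)
Lemma circle_mean_ge f : smooth f ->
  (forall r t : R, 0 < r < 1 ->
     0 <= dirD v (dirD v f) (pt r t) + dirD w (dirD w f) (pt r t)) ->
  f a * (2 * pi) <= cint (fun t => f (pt 1 t)).
Proof.
move=> sf lap0.
have [sv sw] := (smooth_dirD v sf, smooth_dirD w sf).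
have svv := smooth_dirD v sv; have swv := smooth_dirD w sv.
have svw := smooth_dirD v sw; have sww := smooth_dirD w sw.
have [cc cs] := (@continuous_cos R, @continuous_sin R).
have c1 : continuous (fun _ : R => 1 : R) by exact: cst_continuous.
pose G r t := f (pt r t).
pose P r t := cos t * dirD v f (pt r t) + sin t * dirD w f (pt r t).
pose Pr r t :=
  cos t * (cos t * dirD v (dirD v f) (pt r t) + sin t * dirD w (dirD v f) (pt r t)) +
  sin t * (cos t * dirD v (dirD w f) (pt r t) + sin t * dirD w (dirD w f) (pt r t)).
pose T r t := - (r * sin t) * dirD v f (pt r t) + (r * cos t) * dirD w f (pt r t).
pose L r t := dirD v (dirD v f) (pt r t) + dirD w (dirD w f) (pt r t).
pose Tt r t :=
  (- (r * sin t) * (- (r * sin t) * dirD v (dirD v f) (pt r t) +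
      (r * cos t) * dirD w (dirD v f) (pt r t)) +
   dirD v f (pt r t) * - (r * cos t)) +
  (r * cos t * (- (r * sin t) * dirD v (dirD w f) (pt r t) +
      (r * cos t) * dirD w (dirD w f) (pt r t)) +
   dirD w f (pt r t) * - (r * sin t)).
have dG (r t : R) : is_derive r 1 (G ^~ t) (P r t) by exact: circle_radial_derive.
have dP (r t : R) : is_derive r 1 (P ^~ t) (Pr r t).
  exact: (is_deriveD (is_deriveZ (cos t) (circle_radial_derive r t sv))
    (is_deriveZ (sin t) (circle_radial_derive r t sw))).
have dT (r t : R) : is_derive t 1 (T r) (Tt r t).
  have d1 : is_derive t 1 (fun t => - (r * sin t)) (- (r * cos t)).
    exact: is_deriveN (is_deriveZ r (is_derive_sin t)).
  have d2 : is_derive t 1 (fun t => r * cos t) (- (r * sin t)).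
    by have := is_deriveZ r (is_derive_cos t); rewrite -[r *: _]/(_ * _) mulrN.
  exact: (is_deriveD (is_deriveM d1 (circle_angular_derive r t sv))
    (is_deriveM d2 (circle_angular_derive r t sw))).
have key r t : r * (P r t + r * Pr r t) + Tt r t = r ^+ 2 * L r t.
  have := cos2Dsin2 t.
  rewrite /P /Pr /Tt /L; set c := cos t; set s := sin t.
  set a1 := dirD v f _; set a2 := dirD w f _.
  set b1 := dirD v (dirD v f) _; set b2 := dirD w (dirD v f) _.
  set b3 := dirD v (dirD w f) _; set b4 := dirD w (dirD w f) _.
  clearbody c s a1 a2 b1 b2 b3 b4 => cs1.
  rewrite -[RHS]mul1r -cs1; ring.
have cG : continuous (fun p : R * R => G p.1 p.2).
  have -> : (fun p : R * R => G p.1 p.2) = fun p => 1 * f (pt p.1 p.2).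
    by apply/funext => p; rewrite mul1r.
  exact: (circle_term_continuous c1 sf).
have cP : continuous (fun p : R * R => P p.1 p.2).
  move=> p; apply: cvgD.
    exact: (circle_term_continuous cc sv).
  exact: (circle_term_continuous cs sw).
have cPr : continuous (fun p : R * R => Pr p.1 p.2).
  have cont_fst (al : R -> R) : continuous al -> continuous (fun p : R * R => al p.2).
    by move=> cal p; apply: (@cvg_comp _ _ _ snd al); [exact: cvg_snd|exact: cal].
  move=> p; apply: cvgD; apply: cvgM; try exact: cont_fst.
    by apply: cvgD; [exact: (circle_term_continuous cc svv)|
      exact: (circle_term_continuous cs swv)].
  by apply: cvgD; [exact: (circle_term_continuous cc svw)|
    exact: (circle_term_continuous cs sww)].
have slice (K : R -> R -> R) r : continuous (fun p : R * R => K p.1 p.2) -> continuous (K r).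
  exact: continuous_slice.
have cL r : continuous (L r).
  apply: slice.
  have -> : (fun p : R * R => L p.1 p.2) =
      fun p => 1 * (dirD v (dirD v f) (pt p.1 p.2) + dirD w (dirD w f) (pt p.1 p.2)).
    by apply/funext => p; rewrite mul1r.
  exact: (circle_term_continuous c1 (smoothD svv sww)).
have dM (r : R) : is_derive r 1 (fun r => cint (G r)) (cint (P r)).
  exact: is_derive_cint.
have dN (r : R) : is_derive r 1 (fun r => cint (P r)) (cint (Pr r)).
  exact: is_derive_cint.
have Tper (r : R) : T r (2 * pi) = T r 0.
  by rewrite /T /pt [2 * pi]mulr_natl cos2pi sin2pi cos0 sin0.
have cTt (r : R) : continuous (Tt r).
  have -> : Tt r = fun t => r ^+ 2 * L r t - r * (P r t + r * Pr r t).
    by apply/funext => t; rewrite -key addrC addKr.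
  have cPs := slice P r cP; have cPrs := slice Pr r cPr.
  move=> t; apply: cvgB; first by apply: cvgM; [exact: cvg_cst|exact: cL].
  apply: cvgM; first exact: cvg_cst.
  apply: cvgD; first exact: cPs.
  by apply: cvgM; [exact: cvg_cst|exact: cPrs].
have slope (r : R) : r * (cint (P r) + r * cint (Pr r)) = r ^+ 2 * cint (L r).
  have cPs := slice P r cP; have cPrs := slice Pr r cPr.
  have crPr : continuous (fun t => r * Pr r t).
    by move=> t; apply: cvgM; [exact: cvg_cst|exact: cPrs].
  have cS : continuous (fun t => P r t + r * Pr r t).
    by move=> t; apply: cvgD; [exact: cPs|exact: crPr].
  have crS : continuous (fun t => r * (P r t + r * Pr r t)).
    by move=> t; apply: cvgM; [exact: cvg_cst|exact: cS].
  rewrite -(cintZ r cPrs) -(cintD cPs crPr) -(cintZ r cS) -(cintZ (r ^+ 2) (cL r)).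
  have -> : (fun t => r ^+ 2 * L r t) = fun t => r * (P r t + r * Pr r t) + Tt r t.
    by apply/funext => t; rewrite key.
  by rewrite (cintD crS (cTt r)) (cint_derive (dT r) (cTt r)) Tper subrr addr0.
pose Q (r : R) := r * cint (P r).
have dQ (r : R) : is_derive r 1 Q (cint (P r) + r * cint (Pr r)).
  have := is_deriveM (is_derive_id r (1 : R)) (dN r).
  by rewrite -![_ *: _]/(_ * _) mulr1 addrC.
have N0 (r : R) : 0 < r < 1 -> 0 <= cint (P r).
  move=> /andP[r0 r1].
  have cQ : {within `[0, r], continuous Q}.
    by apply: derivable_within_continuous => s _; case: (dQ s).
  have [c c0r Qc] := MVT r0 (fun s _ => dQ s) cQ.
  move: c0r; rewrite in_itv/= => /andP[c0 cr].
  have : 0 <= r * cint (P r).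
    have -> : r * cint (P r) = Q r - Q 0 by rewrite /Q mul0r subr0.
    rewrite Qc subr0 mulr_ge0//; last exact: ltW.
    rewrite -(pmulr_rge0 _ c0) slope mulr_ge0 ?sqr_ge0//.
    apply: cint_ge0 => t; apply: lap0; rewrite c0 /=; exact: lt_trans r1.
  by rewrite pmulr_rge0.
have cM : {within `[0, 1], continuous (fun r => cint (G r))}.
  by apply: derivable_within_continuous => s _; case: (dM s).
have [c c01 Mc] := MVT ltr01 (fun s _ => dM s) cM.
have G0 : cint (G 0) = f a * (2 * pi).
  rewrite -cint_cst; congr cint; apply/funext => t.
  by rewrite /G /pt !mul0r !scale0r !add0r.
rewrite -G0 -subr_ge0 [X in 0 <= X]Mc subr0 mulr1; apply: N0.
by move: c01; rewrite in_itv.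
Qed.

End SubMean.

Section Plurisubharmonic.
Variables (R : realType) (n : nat).
Implicit Types (u : 'rV[R]_(n + n) -> R) (z W a : 'rV[R]_(n + n)).

Lemma partial_sum (I : Type) (s : seq I) (F : I -> 'rV[R]_(n + n) -> R) k z :
  (forall i, smooth (F i)) ->
  partial k (fun z => \sum_(i <- s) F i z) z = \sum_(i <- s) partial k (F i) z.
Proof.
move=> sF; elim: s => [|i s ih].
  under [X in partial k X]eq_fun do rewrite big_nil.
  by rewrite big_nil; exact: partial_cst.
under [X in partial k X]eq_fun do rewrite big_cons.
rewrite big_cons -ih; apply: partialD => //.
exact: (@smooth_sum R _ _ _ _ F).
Qed.

Lemma dirD2 u z W : smooth u -> dirD W (dirD W u) z = quad (hess u z) W.
Proof.
move=> su; rewrite /quad {1}/dirD; apply: eq_bigr => k _.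
have sl l : smooth (fun z => W 0 l * partial l u z).
  exact: smoothM (smooth_cst (W 0 l)) (smooth_partial l su).
rewrite {1}/dirD (partial_sum _ _ _ sl) mulr_sumr; apply: eq_bigr => l _.
rewrite (partialZ (W 0 l) k z (smooth_partial l su)) /hess.
by set p := partial _ _ _; clearbody p; ring.
Qed.

Lemma of_complex_rowZ (x y : R) (w : 'rV[R[i]]_n) :
  of_complex_row ((x +i* y) *: w) =
  x *: of_complex_row w + y *: mul_i (of_complex_row w).
Proof.
rewrite /of_complex_row mul_i_row_mx !scale_row_mx add_row_mx.
by congr row_mx; apply/rowP => j; rewrite !mxE; case: (w 0 j) => p q /=; ring.
Qed.

(** The Laplacian on the complex disc through [a] in the direction [w] is the Levi
    form in that direction, so that the circle means dominate the value at the
    centre. *)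
Lemma plurisubharmonic_of_levi (Omega : set 'rV[R]_(n + n)) u : smooth u ->
  (forall z, Omega z -> forall W, 0 <= levi_quad (hess u z) W) ->
  plurisubharmonic_on Omega u.
Proof.
move=> su L0; split=> [z _ c uc|a w disc].
  have cu : u @ z --> u z by exact: smooth_continuous.
  exact: (cvgr_lt _ cu).
set v := of_complex_row w.
have ptE (x y : R) : a + of_complex_row ((x +i* y) *: w) = x *: v + (y *: mul_i v + a).
  by rewrite of_complex_rowZ addrC -addrA.
have main := @circle_mean_ge R _ v (mul_i v) a u su.
have {}main : u a * (2 * pi) <=
    cint (fun t => u ((1 * cos t) *: v + ((1 * sin t) *: mul_i v + a))).
  apply: main => r t /andP[r0 r1]; rewrite !dirD2//; apply: L0.
  rewrite -ptE; apply: disc.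
  rewrite normc_def -[leRHS]/((1 : R)%:C) lecR -[leRHS]sqrtr1 ler_sqrt//=.
  by rewrite !exprMn -mulrDr cos2Dsin2 mulr1 expr_le1// ltW.
have cu : continuous (fun t : R => u ((1 * cos t) *: v + ((1 * sin t) *: mul_i v + a))).
  have c1 : continuous (fun _ : R => 1 : R) by exact: cst_continuous.
  have := @circle_term_continuous R _ v (mul_i v) a _ u c1 su.
  move=> /(@continuous_slice R (fun r t =>
    1 * u ((r * cos t) *: v + ((r * sin t) *: mul_i v + a))) 1).
  by under eq_fun do rewrite mul1r.
have -> : (fun t : R => (u (a + of_complex_row ((cos t +i* sin t) *: w)))%:E) =
    (fun t => (u ((1 * cos t) *: v + ((1 * sin t) *: mul_i v + a)))%:E).
  by apply/funext => t; rewrite ptE !mul1r.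
rewrite cint_EFin// -EFinM lee_fin mulrC ler_pdivlMr//; exact: twopi_gt0.
Qed.

End Plurisubharmonic.

(** * Positivity of the Levi form near a point *)

Section LeviPositivity.
Variables (R : realType) (n : nat).
Local Notation V := 'rV[R]_(n + n).
Implicit Types (u : V -> R) (z p W : V) (K : R).

Definition tangent u z W : Prop := dirD W u z = 0 /\ dirD (mul_i W) u z = 0.

Definition levi_tangent_pos u z : Prop :=
  forall W, W != 0 -> tangent u z W -> 0 < levi_quad (hess u z) W.

Definition grad_sq u z W : R := dirD W u z ^+ 2 + dirD (mul_i W) u z ^+ 2.

(** Positivity of the complex Hessian after adding [K] times the squared gradient.
    Unlike positivity on the complex tangent space it is visibly an open
    condition, since the vectors range over a fixed space. *)
Definition levi_pos K u z : Prop :=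
  forall W, W != 0 -> 0 < levi_quad (hess u z) W + K * grad_sq u z W.

Lemma continuous_bigsum (T : topologicalType) m (F : 'I_m -> T -> R) :
  (forall i, continuous (F i)) -> continuous (fun x => \sum_i F i x).
Proof.
move=> cF x; suff : forall r : seq 'I_m,
    (\sum_(i <- r) F i y) @[y --> x] --> \sum_(i <- r) F i x by exact.
elim=> [|i r ih].
  by under eq_fun do rewrite big_nil; rewrite big_nil; exact: cvg_cst.
under eq_fun do rewrite big_cons.
by rewrite big_cons; apply: cvgD => //; exact: cF.
Qed.

Lemma continuous_fst_comp (g : V -> R) : continuous g ->
  continuous (fun q : V * V => g q.1).
Proof. by move=> cg q; apply: (@cvg_comp _ _ _ fst g); [exact: cvg_fst|exact: cg]. Qed.

Lemma continuous_snd_comp (g : V -> R) : continuous g ->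
  continuous (fun q : V * V => g q.2).
Proof. by move=> cg q; apply: (@cvg_comp _ _ _ snd g); [exact: cvg_snd|exact: cg]. Qed.

Lemma mul_i_coord_continuous k : continuous (fun W => mul_i W 0 k : R).
Proof.
have [j ->|j ->] := split_ordP k.
  have -> : (fun W => mul_i W 0 (lshift n j) : R) = fun W => - W 0 (rshift n j).
    by apply/funext => W; rewrite row_mxEl !mxE.
  move=> W; have cW : (fun W : V => W 0 (rshift n j)) @ W --> W 0 (rshift n j).
    exact: coord_continuous.
  exact: (cvgN cW).
have -> : (fun W => mul_i W 0 (rshift n j) : R) = fun W => W 0 (lshift n j).
  by apply/funext => W; rewrite row_mxEr !mxE.
exact: coord_continuous.
Qed.

Lemma quad_continuous u (c : 'I_(n + n) -> V -> R) : smooth u ->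
  (forall k, continuous (c k)) ->
  continuous (fun q : V * V => \sum_k \sum_l hess u q.1 k l * (c k q.2 * c l q.2)).
Proof.
move=> su cc; apply: continuous_bigsum => k; apply: continuous_bigsum => l q.
apply: cvgM; first exact: (continuous_fst_comp (smooth_continuous (smooth_hess k l su))).
by apply: cvgM; exact: (continuous_snd_comp (cc _)).
Qed.

Lemma lin_continuous u (c : 'I_(n + n) -> V -> R) : smooth u ->
  (forall k, continuous (c k)) ->
  continuous (fun q : V * V => \sum_k c k q.2 * partial k u q.1).
Proof.
move=> su cc; apply: continuous_bigsum => k q; apply: cvgM.
  exact: (continuous_snd_comp (cc _)).
exact: (continuous_fst_comp (smooth_continuous (smooth_partial k su))).
Qed.

Lemma levi_quad_continuous u : smooth u ->
  continuous (fun q : V * V => levi_quad (hess u q.1) q.2).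
Proof.
move=> su q; apply: cvgD.
  by apply: (quad_continuous su (c := fun k W => W 0 k)) => k; exact: coord_continuous.
exact: (quad_continuous su mul_i_coord_continuous).
Qed.

Lemma grad_sq_continuous u : smooth u ->
  continuous (fun q : V * V => grad_sq u q.1 q.2).
Proof.
move=> su.
have -> : (fun q : V * V => grad_sq u q.1 q.2) = fun q => dirD q.2 u q.1 * dirD q.2 u q.1 +
    dirD (mul_i q.2) u q.1 * dirD (mul_i q.2) u q.1.
  by apply/funext => q; rewrite /grad_sq !expr2.
have c1 : continuous (fun q : V * V => dirD q.2 u q.1).
  by apply: (lin_continuous su (c := fun k W => W 0 k)) => k; exact: coord_continuous.
have c2 : continuous (fun q : V * V => dirD (mul_i q.2) u q.1).
  exact: (lin_continuous su mul_i_coord_continuous).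
by move=> q; apply: cvgD; apply: cvgM; by [exact: c1|exact: c2].
Qed.

Lemma mul_iZ (c : R) W : mul_i (c *: W) = c *: mul_i W.
Proof.
rewrite /mul_i scale_row_mx; congr row_mx; apply/rowP => j; rewrite !mxE.
  by rewrite mulrN.
by [].
Qed.

Lemma dirDZ u z (c : R) W : dirD (c *: W) u z = c * dirD W u z.
Proof. by rewrite /dirD mulr_sumr; apply: eq_bigr => k _; rewrite mxE mulrA. Qed.

Lemma quad_scale S (c : R) W : quad S (c *: W) = c ^+ 2 * quad S W.
Proof.
rewrite /quad mulr_sumr; apply: eq_bigr => k _; rewrite mulr_sumr.
by apply: eq_bigr => l _; rewrite !mxE; ring.
Qed.

Lemma levi_pos_scale K u z (c : R) W :
  levi_quad (hess u z) (c *: W) + K * grad_sq u z (c *: W) =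
  c ^+ 2 * (levi_quad (hess u z) W + K * grad_sq u z W).
Proof. by rewrite /levi_quad /grad_sq mul_iZ !quad_scale !dirDZ !exprMn; ring. Qed.

Lemma grad_sq_ge0 u z W : 0 <= grad_sq u z W.
Proof. by rewrite addr_ge0 ?sqr_ge0. Qed.

(** On the unit sphere the Levi form is positive where the gradient term vanishes;
    elsewhere the gradient term is positive and a large multiple of it dominates.
    Both persist for nearby vectors and base points, and the sphere is compact. *)
Lemma levi_pos_near u p : smooth u -> levi_tangent_pos u p ->
  \forall z \near p & K \near +oo, levi_pos K u z.
Proof.
move=> su tp.
pose S : set V := [set W | `|W| = 1].
have cS : compact S.
  apply: bounded_closed_compact.
    by exists 1; split; [exact: num_real|move=> x x1 W /= ->; exact: ltW].
  rewrite (_ : S = (fun W : V => `|W|) @^-1` [set 1])//.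
  by apply: closed_comp; [move=> W _; exact: norm_continuous|exact: closed_eq].
have covS : \forall zK \near (nbhs p, pinfty_nbhs R),
    S `<=` (fun W => 0 < levi_quad (hess u zK.1) W + zK.2 * grad_sq u zK.1 W).
  move/compact_near_coveringP : cS.
  move/(_ _ (filter_prod (nbhs p) (pinfty_nbhs R))
     (fun zK W => 0 < levi_quad (hess u zK.1) W + zK.2 * grad_sq u zK.1 W)).
  apply => W W1.
  have W0 : W != 0 by rewrite -normr_eq0 W1 oner_eq0.
  pose q0 : V * V := (p, W).
  have cL := levi_quad_continuous su (x := q0).
  have cT := grad_sq_continuous su (x := q0).
  have [t0|t0] := eqVneq (grad_sq u p W) 0.
    have L0 : 0 < levi_quad (hess u p) W.
      apply: tp => //; move/eqP: t0.
      by rewrite paddr_eq0 ?sqr_ge0// !sqrf_eq0 => /andP[/eqP ? /eqP ?]; split.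
    have := cvgr_gt _ cL _ L0.
    move=> -[[A B] /= [nA nB] AB].
    exists (B, [set zK | A zK.1 /\ 0 <= zK.2]) => /=.
      split=> //; exists (A, [set K | 0 <= K]) => //=; first split => //.
        exact: nbhs_pinfty_ge.
    move=> [W' [z K]] /= [BW' [Az K0]].
    by rewrite ltr_wpDr ?mulr_ge0 ?grad_sq_ge0//; exact: (AB (z, W')).
  have tau0 : 0 < grad_sq u p W by rewrite lt_neqAle eq_sym t0 grad_sq_ge0.
  set tau := grad_sq u p W in tau0.
  pose l := levi_quad (hess u p) W.
  have tau2 : tau / 2 < tau by rewrite ltr_pdivrMr// mulr_natr mulr2n ltrDl.
  have [[A B] /= [nA nB] AB] := cvgr_gt _ cT _ tau2.
  have l1 : l - 1 < l by rewrite gtrBl.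
  have [[A' B'] /= [nA' nB'] AB'] := cvgr_gt _ cL _ l1.
  pose K0 := `|l - 1| / (tau / 2).
  exists (B `&` B', [set zK | (A `&` A') zK.1 /\ K0 <= zK.2]) => /=.
    split; first exact: filterI.
    exists (A `&` A', [set K | K0 <= K]) => //=; first split.
    - exact: filterI.
    - by apply: nbhs_pinfty_ge; exact: num_real.
  move=> [W' [z K]] /= [[BW' B'W'] [[Az A'z] KK]].
  have h1 : tau / 2 < grad_sq u z W' := AB (z, W') (conj Az BW').
  have h2 : l - 1 < levi_quad (hess u z) W' := AB' (z, W') (conj A'z B'W').
  have t20 : 0 < tau / 2 by rewrite divr_gt0.
  have h3 : `|l - 1| <= K * grad_sq u z W'.
    have K00 : 0 <= K by apply: le_trans KK; rewrite divr_ge0// ltW.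
    move: KK; rewrite ler_pdivrMr// => /le_trans; apply.
    by apply: ler_wpM2l => //; exact: ltW.
  have := ler_norm (- (l - 1)); rewrite normrN; lra.
have [[A B] /= [nA nB] AB] := covS.
exists (A, B) => //= -[z K] /= zK W W0.
have nW : 0 < `|W| by rewrite normr_gt0.
have iW : 0 < `|W|^-1 by rewrite invr_gt0.
rewrite -(pmulr_rgt0 _ (exprn_gt0 2 iW)) -levi_pos_scale.
apply: (AB (z, K) zK); rewrite /S /= normrZ ger0_norm ?invr_ge0// mulVf//.
by rewrite gt_eqF.
Qed.

(** The constant is found near each point and made uniform by compactness. *)
Lemma levi_pos_compact u (A : set V) : smooth u -> compact A ->
  (forall p, A p -> levi_tangent_pos u p) ->
  exists K, forall p, A p -> \forall z \near p, levi_pos K u z.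
Proof.
move=> su cA tp.
have : \forall K \near pinfty_nbhs R, A `<=` (fun p => \forall z \near p, levi_pos K u z).
  move/compact_near_coveringP : cA.
  move/(_ _ (pinfty_nbhs R) (fun K p => \forall z \near p, levi_pos K u z)).
  apply => p Ap; have [[B D] /= [nB nD] BD] := levi_pos_near su (tp p Ap).
  exists (B°, D) => /=; first by split=> //; exact: nbhs_interior.
  move=> -[p' K] /= [Bp' DK]; apply: filterS Bp' => z Bz; exact: (BD (z, K)).
by move=> /filter_ex[K KA]; exists K.
Qed.

End LeviPositivity.

(** * A global defining function *)

Section Germs.
Variables (R : realType) (n : nat).
Local Notation V := 'rV[R]_(n + n).
Implicit Types (u r : V -> R) (z p W : V).

Lemma near_eq_cpartial (g h : V -> R[i]) k z : (\forall w \near z, g w = h w) ->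
  cpartial k g z = cpartial k h z.
Proof.
move=> gh; congr (_ +i* _); apply: near_eq_partial.
  by apply: filterS gh => w ->.
by apply: filterS gh => w ->.
Qed.

Lemma near_eq_dz (g h : V -> R[i]) j z : (\forall w \near z, g w = h w) ->
  dz j g z = dz j h z.
Proof.
move=> gh; rewrite /dz (near_eq_cpartial (lshift n j) gh).
by rewrite (near_eq_cpartial (rshift n j) gh).
Qed.

Lemma near_eq_dzbar (g h : V -> R[i]) j z : (\forall w \near z, g w = h w) ->
  dzbar j g z = dzbar j h z.
Proof.
move=> gh; rewrite /dzbar (near_eq_cpartial (lshift n j) gh).
by rewrite (near_eq_cpartial (rshift n j) gh).
Qed.

Lemma near_eq_complexify u r z : (\forall w \near z, u w = r w) ->
  \forall w \near z, (u w)%:C = (r w)%:C.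
Proof. by apply: filterS => w ->. Qed.

Lemma near_eq_complex_hessian u r z : (\forall w \near z, u w = r w) ->
  complex_hessian u z = complex_hessian r z.
Proof.
move=> ur; apply/matrixP => i j; rewrite [LHS]mxE [RHS]mxE.
apply: near_eq_dz.
have : \forall w \near z, \forall w' \near w, (u w')%:C = (r w')%:C.
  exact/near_join/near_eq_complexify.
by apply: filterS => w; exact: near_eq_dzbar.
Qed.

Definition to_complex_row W : 'rV[R[i]]_n :=
  \row_j (W 0 (lshift n j) +i* W 0 (rshift n j)).

Lemma to_complex_rowK W : of_complex_row (to_complex_row W) = W.
Proof.
rewrite -[RHS]hsubmxK /of_complex_row.
by congr row_mx; apply/rowP => j; rewrite !mxE.
Qed.

Lemma lin_dirD u z W : lin (fun k => partial k u z) W = dirD W u z.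
Proof. by apply: eq_bigr => k _; rewrite mulrC. Qed.

Lemma complex_tangentE u z W : tangent u z W ->
  complex_tangent u z (to_complex_row W).
Proof.
move=> [t1 t2]; rewrite /complex_tangent.
under eq_bigr do rewrite dzE.
by rewrite wirt_grad_dot to_complex_rowK !lin_dirD t1 t2 mulr0 oppr0.
Qed.

Lemma levi_tangent_posP u z : smooth u ->
  (forall w, w != 0 -> complex_tangent u z w -> 0 < levi_form u z w) ->
  levi_tangent_pos u z.
Proof.
move=> su L W W0 tW.
have w0 : to_complex_row W != 0.
  apply: contraNneq W0 => w0; rewrite -[W]to_complex_rowK w0.
  by apply/eqP/rowP => j; rewrite /of_complex_row !map_mx0 row_mx0 mxE.
have := L _ w0 (complex_tangentE tW); rewrite ltcE => /andP[_].
rewrite /levi_form (complex_hessianE z su) Re_wirt_hess to_complex_rowK.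
by rewrite pmulr_rgt0 ?invr_gt0.
Qed.

(** A bump function cuts the local function off; off the support the product is
    locally zero, on the open set it is a product of smooth functions. *)
Lemma smooth_extension (U : set V) r p : open U -> U p -> smooth_on U r ->
  exists2 u, smooth u & \forall z \near p, u z = r z.
Proof.
move=> oU Up sr.
have [chi [schi chi0 chi1 chiU]] := smooth_bump oU Up.
exists (fun z => chi z * r z); last by apply: filterS chi1 => z ->; rewrite mul1r.
pose U' : set V := [set z | chi z = 0]°.
have s1 : smooth_on U (fun z => chi z * r z).
  apply: smooth_expr_smooth => //; apply: se_mul; apply: se_smooth => //.
  by move=> s z _; exact: (schi s z I).
have s2 : smooth_on U' (fun z => chi z * r z).
  apply: smooth_expr_smooth; first exact: open_interior.
  apply: se_eq (se_cst _ 0) _ => z /set_mem Uz.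
  have : chi z = 0 by apply: (@interior_subset _ [set z | chi z = 0]).
  by move=> ->; rewrite mul0r.
move=> s z _; have [Uz|nUz] := pselect (U z); first exact: s1.
by apply: s2; exact: chiU.
Qed.

End Germs.

Section Admissible.
Variables (R : realType) (n : nat) (Omega : set 'rV[R]_(n + n)).
Local Notation V := 'rV[R]_(n + n).
Implicit Types (g h : V -> R) (z p v W : V).

(** Depends only on the germ of [g]: it defines the domain near [z], is regular
    there and satisfies the Levi condition. *)
Definition spsc_at g z : Prop :=
  [/\ \forall w \near z, Omega w <-> g w < 0, exists k, partial k g z != 0 &
      levi_tangent_pos g z].

(** The alternative for a localized defining function at the boundary points where
    the cutoff vanishes. *)
Definition null_jet g z : Prop :=
  (forall k, partial k g z = 0) /\ (forall k l, hess g z k l = 0).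

(** The localized defining functions satisfy this, and so do their sums.  The signs
    on both sides of the boundary are included because they make a sum negative
    exactly on the domain near the points where one summand is. *)
Definition admissible g : Prop :=
  [/\ smooth g, forall z, Omega z -> g z <= 0, forall z, ~ Omega z -> 0 <= g z &
      forall z, boundary Omega z -> spsc_at g z \/ null_jet g z].

(** What the global function must satisfy at the points of the closure.  In a sum
    of admissible functions it suffices that one summand satisfies it. *)
Definition defining_at g z : Prop :=
  (Omega z -> g z < 0) /\ (boundary Omega z -> spsc_at g z).

Lemma boundary_notin z : open Omega -> boundary Omega z -> ~ Omega z.
Proof. by move=> /interior_id oO [_]; rewrite oO. Qed.

Lemma admissible_boundary0 g z : open Omega -> admissible g -> boundary Omega z -> g z = 0.
Proof.
move=> oO [sg gle gge _] bz; apply/eqP; rewrite eq_le (gge _ (boundary_notin oO bz)) andbT.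
have cl : closed [set z | g z <= 0].
  apply: (closed_comp (f := g) (D := [set x | x <= 0])); last exact: closed_le.
  by move=> w _; exact: smooth_continuous.
case: bz => cz _; move/closure_id : cl => E.
suff : closure [set z | g z <= 0] z by rewrite -E.
by apply: closure_subset cz => w /gle.
Qed.

Lemma dirD_add_fun g h v z : smooth g -> smooth h ->
  dirD v (fun z => g z + h z) z = dirD v g z + dirD v h z.
Proof.
move=> sg sh; rewrite /dirD -big_split; apply: eq_bigr => k _ /=.
by rewrite (partialD k z sg sh) mulrDr.
Qed.

Lemma dirD_delta g k z : dirD (delta_mx 0 k) g z = partial k g z.
Proof.
rewrite /dirD (bigD1 k)//= mxE !eqxx mul1r big1 ?addr0// => l lk.
by rewrite mxE eqxx (negbTE lk) mul0r.
Qed.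

(** Moving from the boundary point in a direction where [g] decreases leads into
    the domain, where [h] is negative. *)
Lemma spsc_at_dir g h v z : smooth g -> smooth h -> spsc_at g z -> spsc_at h z ->
  g z = 0 -> h z = 0 -> dirD v g z < 0 -> dirD v h z <= 0.
Proof.
move=> sg sh [Og _ _] [Oh _ _] g0 h0 vg; rewrite leNgt; apply/negP => vh.
have slope_cvg f : smooth f ->
    t^-1 *: (f (t *: v + z) - f z) @[t --> 0^'] --> dirD v f z.
  by move=> sf; have [d e] := smooth_is_derive z v sf; rewrite /dirD -e; exact: d.
have ng : \forall t \near (0 : R)^', t^-1 *: (g (t *: v + z) - g z) < 0.
  exact: (cvgr_lt _ (slope_cvg g sg)).
have nh : \forall t \near (0 : R)^', 0 < t^-1 *: (h (t *: v + z) - h z).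
  exact: (cvgr_gt _ (slope_cvg h sh)).
have cl : (fun t : R => t *: v + z) t @[t --> 0] --> z.
  rewrite -[X in _ --> X]add0r -(scale0r v).
  by apply: cvgD; [apply: cvgZr_tmp; exact: cvg_id|exact: cvg_cst].
have nO : \forall t \near (0 : R), (Omega (t *: v + z) <-> g (t *: v + z) < 0) /\
    (Omega (t *: v + z) <-> h (t *: v + z) < 0).
  by apply: (cl (fun w => (Omega w <-> g w < 0) /\ (Omega w <-> h w < 0))); exact: filterI.
have N : \forall t \near (0 : R),
    ((Omega (t *: v + z) <-> g (t *: v + z) < 0) /\
     (Omega (t *: v + z) <-> h (t *: v + z) < 0)) /\
    ((t != 0 -> t^-1 *: (g (t *: v + z) - g z) < 0) /\
     (t != 0 -> 0 < t^-1 *: (h (t *: v + z) - h z))).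
  apply: filterI nO _.
  have ng' : \forall t \near (0 : R), t != 0 -> t^-1 *: (g (t *: v + z) - g z) < 0 by exact: ng.
  have nh' : \forall t \near (0 : R), t != 0 -> 0 < t^-1 *: (h (t *: v + z) - h z) by exact: nh.
  exact: filterI ng' nh'.
move/nbhs_ballP : N => [e /= e0 eP].
have t0 : 0 < e / 2 by rewrite divr_gt0.
have be : ball (0 : R) e (e / 2).
  rewrite -ball_normE /= sub0r normrN gtr0_norm//.
  by rewrite ltr_pdivrMr// mulr_natr mulr2n ltrDl.
have [[Og' Oh'] [/(_ (lt0r_neq0 t0)) + /(_ (lt0r_neq0 t0))]] := eP _ be.
rewrite g0 h0 !subr0 -![_ *: _]/(_ * _) pmulr_rlt0 ?invr_gt0// pmulr_rgt0 ?invr_gt0//.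
by move=> /Og'/Oh' /lt_trans h1 /h1; rewrite ltxx.
Qed.

(** By [spsc_at_dir], the open half space where [dg < 0] lies in the half space
    where [dh <= 0]; linear functions in this position are positively
    proportional. *)
Lemma spsc_at_parallel g h z : smooth g -> smooth h -> spsc_at g z -> spsc_at h z ->
  g z = 0 -> h z = 0 -> exists2 c, 0 <= c & forall v, dirD v h z = c * dirD v g z.
Proof.
move=> sg sh Sg Sh g0 h0; have [_ [k gk] _] := Sg.
have lin_g := dirD_linear g z; have lin_h := dirD_linear h z.
have lg a v w : dirD (a *: v + w) g z = a * dirD v g z + dirD w g z by exact: lin_g.
have lh a v w : dirD (a *: v + w) h z = a * dirD v h z + dirD w h z by exact: lin_h.
pose e := (- (partial k g z)^-1) *: delta_mx 0 k : V.
have eg : dirD e g z = -1 by rewrite dirDZ dirD_delta mulNr mulVf.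
have eh : dirD e h z <= 0 by apply: (spsc_at_dir sg sh) => //; rewrite eg oppr_lt0 ltr01.
have ker v : dirD v g z = 0 -> dirD v h z <= 0.
  move=> vg; apply/ler_addgt0Pr => x x0.
  pose s := x / (`|dirD e h z| + 1).
  have d0 : 0 < `|dirD e h z| + 1 by rewrite ltr_wpDl.
  have s0 : 0 < s by rewrite divr_gt0.
  have := spsc_at_dir (v := s *: e + v) sg sh Sg Sh g0 h0.
  rewrite lg lh vg eg addr0 mulrN1 oppr_lt0 => /(_ s0) H.
  have : s * `|dirD e h z| <= x.
    by rewrite mulrAC ler_pdivrMr// ler_wpM2l ?(ltW x0)// lerDl.
  have := ler_norm (- dirD e h z); rewrite normrN => /(ler_wpM2l (ltW s0)).
  rewrite mulrN; lra.
exists (- dirD e h z) => [|v]; first by rewrite oppr_ge0.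
have kv : dirD (dirD v g z *: e + v) g z = 0 by rewrite lg eg mulrN1 addNr.
have kv' : dirD (- 1 *: (dirD v g z *: e + v)) g z = 0 by rewrite dirDZ kv mulr0.
have := ker _ kv; have := ker _ kv'; rewrite dirDZ lh => h1 h2.
lra.
Qed.

Lemma tangent_parallel g h c W z : (forall v, dirD v h z = c * dirD v g z) ->
  tangent g z W -> tangent h z W.
Proof. by move=> hg [t1 t2]; split; rewrite hg (t1, t2) mulr0. Qed.

Lemma levi_quad_add g h z W : smooth g -> smooth h ->
  levi_quad (hess (fun z => g z + h z) z) W =
  levi_quad (hess g z) W + levi_quad (hess h z) W.
Proof.
move=> sg sh; rewrite -levi_quadD; apply: levi_quad_ext => k l; exact: hessD.
Qed.

(** Proportional gradients have the same complex tangent space, on which the Levi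
    forms add up. *)
Lemma spsc_at_add g h z : open Omega -> admissible g -> admissible h ->
  boundary Omega z -> spsc_at g z -> spsc_at (fun z => g z + h z) z.
Proof.
move=> oO Ag Ah bz Sg; have [sg gle gge _] := Ag; have [sh hle hge hb] := Ah.
have [Og [k gk] Lg] := Sg.
have par : exists2 c, 0 <= c & (forall v, dirD v h z = c * dirD v g z) /\
    (forall W, W != 0 -> tangent g z W -> 0 <= levi_quad (hess h z) W).
  have [Sh|[h1 h2]] := hb z bz.
    have [g0 h0] := (admissible_boundary0 oO Ag bz, admissible_boundary0 oO Ah bz).
    have [c c0 hg] := spsc_at_parallel sg sh Sg Sh g0 h0.
    have [_ _ LS] := Sh; exists c; [exact: c0|split; [exact: hg|]].
    by move=> W W0 tW; apply/ltW; exact: LS W0 (tangent_parallel hg tW).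
  exists 0; [exact: lexx|split=> [v|W _ _]].
    by rewrite mul0r /dirD big1// => l _; rewrite h1 mulr0.
  by rewrite /levi_quad /quad !big1 ?addr0// => l _; rewrite big1// => j _; rewrite h2 mul0r.
have [c c0 [hg hL]] := par; have c1 : 0 < 1 + c by rewrite ltr_wpDr.
have sum_dir v : dirD v (fun z => g z + h z) z = (1 + c) * dirD v g z.
  by rewrite dirD_add_fun// hg mulrDl mul1r.
split.
- apply: filterS Og => w Ow; split=> [Oz|].
    by have := hle w Oz; move/Ow : Oz; lra.
  move=> gh; apply: contrapT => nO; have := gge w nO; have := hge w nO; lra.
- exists k; rewrite -dirD_delta sum_dir mulf_neq0 ?dirD_delta//.
  by rewrite gt_eqF.
- move=> W W0 [t1 t2]; have tg : tangent g z W.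
    move/eqP: t1; move/eqP : t2; rewrite !sum_dir !mulf_eq0 gt_eqF//=.
    by move=> /eqP ? /eqP ?; split.
  rewrite levi_quad_add// ltr_wpDr//; first exact: hL.
  exact: Lg.
Qed.

Lemma null_jet_add g h z : smooth g -> smooth h -> null_jet g z -> null_jet h z ->
  null_jet (fun z => g z + h z) z.
Proof.
move=> sg sh [g1 g2] [h1 h2]; split=> [k|k l].
  by rewrite (partialD k z sg sh) g1 h1 addr0.
by rewrite (hessD z k l sg sh) g2 h2 addr0.
Qed.

Lemma spsc_at_ext g h z : g =1 h -> spsc_at g z -> spsc_at h z.
Proof. by move=> /funext ->. Qed.

Lemma admissible_add g h : open Omega -> admissible g -> admissible h ->
  admissible (fun z => g z + h z).
Proof.
move=> oO Ag Ah; have [sg gle gge gb] := Ag; have [sh hle hge hb] := Ah; split.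
- exact: smoothD.
- by move=> z Oz; rewrite -[leRHS]addr0 lerD ?gle ?hle.
- by move=> z Oz; rewrite addr_ge0 ?gge ?hge.
move=> z bz; have [Sg|Ng] := gb z bz; first by left; exact: spsc_at_add.
have [Sh|Nh] := hb z bz; last by right; exact: null_jet_add.
by left; apply: (@spsc_at_ext (fun z => h z + g z)) (spsc_at_add _ _ _ _ _) => // w; rewrite addrC.
Qed.

Lemma defining_at_addl g h z : open Omega -> admissible g -> admissible h ->
  defining_at g z -> defining_at (fun z => g z + h z) z.
Proof.
move=> oO Ag Ah [g1 g2]; split=> [Oz|bz]; last exact: spsc_at_add (g2 bz).
have [_ hle _ _] := Ah; have := hle z Oz; have := g1 Oz; lra.
Qed.

Lemma defining_at_ext g h z : g =1 h -> defining_at g z -> defining_at h z.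
Proof. by move=> /funext ->. Qed.

Lemma admissible_sum (I : eqType) (s : seq I) (G : I -> V -> R) : open Omega ->
  (forall i, i \in s -> admissible (G i)) ->
  admissible (fun z => \sum_(i <- s) G i z) /\
  forall i z, i \in s -> defining_at (G i) z -> defining_at (fun z => \sum_(i <- s) G i z) z.
Proof.
move=> oO; elim: s => [|i s ih] AG.
  split=> //; split=> [|z _|z _|z _].
  - by under eq_fun do rewrite big_nil; exact: smooth_cst.
  - by rewrite big_nil.
  - by rewrite big_nil.
  right; split=> [k|k l].
    by under eq_fun do rewrite big_nil; exact: partial_cst.
  under eq_fun do rewrite big_nil; rewrite /hess.
  have -> : partial l (fun _ : V => 0 : R) = fun=> 0.
    by apply/funext => w; exact: partial_cst.
  exact: partial_cst.
have Ai : admissible (G i) by apply: AG; rewrite mem_head.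
have [As gs] := ih (fun j js => AG j (mem_behead (s := i :: s) js)).
have E : (fun z => \sum_(j <- i :: s) G j z) =
    fun z => G i z + \sum_(j <- s) G j z by apply/funext => z; rewrite big_cons.
rewrite E; split; first exact: admissible_add.
move=> j z; rewrite inE => /predU1P[->|js] gj; first exact: defining_at_addl.
apply: (@defining_at_ext (fun z => \sum_(j <- s) G j z + G i z)).
  by move=> w; rewrite addrC.
by apply: defining_at_addl => //; exact: gs js gj.
Qed.

End Admissible.

Section BoundedSets.
Variables (R : realType) (m : nat).
Local Notation V := 'rV[R]_m.

Lemma closed_norm_le (M : R) : closed [set z : V | `|z| <= M].
Proof.
apply: (closed_comp (f := fun z : V => `|z|) (D := [set y | y <= M])); last exact: closed_le.
by move=> w _; exact: norm_continuous.
Qed.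

Lemma closure_bounded (A : set V) : bounded_set A -> bounded_set (closure A).
Proof.
move=> [M [Mr bM]]; exists M; split=> // x Mx z cz.
have /closure_id E := @closed_norm_le x.
suff : closure [set z : V | `|z| <= x] z by rewrite -E.
by apply: closure_subset cz => w Aw; exact: bM.
Qed.

Lemma closure_compact (A : set V) : bounded_set A -> compact (closure A).
Proof.
by move=> bA; apply: bounded_closed_compact; [exact: closure_bounded|exact: closed_closure].
Qed.

Lemma boundary_compact (A : set V) : bounded_set A -> compact (boundary A).
Proof.
move=> bA; apply: (subclosed_compact _ (closure_compact bA)); last by move=> z [].
by rewrite /boundary setDE; apply: closedI; [exact: closed_closure|exact/open_closedC/open_interior].
Qed.

End BoundedSets.

Section GlobalDefiningFunction.
Variables (R : realType) (n : nat) (Omega : set 'rV[R]_(n + n)).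
Local Notation V := 'rV[R]_(n + n).
Implicit Types (g h u chi : V -> R) (z p v W : V).

Lemma near_zero_null_jet g z : (\forall w \near z, g w = 0) -> null_jet g z.
Proof.
move=> g0; split=> [k|k l].
  by rewrite (near_eq_partial k (g := fun=> 0) g0); exact: partial_cst.
rewrite /hess (near_eq_partial2 k l (g := fun=> 0) g0).
have -> : partial l (fun _ : V => 0 : R) = fun=> 0.
  by apply/funext => w; exact: partial_cst.
exact: partial_cst.
Qed.

Lemma levi_pos_tangent K u z : levi_pos K u z -> levi_tangent_pos u z.
Proof.
move=> Kp W W0 [t1 t2]; have := Kp W W0.
by rewrite /grad_sq t1 t2 !expr0n /= addr0 mulr0 addr0.
Qed.

(** The Levi condition is passed through [levi_pos] because the complex tangent
    space moves with the point. *)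
Lemma near_spsc_at u p : smooth u -> spsc_at Omega u p ->
  \forall z \near p, spsc_at Omega u z.
Proof.
move=> su [Ou [k uk] Lu].
have nO : \forall z \near p, \forall w \near z, Omega w <-> u w < 0 by exact: near_join.
have nk : \forall z \near p, partial k u z != 0.
  have c : partial k u @ p --> partial k u p by exact: (@smooth_continuous _ _ _ (smooth_partial k su) p).
  have [neg|] := ltP (partial k u p) 0.
    by apply: filterS (cvgr_lt _ c _ neg) => z; move/lt_eqF => ->.
  rewrite le_eqVlt eq_sym (negbTE uk) /= => pos.
  by apply: filterS (cvgr_gt _ c _ pos) => z; move/gt_eqF => ->.
have [[A B] /= [nA nB] AB] := levi_pos_near su Lu.
have [K BK] := filter_ex nB.
near=> z; split; [by near: z|by exists k; near: z|].
apply: (@levi_pos_tangent K); apply: (AB (z, K)); split=> //=.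
by near: z.
Unshelve. all: by end_near. Qed.

(** On the zero set, multiplication of [u] by [chi] multiplies the gradient by
    [chi], and also the Hessian up to products with the gradient of [u], which
    vanish on tangent vectors. *)
Lemma spsc_at_localize u chi p z : smooth u -> smooth chi -> u z = 0 -> 0 < chi z ->
  spsc_at Omega u z -> spsc_at Omega (fun w => chi w * u w) z.
Proof.
move=> su sc uz cz [Ou [k uk] Lu].
have dir v : dirD v (fun w => chi w * u w) z = chi z * dirD v u z.
  rewrite /dirD mulr_sumr; apply: eq_bigr => l _.
  by rewrite (partialM l z sc su) uz mul0r addr0 mulrCA.
split.
- have cc : chi @ z --> chi z by exact: smooth_continuous.
  have npos : \forall w \near z, 0 < chi w by exact: (cvgr_gt _ cc _ cz).
  near=> w; have Ow : Omega w <-> u w < 0 by near: w.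
  have cw : 0 < chi w by near: w.
  by rewrite pmulr_rlt0.
- exists k; rewrite -dirD_delta dir; apply: mulf_neq0; first by rewrite gt_eqF.
  by rewrite dirD_delta.
- move=> W W0 [t1 t2]; have [d1 d2] : tangent u z W.
    move/eqP: t1; move/eqP: t2; rewrite !dir !mulf_eq0 gt_eqF//=.
    by move=> /eqP ? /eqP ?; split.
  have hE i j : hess (fun w => chi w * u w) z i j = chi z * hess u z i j +
      (partial i chi z * partial j u z + partial i u z * partial j chi z).
    by rewrite (hessM z i j sc su) uz mul0r addr0 addrA.
  have -> : levi_quad (hess (fun w => chi w * u w) z) W = chi z * levi_quad (hess u z) W.
    refine (etrans (levi_quad_ext W hE) _).
    rewrite levi_quadD levi_quadZ levi_quadD !levi_quad_rank1 !lin_dirD d1 d2.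
    by rewrite !(mulr0, mul0r, addr0).
  by rewrite mulr_gt0//; exact: Lu.
Unshelve. all: by end_near. Qed.

(** The square of [chi] makes the product vanish to third order where [chi] and [u]
    both vanish, in particular on the edge of the support of [chi]. *)
Lemma null_jet_localize u chi z : smooth u -> smooth chi -> u z = 0 -> chi z = 0 ->
  null_jet (fun w => chi w ^+ 2 * u w) z.
Proof.
move=> su sc uz cz; have sc2 := smoothX 2 sc.
have c2 k : partial k (fun w => chi w ^+ 2) z = 0.
  by rewrite (partialX 2 k z sc) cz expr1 mulr0 mul0r.
split=> [k|k l].
  by rewrite (partialM k z sc2 su) uz cz expr0n /= !mul0r addr0.
have alg (f a b g x y s t : R) : f = 0 -> a = 0 -> b = 0 -> g = 0 ->
    f * s + a * x + y * b + g * t = 0.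
  by move=> -> -> -> ->; rewrite !(mul0r, mulr0, addr0).
refine (etrans (hessM z k l sc2 su) (alg _ _ _ _ _ _ _ _ _ (c2 k) (c2 l) uz)).
by rewrite cz expr0n.
Qed.

(** At an interior point minus a bump function serves; at a boundary point, the
    local defining function times the square of a bump function supported where
    strict pseudoconvexity persists. *)
Lemma local_admissible p : open Omega -> strictly_pseudoconvex Omega ->
  closure Omega p ->
  exists2 g, admissible Omega g & \forall z \near p, defining_at Omega g z.
Proof.
move=> oO spc clp; have [Op|nOp] := pselect (Omega p).
  have [chi [sc c0 c1 cO]] := smooth_bump oO Op.
  exists (fun z => - chi z).
    split=> [|z _|z nO|z bz].
    - exact: smoothN.
    - by rewrite oppr_le0.
    - by rewrite (nbhs_singleton (cO z nO)) oppr0.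
    - right; apply: near_zero_null_jet.
      apply: filterS (cO z (boundary_notin oO bz)) => w ->.
      by rewrite oppr0.
  have nO : \forall z \near p, Omega z by exact: open_nbhs_nbhs.
  near=> z; split=> [_|bz].
    by rewrite (_ : chi z = 1) ?oppr_lt0//; near: z.
  by case: (boundary_notin oO bz); near: z.
have bp : boundary Omega p by split=> // /interior_subset.
have [U [r [Up [oU sr rO rg] Lr]]] := spc p bp.
have [u su ur] := smooth_extension oU Up sr.
have Su : spsc_at Omega u p.
  split.
  - have nU : \forall z \near p, U z by exact: open_nbhs_nbhs.
    have nur : \forall z \near p, u z = r z by [].
    apply: filterS (filterI nU nur) => z [Uz ->]; split=> [Oz|rz].
      by have : (Omega `&` U) z by []; rewrite rO => -[].
    by have : [set z | U z /\ r z < 0] z by []; rewrite -rO => -[].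
  - apply: contrapT => nuk; have := rg p Up.
    suff -> : grad r p = 0 by rewrite eqxx.
    apply/rowP => k; rewrite mxE [RHS]mxE; apply/eqP; apply: contrapT => /negP rk.
    by apply: nuk; exists k; rewrite (near_eq_partial k ur).
  - apply: levi_tangent_posP => // w w0 tw.
    rewrite /levi_form (near_eq_complex_hessian ur); apply: Lr => //.
    move: tw; rewrite /complex_tangent.
    by under eq_bigr do rewrite (near_eq_dz _ (near_eq_complexify ur)).
pose N := [set z | spsc_at Omega u z]°.
have Np : N p by exact: near_spsc_at.
have [chi [sc c0 c1 cN]] := smooth_bump (open_interior _) Np.
have NS z : chi z != 0 -> spsc_at Omega u z.
  move=> cz; have : N z.
    by apply: contrapT => nN; move: cz; rewrite (nbhs_singleton (cN z nN)) eqxx.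
  exact: interior_subset.
have u0 z : boundary Omega z -> spsc_at Omega u z -> u z = 0.
  move=> bz [Ou _ _]; apply/eqP; rewrite eq_le; apply/andP; split; last first.
    rewrite leNgt; apply/negP => /(nbhs_singleton Ou).2.
    exact: boundary_notin.
  rewrite leNgt; apply/negP => uz.
  have cu : u @ z --> u z by exact: smooth_continuous.
  have npos : \forall w \near z, 0 < u w by exact: (cvgr_gt _ cu _ uz).
  have [cz _] := bz.
  have [w [Ow]] := cz _ (filterI Ou npos).
  by move=> [/= Ow' uw]; have := Ow'.1 Ow; rewrite ltNge ltW.
have sc2 := smoothX 2 sc.
have Ag : admissible Omega (fun z => chi z ^+ 2 * u z).
  split=> [|z Oz|z nO|z bz].
  - exact: smoothM.
  - have [->|cz] := eqVneq (chi z) 0; first by rewrite expr0n mul0r.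
    have [Ou _ _] := NS z cz.
    rewrite mulr_ge0_le0 ?sqr_ge0// ltW//; exact: (nbhs_singleton Ou).1.
  - have [->|cz] := eqVneq (chi z) 0; first by rewrite expr0n mul0r.
    have [Ou _ _] := NS z cz.
    rewrite mulr_ge0 ?sqr_ge0// leNgt; apply/negP => uz; apply: nO.
    exact: (nbhs_singleton Ou).2.
  - have [cz|cz] := eqVneq (chi z) 0.
      right.
      have [Nz|nN] := pselect (N z).
        by apply: null_jet_localize => //; apply: u0 => //; exact: interior_subset Nz.
      by apply: near_zero_null_jet; apply: filterS (cN z nN) => w ->; rewrite expr0n mul0r.
    left; apply: spsc_at_localize => //.
    - by apply: u0 => //; exact: NS.
    - by rewrite exprn_gt0// lt_neqAle eq_sym cz c0.
    - exact: NS.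
exists (fun z => chi z ^+ 2 * u z) => //.
near=> z; have cz : chi z = 1 by near: z.
have Sz : spsc_at Omega u z by apply: NS; rewrite cz oner_eq0.
split=> [Oz|bz].
  by rewrite cz expr1n mul1r; have [Ou _ _] := Sz; exact: (nbhs_singleton Ou).1.
apply: spsc_at_localize => //; first exact: u0.
by rewrite cz expr1n.
Unshelve. all: by end_near. Qed.

(** The sum of the local functions over a finite subcover of the closure. *)
Lemma global_defining_function : open Omega -> bounded_set Omega ->
  strictly_pseudoconvex Omega ->
  exists rho, [/\ smooth rho, forall z, Omega z -> rho z < 0,
    forall z, boundary Omega z -> rho z = 0 &
    forall z, boundary Omega z -> spsc_at Omega rho z].
Proof.
move=> oO bO spc.
have ex p : exists g, closure Omega p ->
    admissible Omega g /\ \forall z \near p, defining_at Omega g z.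
  have [cp|ncp] := pselect (closure Omega p); last by exists (fun=> 0).
  by have [g Ag gg] := local_admissible oO spc cp; exists g.
have [G GP] := choice ex.
have := closure_compact bO; rewrite compact_cover.
move=> /(_ _ (closure Omega) (fun p => [set z | defining_at Omega (G p) z]°)).
case=> [p _|p cp|D Dcl Dcov].
- exact: open_interior.
- by exists p => //; exact: (GP p cp).2.
have AD p : p \in finmap.enum_fset D -> admissible Omega (G p).
  by move=> pD; have /set_mem cp := Dcl p pD; exact: (GP p cp).1.
have [A gs] := admissible_sum oO AD.
have defining_closure z : closure Omega z -> defining_at Omega (fun z => \sum_(p <- finmap.enum_fset D) G p z) z.
  move=> cz; have [p /= pD pz] := Dcov z cz.
  by apply: gs pD _; exact: (interior_subset pz).
exists (fun z => \sum_(p <- finmap.enum_fset D) G p z); split.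
- by case: A.
- by move=> z Oz; have [+ _] := defining_closure z (subset_closure Oz); exact.
- by move=> z bz; exact: admissible_boundary0 A bz.
- by move=> z bz; have [_] := defining_closure z bz.1; exact.
Qed.

End GlobalDefiningFunction.

(** * Distance to the boundary *)

Section Distance.
Variables (R : realType) (m : nat) (Omega : set 'rV[R]_m).
Local Notation V := 'rV[R]_m.
Implicit Types (u : V -> R) (z w v : V).

Lemma coord_le_enorm v k : `|v 0 k| <= enorm v.
Proof.
rewrite /enorm -sqrtr_sqr ler_sqrt ?sumr_ge0// => [|l _]; last exact: sqr_ge0.
by rewrite (bigD1 k)//= lerDl sumr_ge0// => l _; exact: sqr_ge0.
Qed.

(** The mean value theorem on a ball that contains [B]; the ball is convex, [B] need
    not be. *)
Lemma smooth_lipschitz (B : set V) u : smooth u -> bounded_set B ->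
  exists2 L, 0 < L & forall z w, B z -> B w -> `|u z - u w| <= L * enorm (z - w).
Proof.
move=> su [M [Mr bM]].
pose A : set V := [set x | `|x| <= M + 1].
have cA : compact A.
  apply: bounded_closed_compact.
    by exists (M + 1); split; [exact: num_real|move=> x Mx y /= /le_trans; apply; exact: ltW].
  exact: closed_norm_le.
have /choice[c bc] : forall k, exists c, forall x, A x -> `|partial k u x| <= c.
  move=> k.
  have [A0|A0] := pselect (A !=set0); last first.
    by exists 0 => x Ax; case: A0; exists x.
  have ck : continuous (fun x => `|partial k u x|).
    move=> x; apply: continuous_comp; last exact: norm_continuous.
    exact: (@smooth_continuous _ _ _ (smooth_partial k su)).
  have [y _ ymax] := compact_EVT_max A0 cA (continuous_subspaceT ck).
  by exists `|partial k u y| => x Ax; apply: ymax; rewrite inE.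
exists (\sum_k `|c k| + 1) => [|z w Oz Ow]; first by rewrite ltr_wpDl// sumr_ge0.
have M1 : M < M + 1 by rewrite ltrDl.
have [s /andP[s0 s1] E] := dirD_mean w (z - w) su.
rewrite subrK in E; rewrite E.
have As : A (s *: (z - w) + w).
  have -> : s *: (z - w) + w = s *: z + (1 - s) *: w.
    by rewrite scalerBr scalerBl scale1r addrA addrAC.
  rewrite /A /=; apply: le_trans (ler_normD _ _) _.
  rewrite !normrZ ger0_norm ?(ltW s0)// ger0_norm ?subr_ge0 ?(ltW s1)//.
  have hz : `|z| <= M + 1 by apply: bM M1 _ Oz.
  have hw : `|w| <= M + 1 by apply: bM M1 _ Ow.
  have := ler_wpM2l (ltW s0) hz; have := ler_wpM2l (_ : 0 <= 1 - s) hw.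
  rewrite subr_ge0 => /(_ (ltW s1)); lra.
rewrite mulrDl mul1r mulr_suml; apply: le_trans (ler_norm_sum _ _ _) _.
rewrite -[leLHS]addr0 lerD ?sqrtr_ge0//; apply: ler_sum => k _.
rewrite normrM mulrC ler_pM// ?coord_le_enorm//.
by apply: le_trans (bc k _ As) _; exact: ler_norm.
Qed.

(** Otherwise the domain would be compact, and a coordinate would attain its
    maximum in an open set. *)
Lemma boundary_nonempty (k : 'I_m) : open Omega -> bounded_set Omega -> Omega !=set0 ->
  boundary Omega !=set0.
Proof.
move=> oO bO O0; apply: contrapT => nb.
have clO : closure Omega `<=` Omega.
  move=> z cz; apply: contrapT => nz; apply: nb; exists z; split=> //.
  by move=> /interior_subset.
have cO : compact Omega.
  exact: bounded_closed_compact.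
have ck : continuous (fun z : V => z 0 k) by exact: coord_continuous.
have [c /set_mem Oc cmax] := compact_EVT_max O0 cO (continuous_subspaceT ck).
have [e e0 eO] := nbhs_box (open_nbhs_nbhs (conj oO Oc)).
have e2 : 0 < e / 2 by rewrite divr_gt0.
have : Omega (c + (e / 2) *: delta_mx 0 k).
  apply: eO => l; rewrite !mxE eqxx /= addrAC subrr add0r normrM gtr0_norm//.
  have ee : e / 2 < e by rewrite ltr_pdivrMr// mulr_natr mulr2n ltrDl.
  by case: (l == k); rewrite ?normr1 ?mulr1 ?normr0 ?mulr0.
move=> /mem_set/cmax; rewrite !mxE !eqxx mulr1 gerDl.
by rewrite leNgt e2.
Qed.

Lemma dist_ge (A : set V) z (c : R) : A !=set0 -> (forall w, A w -> c <= enorm (z - w)) ->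
  c <= euclidean_dist z A.
Proof.
move=> [w Aw] cA; apply: lb_le_inf; first by exists (enorm (z - w)), w.
by move=> _ [y Ay <-]; exact: cA.
Qed.

(** The Lipschitz estimate against every boundary point, then the infimum. *)
Lemma vanishing_le_dist u : smooth u -> bounded_set Omega -> boundary Omega !=set0 ->
  (forall z, boundary Omega z -> u z = 0) ->
  exists2 L, 0 < L & forall z, Omega z ->
    `|u z| <= L * euclidean_dist z (boundary Omega).
Proof.
move=> su bO bne ub.
have [L L0 hL] := smooth_lipschitz su (closure_bounded bO).
exists L => // z Oz; rewrite mulrC -ler_pdivrMr//; apply: dist_ge => // w bw.
rewrite ler_pdivrMr// mulrC -[u z]subr0 -(ub w bw).
by apply: hL; [exact: subset_closure|case: bw].
Qed.

End Distance.

(** * Levi form and positive matrices *)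

Section Bridge.
Variables (R : realType) (n : nat).
Local Notation C := R[i].
Local Notation V := 'rV[R]_(n + n).
Implicit Types (u : V -> R) (z W : V) (w : 'rV[C]_n).
Local Open Scope sesquilinear_scope.

Lemma herm_form_real (A : 'M[C]_n) w : A ^t* = A -> herm_form A w \is Num.real.
Proof.
move=> hA; apply/CrealP; rewrite /herm_form.
have E : (w *m A *m w ^t* ) ^t* = w *m A *m w ^t*.
  by rewrite !trmxC_mul trmxCK hA mulmxA.
by rewrite -[in RHS]E !mxE.
Qed.

Lemma herm_formE (A : 'M[C]_n) w :
  herm_form A w = \sum_i \sum_j A i j * w 0 i * (w 0 j)^*%C.
Proof.
rewrite /herm_form mxE exchange_big; apply: eq_bigr => j _.
rewrite !mxE mulr_suml; apply: eq_bigr => i _.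
by rewrite [w 0 i * _]mulrC.
Qed.

Lemma Re_herm_form S w :
  complex.Re (herm_form (wirt_hess S) w) = 4^-1 * levi_quad S (of_complex_row w).
Proof. by rewrite herm_formE Re_wirt_hess. Qed.

Lemma of_complex_row_neq0 w : w != 0 -> of_complex_row w != 0.
Proof.
apply: contraNneq => w0; apply/eqP/rowP => j; rewrite mxE.
have := congr1 (fun M : V => M 0 (lshift n j)) w0.
have := congr1 (fun M : V => M 0 (rshift n j)) w0.
rewrite /of_complex_row row_mxEl row_mxEr !mxE.
by case: (w 0 j) => a b /= -> ->.
Qed.

(** The matrix of the form in [levi_pos]. *)
Definition augmented u z (K : R) : 'M[C]_n :=
  levi_mx u z + K%:C *: (dz_vec u z *m (dz_vec u z) ^t* ).

Lemma augmentedE u z K : augmented u z K =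
  wirt_hess (fun k l => hess u z k l + K * (partial k u z * partial l u z)).
Proof. by rewrite wirt_hessD wirt_hessZ /augmented dz_vec_rank1. Qed.

Lemma posdef_augmented u z K : smooth u -> levi_pos K u z -> posdef (augmented u z K).
Proof.
move=> su Lp w w0.
have hA : (augmented u z K) ^t* = augmented u z K.
  rewrite augmentedE; apply: wirt_hess_herm => k l.
  by rewrite (hessC z k l su) [partial l u z * _]mulrC.
have := herm_form_real w hA; move/RRe_real => <-; rewrite ltcR augmentedE Re_herm_form.
rewrite mulr_gt0 ?invr_gt0//.
have := Lp _ (of_complex_row_neq0 w0).
by rewrite levi_quadD levi_quadZ levi_quad_rank1 !lin_dirD /grad_sq !expr2.
Qed.

(** By [levi_pos] the complex Hessian is positive definite up to a rank one term,
    and [herm_form_ge0] applies. *)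
Lemma levi_quad_ge0 u z K W : smooth u -> levi_pos K u z ->
  0 <= \det (levi_mx u z) -> 0 <= levi_quad (hess u z) W.
Proof.
move=> su Lp d0; have hA := levi_mx_herm z su.
have Kr : K%:C \is @Num.real C by apply/complex_realP; exists K.
have := @herm_form_ge0 _ _ _ (dz_vec u z) K%:C (to_complex_row W) hA Kr
  (posdef_augmented su Lp) d0.
rewrite lecE => /andP[_]; rewrite Re_herm_form to_complex_rowK.
by rewrite pmulr_rge0 ?invr_gt0.
Qed.

Lemma slope_gt0 u z K k : smooth u -> levi_pos K u z -> partial k u z != 0 ->
  0 < slope u z.
Proof.
move=> su Lp uk; have hA := levi_mx_herm z su.
have Kr : K%:C \is @Num.real C by apply/complex_realP; exists K.
apply: (det_slope_gt0 hA Kr (posdef_augmented su Lp)).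
apply: contraNneq uk => d0.
have [j ->|j ->] := split_ordP k.
  have := congr1 (fun M : 'cV[C]_n => complex.Re (M j 0)) d0; rewrite !mxE /= => /eqP.
  by rewrite mulf_eq0 invr_eq0 pnatr_eq0.
have := congr1 (fun M : 'cV[C]_n => complex.Im (M j 0)) d0; rewrite !mxE /= => /eqP.
by rewrite oppr_eq0 mulf_eq0 invr_eq0 pnatr_eq0.
Qed.

Lemma slope_real u z : smooth u -> slope u z = (complex.Re (slope u z))%:C.
Proof.
move=> su; rewrite RRe_real//; apply: rpredB; apply: herm_det_real.
  have := wirt_hess_herm (S := fun k l => hess u z k l + 1 * (partial k u z * partial l u z)).
  rewrite -augmentedE /augmented scale1r; apply => k l.
  by rewrite (hessC z k l su) [partial l u z * _]mulrC.
exact: levi_mx_herm.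
Qed.

Lemma smooth_slope u : smooth u -> smooth (fun z => complex.Re (slope u z)).
Proof.
move=> su; suff [] : csmooth (slope u) by [].
have s1 : csmooth (fun z => \det (levi_mx u z)).
  by apply: csmooth_det => i j; exact: csmooth_levi_mx.
have s2 : csmooth (fun z => \det (levi_mx u z + dz_vec u z *m (dz_vec u z) ^t* )).
  apply: csmooth_det => i j.
  have := csmoothD (csmooth_levi_mx i j su) (csmooth_dz_vec_rank1 i j su).
  by congr csmooth; apply/funext => z; rewrite [RHS]mxE.
have := csmoothD s2 (csmoothM (csmooth_cst _ (-1)) s1).
by congr csmooth; apply/funext => z; rewrite mulN1r.
Qed.

End Bridge.

(** * The plurisubharmonic defining function *)

Section Assembly.
Variables (R : realType) (n : nat) (Omega : set 'rV[R]_(n + n)).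
Local Notation C := R[i].
Local Notation V := 'rV[R]_(n + n).
Implicit Types (u r g f : V -> R) (z p W : V).

(** The slope is positive near [A], where strict pseudoconvexity holds; a smooth
    step keeps the denominator positive elsewhere. *)
Lemma slope_inverse r (A : set V) : smooth r -> compact A ->
  (forall p, A p -> levi_tangent_pos r p) ->
  (forall p, A p -> exists k, partial k r p != 0) ->
  exists b (W : set V), [/\ smooth b, forall p, A p -> \forall z \near p, W z &
    forall z, W z -> slope r z * (b z)%:C = 1].
Proof.
move=> sr cA lp rk.
pose B z := complex.Re (slope r z).
have sB : smooth B := smooth_slope sr.
have BE z : slope r z = (B z)%:C := slope_real z sr.
have [K KA] := levi_pos_compact sr cA lp.
have Bpos p : A p -> 0 < B p.
  move=> Ap; have [k rk0] := rk p Ap.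
  have Lp : levi_pos K r p := nbhs_singleton (KA p Ap).
  by have := slope_gt0 sr Lp rk0; rewrite BE ltcR.
have [e e0 eA] : exists2 e, 0 < e & forall p, A p -> e < B p.
  have [A0|A0] := pselect (A !=set0); last first.
    by exists 1 => // p Ap; case: A0; exists p.
  have [c Ac cmin] := compact_EVT_min A0 cA (continuous_subspaceT (smooth_continuous sB)).
  have Bc := Bpos c (set_mem Ac).
  exists (B c / 2) => [|p Ap]; first by rewrite divr_gt0.
  apply: (@lt_le_trans _ _ (B c)); first by rewrite ltr_pdivrMr// mulr_natr mulr2n ltrDl.
  by apply: cmin; rewrite inE.
have e2 : e / 2 < e by rewrite ltr_pdivrMr// mulr_natr mulr2n ltrDl.
have e20 : 0 < e / 2 by rewrite divr_gt0.
pose s z := step (e / 2) e (B z).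
have ss : smooth s := smooth_comp (smooth1_step e2) sB.
(* Equal to the slope where that is large, and to 1 where it is small or
   negative. *)
pose den z := B z * s z + (1 - s z).
have sden : smooth den := smoothD (smoothM sB ss) (smoothB (smooth_cst 1) ss).
have den0 z : den z != 0.
  rewrite gt_eqF// /den.
  have s0 : 0 <= s z by exact: step_ge0.
  have s1 : s z <= 1 by exact: step_le1.
  have [Bz|Bz] := leP (B z) (e / 2); first by rewrite /s step0// mulr0 add0r subr0.
  have B0 : 0 < B z := lt_trans e20 Bz.
  have [->|sz] := eqVneq (s z) 1; first by rewrite mulr1 subrr addr0.
  by apply: ltr_wpDl; [apply: mulr_ge0 => //; exact: ltW|rewrite subr_gt0 lt_neqAle sz].
exists (fun z => (den z)^-1), [set z | e < B z]; split=> [|p Ap|z /= Bz].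
- exact: smoothV.
- exact: (cvgr_gt _ (@smooth_continuous _ _ _ sB p) _ (eA p Ap)).
have sz : s z = 1 by rewrite /s step1// ltW.
rewrite BE -rmorphM /=; congr (_%:C).
have E : den z = B z by rewrite /den sz mulr1 subrr addr0.
by rewrite -E mulfV.
Qed.

(** Compactness of the closure: at interior points [r] stays away from 0, so only
    boundary points matter for small [d]. *)
Lemma boundary_collar r (P : set V) : continuous r -> bounded_set Omega -> open Omega ->
  (forall z, Omega z -> r z < 0) ->
  (forall p, boundary Omega p -> \forall z \near p, P z) ->
  exists2 d, 0 < d & forall z, Omega z -> - d < r z -> P z.
Proof.
move=> cr bO oO rO nP.
have : \forall d \near (0 : R)^'+, closure Omega `<=` (fun z => Omega z -> - d < r z -> P z).
  move/compact_near_coveringP : (closure_compact bO).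
  move/(_ _ ((0 : R)^'+) (fun d z => Omega z -> - d < r z -> P z)).
  apply => x cx; have [Ox|nOx] := pselect (Omega x); last first.
    have bx : boundary Omega x by split=> //; move/interior_subset.
    exists (P, setT) => /=; first by split; [exact: nP|exact: filterT].
    by move=> -[z d] [/= Pz _].
  have r0 := rO x Ox.
  have r2 : r x < r x / 2 by rewrite ltr_pdivlMr// mulr_natr mulr2n gtrDl.
  have r20 : 0 < - (r x / 2) by rewrite oppr_gt0 pmulr_llt0 ?invr_gt0.
  exists ([set z | r z < r x / 2], [set d | d < - (r x / 2)]) => /=.
    split; first exact: (cvgr_lt _ (cr x) _ r2).
    exact: nbhs_right_lt.
  move=> -[z d] /= [rz dx] _ dz; exfalso; lra.
move=> h; have [d [d0 dP]] := filter_ex (filterI (nbhs_right_gt (0 : R)) h).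
by exists d => // z Oz; apply: dP => //; exact: subset_closure.
Qed.

Lemma partial_square_perturb r g p k : smooth r -> smooth g -> r p = 0 ->
  partial k (fun z => r z + g z * r z ^+ 2) p = partial k r p.
Proof.
move=> sr sg rp; refine (etrans (partial_perturb 0 k p sr sg sr) _).
by rewrite rp expr1 mul0r addr0.
Qed.

(** At a zero of [r] the Hessian changes by a multiple of the squared gradient,
    which vanishes on tangent vectors. *)
Lemma levi_tangent_pos_perturb r g p : smooth r -> smooth g -> r p = 0 ->
  levi_tangent_pos r p -> levi_tangent_pos (fun z => r z + g z * r z ^+ 2) p.
Proof.
move=> sr sg rp Lr W W0 [t1 t2].
have dE v : dirD v (fun z => r z + g z * r z ^+ 2) p = dirD v r p.
  by apply: eq_bigr => k _; rewrite partial_square_perturb.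
have {}t1 := etrans (esym (dE W)) t1; have {}t2 := etrans (esym (dE _)) t2.
have hE k l : hess (fun z => r z + g z * r z ^+ 2) p k l =
    hess r p k l + 2 * g p * (partial k r p * partial l r p).
  refine (etrans (hess_perturb 0 p k l sr sg sr) _).
  by rewrite rp expr1 mul0r addr0 expr0 mulr1.
rewrite (levi_quad_ext W hE) levi_quadD levi_quadZ levi_quad_rank1 !lin_dirD.
by rewrite t1 t2 !mulr0 addr0 mulr0 addr0; apply: Lr => //; split.
Qed.

Lemma continuous_small (u : V -> R) p (c : R) : continuous u -> u p = 0 -> 0 < c ->
  \forall z \near p, `|u z| < c.
Proof.
move=> cu up c0; have cn : {for p, continuous (fun z => `|u z|)}.
  by apply: continuous_comp; [exact: cu|exact: norm_continuous].
by apply: (cvgr_lt _ cn); rewrite up normr0.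
Qed.

(** The function is [rho + g rho^2] with [g] from [monge_ampere_approx].  Its
    determinant is [(- rho)^q (1 + o(1))] near the boundary, in particular
    nonnegative inside, and [levi_quad_ge0] turns this sign into semipositivity of
    the whole Levi form. *)
Lemma collar_solution rho q : open Omega -> bounded_set Omega -> smooth rho ->
  (forall z, Omega z -> rho z < 0) -> (forall z, boundary Omega z -> rho z = 0) ->
  (forall z, boundary Omega z -> spsc_at Omega rho z) ->
  exists F d, [/\ smooth F, 0 < d,
    forall z, boundary Omega z -> F z = 0 /\ forall k, partial k F z = partial k rho z &
    forall z, Omega z -> - d < rho z ->
      [/\ F z <= rho z / 2, forall W, 0 <= levi_quad (hess F z) W &
          \det (levi_mx F z) <= (2 * (- rho z) ^+ q)%:C]].
Proof.
move=> oO bO sr rO rb Sr; have cbd := boundary_compact bO.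
have [b [W [sb Wn bW]]] : exists b (W : set V), [/\ smooth b,
    forall p, boundary Omega p -> \forall z \near p, W z &
    forall z, W z -> slope rho z * (b z)%:C = 1].
  by apply: slope_inverse => // p /Sr[].
have [g [f [sg sf detF]]] := monge_ampere_approx q sr sb bW.
pose F z := rho z + g z * rho z ^+ 2.
have sF : smooth F := smoothD sr (smoothM sg (smoothX 2 sr)).
have [K KF] : exists K, forall p, boundary Omega p -> \forall z \near p, levi_pos K F z.
  apply: levi_pos_compact => // p bp; apply: levi_tangent_pos_perturb => //.
    exact: rb.
  by have [] := Sr p bp.
pose P := [set z | [/\ W z, levi_pos K F z, `|rho z * f z| < 1 & `|rho z * g z| < 2^-1]].
have [d d0 dP] : exists2 d, 0 < d & forall z, Omega z -> - d < rho z -> P z.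
  apply: boundary_collar => // [|p bp]; first exact: smooth_continuous.
  have n1 : \forall z \near p, `|rho z * f z| < 1.
    apply: continuous_small => //; first exact: smooth_continuous (smoothM sr sf).
    by rewrite (rb p bp) mul0r.
  have n2 : \forall z \near p, `|rho z * g z| < 2^-1.
    apply: continuous_small; first exact: smooth_continuous (smoothM sr sg).
      by rewrite (rb p bp) mul0r.
    by rewrite invr_gt0.
  near=> z; split; near: z => //; [exact: Wn|exact: KF].
exists F, d; split=> // [z bz|z Oz /(dP z Oz)[Wz Kz fz gz]].
  split; first by rewrite /F (rb z bz) expr0n mulr0 addr0.
  by move=> k; apply: partial_square_perturb => //; exact: rb.
have r0 := rO z Oz.
have rq : 0 <= (- rho z) ^+ q by rewrite exprn_ge0// oppr_ge0 ltW.
have dE : \det (levi_mx F z) = ((- rho z) ^+ q * (1 + (- 1) ^+ q * (rho z * f z)))%:C.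
  rewrite detF//; congr (_%:C).
  rewrite [rho z ^+ q.+1]exprSr mulrDr mulr1; congr (_ + _).
  have -> : rho z ^+ q = (- rho z) ^+ q * (-1) ^+ q by rewrite -exprMn mulrN1 opprK.
  by rewrite -!mulrA.
have ab : `|(- 1) ^+ q * (rho z * f z)| < 1.
  by rewrite normrM normrX normrN1 expr1n mul1r.
move: ab dE; set w := (-1) ^+ q * _; rewrite ltr_norml => /andP[w1 w2] dE.
split.
- move: gz; rewrite ltr_norml => /andP[g1 _].
  have : 0 <= - rho z * (rho z * g z + 2^-1) by rewrite mulr_ge0 ?oppr_ge0 ?ltW//; lra.
  rewrite /F; set x := rho z; set y := g z; lra.
- move=> U; apply: (levi_quad_ge0 U sF Kz); rewrite dE (lecR 0) mulr_ge0//; lra.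
- rewrite dE lecR mulrC ler_wpM2r//; lra.
Unshelve. all: by end_near. Qed.

End Assembly.

Section Gluing.
Variables (R : realType) (n : nat) (Omega : set 'rV[R]_(n + n)).
Local Notation C := R[i].
Local Notation V := 'rV[R]_(n + n).
Implicit Types (u r g f : V -> R) (z p W : V).

(** With a step [s] in [rho], the function is [s (F + d/4) - d/4].  Where it is
    greater than [- d/4], the step is already 1, because [F <= rho/2] there. *)
Lemma collar_extension rho F d : 0 < d -> smooth rho -> smooth F ->
  (forall z, Omega z -> rho z < 0) -> (forall z, boundary Omega z -> rho z = 0) ->
  (forall z, Omega z -> - d < rho z -> F z <= rho z / 2) ->
  exists G, [/\ smooth G, forall z, Omega z -> G z < 0,
    forall z, boundary Omega z -> \forall w \near z, G w = F w &
    forall z, Omega z -> - (d / 4) < G z ->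
      - d < rho z /\ \forall w \near z, G w = F w].
Proof.
move=> d0 sr sF rO rb Fle.
have cr := smooth_continuous sr.
have dd : - d < - (d / 2) by lra.
pose s z := step (- d) (- (d / 2)) (rho z).
have ss : smooth s := smooth_comp (smooth1_step dd) sr.
pose G z := s z * (F z + d / 4) - d / 4.
have sG : smooth G :=
  smoothB (smoothM ss (smoothD sF (smooth_cst (d / 4)))) (smooth_cst (d / 4)).
have GF z : - (d / 2) < rho z -> \forall w \near z, G w = F w.
  move=> dz; have : \forall w \near z, - (d / 2) < rho w by exact: (cvgr_gt _ (cr z) _ dz).
  apply: filterS => w dw.
  by rewrite /G /s step1 ?(ltW dw)// mul1r addrK.
have Gle z : Omega z -> rho z <= - d -> G z = - (d / 4).
  by move=> _ dz; rewrite /G /s step0// mul0r sub0r.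
exists G; split=> // [z Oz|z bz|z Oz Gz].
- have [dz|dz] := leP (rho z) (- d); first by rewrite Gle//; lra.
  have r0 := rO z Oz; have Fz := Fle z Oz dz.
  have s0 : 0 <= s z := step_ge0 _ dd; have s1 : s z <= 1 := step_le1 _ dd.
  have [sz|sz] := eqVneq (s z) 0; first by rewrite /G sz mul0r; lra.
  have sp : 0 < s z by rewrite lt_neqAle eq_sym sz.
  have : 0 < s z * - F z by rewrite mulr_gt0//; lra.
  have : 0 <= (1 - s z) * (d / 4) by rewrite mulr_ge0//; lra.
  rewrite /G; lra.
- by apply: GF; rewrite rb//; lra.
have dz : - d < rho z by rewrite ltNge; apply/negP => dz; move: Gz; rewrite Gle// ltxx.
split=> //; apply: GF; rewrite ltNge; apply/negP => dz'.
have Fz := Fle z Oz dz.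
have s0 : 0 <= s z := step_ge0 _ dd; have s1 : s z <= 1 := step_le1 _ dd.
have : 0 <= s z * (- (d / 4) - F z) by rewrite mulr_ge0//; lra.
move: Gz; rewrite /G; lra.
Qed.

Lemma near_eq_hess f g z k l : (\forall w \near z, f w = g w) -> hess f z k l = hess g z k l.
Proof. exact: near_eq_partial2. Qed.

Lemma levi_mx_ext f g z : (forall k l, hess f z k l = hess g z k l) -> levi_mx f z = levi_mx g z.
Proof.
move=> fg; have E : hess f z = hess g z by apply/funext => k; apply/funext => l.
exact: congr1 E.
Qed.

Lemma near_eq_levi_mx f g z : (\forall w \near z, f w = g w) -> levi_mx f z = levi_mx g z.
Proof.
by move=> fg; apply: levi_mx_ext => k l; exact: near_eq_hess.
Qed.

Lemma det_levi_mx_bounded u : smooth u -> bounded_set Omega ->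
  exists2 M, 0 <= M & forall z, Omega z -> \det (levi_mx u z) <= M%:C.
Proof.
move=> su bO; have [neO|neO] := pselect (Omega !=set0); last first.
  by exists 0 => // z Oz; case: neO; exists z.
have [B [sB BE]] : exists B : V -> R, smooth B /\ forall z, \det (levi_mx u z) = (B z)%:C.
  have [s1 _] : csmooth (fun z => \det (levi_mx u z)).
    by apply: csmooth_det => i j; exact: csmooth_levi_mx.
  exists (fun z => complex.Re (\det (levi_mx u z))); split; first exact: s1.
  by move=> z; exact: det_levi_mx_real.
have clO0 : closure Omega !=set0.
  by case: neO => z Oz; exists z; exact: subset_closure.
have [c _ cmax] := compact_EVT_max clO0 (closure_compact bO)
  (continuous_subspaceT (smooth_continuous sB)).
exists `|B c| => // z Oz.
rewrite BE lecR; apply: le_trans (ler_norm _).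
by apply: cmax; rewrite inE; exact: subset_closure.
Qed.

(** A convex cutoff makes the extended function constant outside the collar, where
    nothing is known about its Levi form.  The determinant is controlled by the
    distance near the boundary, and by compactness away from it, where the
    distance is bounded below. *)
Lemma psh_defining_function q : (0 < n)%N -> Omega !=set0 -> open Omega ->
  bounded_set Omega -> strictly_pseudoconvex Omega ->
  exists (G : V -> R) (c : R), [/\ smooth_defining_function Omega G,
    plurisubharmonic_on Omega G & forall z, Omega z ->
      \det (complex_hessian G z) <= (c * euclidean_dist z (boundary Omega) ^+ q)%:C].
Proof.
move=> hn O0 oO bO spc.
have [rho [sr rO rb Sr]] := global_defining_function oO bO spc.
have bd0 : boundary Omega !=set0 := boundary_nonempty (lshift n (Ordinal hn)) oO bO O0.
have [F [d [sF d0 Fb FO]]] := collar_solution q oO bO sr rO rb Sr.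
have Fle z : Omega z -> - d < rho z -> F z <= rho z / 2.
  by move=> Oz dz; have [] := FO z Oz dz.
have [E [sE EO EFb EFO]] := collar_extension d0 sr sF rO rb Fle.
have ab : - (d / 8) < - (d / 16) by lra.
have b0 : - (d / 16) < 0 by lra.
have [H [dH H0 Hneg Hge Hab]] := convex_cutoff ab b0.
have sG : smooth (fun z => H 0%N (E z)) by apply: smooth_comp => //; exists H.
have Eb z : boundary Omega z -> E z = 0.
  by move=> bz; rewrite (nbhs_singleton (EFb z bz)); have [] := Fb z bz.
have hG z k l := hess_comp z k l dH sE.
have [L L0 Lrho] := vanishing_le_dist sr bO bd0 rb.
have [L' L'0 LE] := vanishing_le_dist sE bO bd0 Eb.
have [M M0 GM] := det_levi_mx_bounded sG bO.
exists (fun z => H 0%N (E z)), (2 * L ^+ q + M * (L' * 16 / d) ^+ q); split.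
- split.
  + by exists setT; split=> //; exact: openT.
  + by move=> z Oz; apply: Hneg; exact: EO.
  + by move=> z bz; rewrite Eb.
  + move=> z bz; have [_ [k rk] _] := Sr z bz.
    have E0 := Eb z bz; have bE : - (d / 16) < E z by rewrite E0.
    have [H1 _] := (Hab (E z)).2 bE.
    apply: contra_neq rk => g0; have := congr1 (fun v : V => v 0 k) g0; rewrite !mxE.
    rewrite (partial_comp k sE (dH 0%N (E z))) H1 mul1r.
    by rewrite (near_eq_partial k (EFb z bz)) (Fb z bz).2.
- apply: plurisubharmonic_of_levi sG _ => z Oz W.
  rewrite (levi_quad_ext W (hG z)) levi_quadD levi_quadZ levi_quad_rank1 levi_quadZ.
  have /andP[H1 H2] := Hge (E z).
  have [Ez|Ez] := ltP (E z) (- (d / 8)).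
    by have [-> ->] := (Hab (E z)).1 Ez; rewrite !mul0r addr0.
  have Ez4 : - (d / 4) < E z by apply: lt_le_trans Ez; lra.
  have [dz EF] := EFO z Oz Ez4.
  apply: addr_ge0; first by rewrite mulr_ge0// addr_ge0// -expr2 sqr_ge0.
  rewrite mulr_ge0//.
  rewrite (levi_quad_ext (T := hess F z) W (fun k l => near_eq_hess k l EF)).
  by have [_ + _] := FO z Oz dz; exact.
move=> z Oz; rewrite complex_hessianE// -/(levi_mx _ z).
set D := euclidean_dist z (boundary Omega).
have LDr := Lrho z Oz; have LDE := LE z Oz; rewrite -/D in LDr LDE.
have D0 : 0 <= D.
  by rewrite -(pmulr_rge0 _ L0); apply: le_trans LDr.
have Dq : 0 <= D ^+ q by rewrite exprn_ge0.
have cq : 0 <= (L' * 16 / d) ^+ q by rewrite exprn_ge0// divr_ge0 ?mulr_ge0// ltW.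
have [Ez|Ez] := ltP (- (d / 16)) (E z); last first.
  apply: le_trans (GM z Oz) _; rewrite lecR mulrDl -[M * _ * _]mulrA -exprMn.
  have h1 : 1 <= (L' * 16 / d * D) ^+ q.
    apply: exprn_ege1; rewrite mulrAC ler_pdivlMr// mul1r.
    have := ler_norm (- E z); rewrite normrN; move: LDE Ez.
    set x := `|E z|; set y := E z; lra.
  have := ler_wpM2l M0 h1; rewrite mulr1 => h2; apply: (le_trans h2).
  by rewrite lerDr -mulrA mulr_ge0// mulr_ge0// exprn_ge0// ltW.
have Ez4 : - (d / 4) < E z by apply: lt_trans Ez; lra.
have [dz EF] := EFO z Oz Ez4.
have [H1 H2] := (Hab (E z)).2 Ez.
have -> : levi_mx (fun z => H 0%N (E z)) z = levi_mx F z.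
  refine (etrans _ (near_eq_levi_mx EF)).
  apply: levi_mx_ext => k l.
  by refine (etrans (hG z k l) _); rewrite H1 H2 mul0r mul1r add0r.
have [_ _ dF] := FO z Oz dz; apply: (le_trans dF); rewrite lecR [leRHS]mulrDl.
apply: ler_wpDr; first by rewrite !mulr_ge0.
rewrite -mulrA -exprMn; apply: ler_wpM2l => //; apply: lerXn2r;
  rewrite ?nnegrE ?oppr_ge0 ?(ltW (rO z Oz))// ?mulr_ge0// ?(ltW L0)//.
by apply: le_trans LDr; rewrite -normrN; exact: ler_norm.
Qed.

End Gluing.
Theorem theorem2p2 (R : realType) (n : nat) (hn : (0 < n)%N)
    (Omega : set 'rV[R]_(n + n))
    (Omega_domain : is_domain Omega)
    (Omega_bounded : bounded_set Omega)
    (Omega_smooth : smooth_boundary Omega)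
    (Omega_spc : strictly_pseudoconvex Omega)
    (q : nat) (hq : (0 < q)%N) :
  exists (rho : 'rV[R]_(n + n) -> R) (C : R),
    [/\ smooth_defining_function Omega rho,
        plurisubharmonic_on Omega rho &
        forall z, Omega z ->
          \det (complex_hessian rho z)
            <= (C * euclidean_dist z (boundary Omega) ^+ q)%:C].
Proof.
case: Omega_domain => Omega_open _ Omega_neq0.
exact: psh_defining_function hn Omega_neq0 Omega_open Omega_bounded Omega_spc.
Qed.
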